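(* Let $\gamma:(-\delta_0,\delta_0)\to\mathbb{R}^3$ be a smooth unit speed space curve, with $\ddot\gamma$ nowhere zero, and let $x_0=\gamma(0)$, $y=\gamma(\delta)$. For all $\delta,\sigma,\varepsilon>0$ sufficiently small with $\max(\sigma,\varepsilon)\le\frac{\delta}{4}$, it holds that $$ W_1(\mu_{x_0}^{\sigma,\varepsilon},\mu_y^{\sigma,\varepsilon})=\|x_0-y\|\left(1+\frac{\sigma^2}{4R^2}-\frac{\varepsilon^2}{6R^2}\right)+O(\delta^4), $$ where $R=\frac{1}{\|\ddot\gamma(0)\|}$ is the radius of the osculating circle.
   Context: $\gamma$ is fixed ($\delta_0>0$ small, so that $\gamma$ is an embedding), $M=\gamma((-\delta_0,\delta_0))$, $\|\cdot\|$ is the Euclidean norm. For $\sigma>0$ small, $M_\sigma=\{x+v: x\in M,\ v\in (T_xM)^\perp,\ \|v\|\le\sigma\}\subset\mathbb{R}^3$, and $\pi$ is the nearest-point projection onto $M$, well defined near $x_0$ when $\sigma$ is small. Let $d_M$ be the arc-length distance along $\gamma$ and $\mu$ the Lebesgue measure on $\mathbb{R}^3$. For $x\in M$, $$B_{\sigma,\varepsilon}(x)=\{z\in M_\sigma: d_M(\pi(z),x)<\varepsilon\},\qquad \mu_x^{\sigma,\varepsilon}(A)=\frac{\mu(A\cap B_{\sigma,\varepsilon}(x))}{\mu(B_{\sigma,\varepsilon}(x))}$$ for Borel $A\subset\mathbb{R}^3$. $W_1$ is the 1-Wasserstein distance with Euclidean cost. ''$+O(\delta^4)$ for all sufficiently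 small parameters'' means: there are $C,\delta_1>0$, depending only on $\gamma$, such that for all $\delta\in(0,\delta_1)$ and all $\sigma,\varepsilon>0$ with $\max(\sigma,\varepsilon)\le\delta/4$ the remainder is at most $C\delta^4$ in absolute value. *)

(* Defs.v *)
From HB Require Import structures.
From mathcomp Require Import all_boot all_order all_algebra.
From mathcomp Require Import all_classical all_reals all_analysis.

Set Implicit Arguments.
Unset Strict Implicit.
Unset Printing Implicit Defensive.

Import Order.TTheory GRing.Theory Num.Theory.
Import numFieldNormedType.Exports.

Local Open Scope ring_scope.
Local Open Scope classical_set_scope.

(** R^3 as an iterated product.  The library norm [`|x|] on it is the sup norm;
    the Euclidean norm is [enorm] below.  [mspace3 R] is convertible to
    [space3 R]; it carries the measurable structure over which the library's
    [lebesgue_measure] is defined (product of the Borel sigma-algebras of R,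
    i.e. the Borel sigma-algebra of R^3). *)
Notation space3 R := (R * R * R)%type.
Notation mspace3 R :=
  (measurableTypeR R * measurableTypeR R * measurableTypeR R)%type.

Definition dot (R : realType) (x y : space3 R) : R :=
  x.1.1 * y.1.1 + x.1.2 * y.1.2 + x.2 * y.2.

Definition enorm (R : realType) (x : space3 R) : R := Num.sqrt (dot x x).

Definition lebesgue3 (R : realType) : set (mspace3 R) -> \bar R :=
  ((@lebesgue_measure R \x @lebesgue_measure R) \x @lebesgue_measure R)%E.

HB.instance Definition _ (R : realType) :=
  Measure.copy (@lebesgue3 R)
    ((@lebesgue_measure R \x @lebesgue_measure R) \x @lebesgue_measure R)%E.

Section curves.
Context {R : realType}.
Implicit Types (I : set R) (gamma : R -> space3 R).

Definition smooth_on I gamma :=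
  forall n t, I t -> derivable (gamma^`(n)) t 1.

Definition unit_speed_on I gamma :=
  forall t, I t -> enorm (derive1 gamma t) = 1.

(** Homeomorphism onto the image; for the unit speed curves considered here
    the immersion condition is automatic. *)
Definition embedding_on I gamma :=
  [/\ {in I &, injective gamma},
      {within I, continuous gamma} &
      forall U, open U ->
        exists2 V, open V & gamma @` (U `&` I) = V `&` (gamma @` I)].

Definition tangent_space I gamma (x : space3 R) : set (space3 R) :=
  [set w | exists t c, [/\ I t, gamma t = x & w = c *: derive1 gamma t]].

Definition tube I gamma (sigma : R) : set (space3 R) :=
  [set z | exists x v, [/\ (gamma @` I) x,
      forall w, tangent_space I gamma x w -> dot v w = 0,
      enorm v <= sigma & z = x + v]].

(** [is_proj M z p] is "pi(z) is defined and equal to p": [p] is the unique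
    point of [M] nearest to [z].  The projection is only partially defined. *)
Definition is_proj (M : set (space3 R)) (z p : space3 R) :=
  M p /\ forall q, M q -> q <> p -> enorm (z - p) < enorm (z - q).

Definition curve_param I gamma (x : space3 R) : R :=
  xget 0 [set t | I t /\ gamma t = x].

Definition arc_dist I gamma (x y : space3 R) : \bar R :=
  let s := curve_param I gamma x in let t := curve_param I gamma y in
  (\int[lebesgue_measure]_(u in `[Num.min s t, Num.max s t])
     (enorm (derive1 gamma u))%:E)%E.

Definition tube_ball I gamma (sigma eps : R) (x : space3 R) : set (space3 R) :=
  [set z | tube I gamma sigma z /\
     exists p, is_proj (gamma @` I) z p /\ (arc_dist I gamma p x < eps%:E)%E].

Definition tube_measure I gamma (sigma eps : R) (x : space3 R)
    (A : set (mspace3 R)) : \bar R :=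
  let B := tube_ball I gamma sigma eps x in
  (lebesgue3 (A `&` B) / lebesgue3 B)%E.

End curves.

Section wasserstein.
Context {R : realType}.
Implicit Types mu nu : set (mspace3 R) -> \bar R.

Definition is_coupling mu nu
    (P : probability (mspace3 R * mspace3 R)%type R) :=
  forall A : set (mspace3 R), measurable A ->
    pushforward P fst A = mu A /\ pushforward P snd A = nu A.

(** The infimum is [+oo] if there is no coupling, in particular if [mu] or
    [nu] does not restrict to a probability measure on the Borel sets. *)
Definition W1 mu nu : \bar R :=
  ereal_inf [set (\int[P]_z (enorm ((z.1 : space3 R) - z.2))%:E)%E
            | P in is_coupling mu nu].

End wasserstein.

(* Main.v *)
(* Let T, k be the tangent and the curvature vector of the curve, and let (p, q)
   be an orthonormal frame of the normal planes. In the normal disc of radius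
   sigma at time t, replace the point with coordinates u by the one with
   coordinates w = u + l (k.p, k.q), where l = (|w|^2 - sigma^2) / 2. This makes
   the parametrization of the tube by (t, u) volume preserving, the usual density
   1 - w.k being compensated by the shift. So the measures mu_x are the images of
   the uniform law on ]-eps, eps[ x disc, and (t, u) |-> (point at t, point at
   delta - t) is a coupling. Its displacement D is a multiple b >= 1/4 of the
   chord up to O(delta^3), hence |D| = D.e + O(delta^5), where e is the direction
   of the chord; and the mean of D.e is a lower bound for the cost of any
   coupling, since z |-> |e.z + a| is 1-Lipschitz. Finally the average of D.e over
   (+-t, +-u) is |x0 - y| - kappa^2 delta (t^2 + |u|^2 - sigma^2) / 2 up to
   O(delta^4), and the means of t^2 and |u|^2 are eps^2 / 3 and sigma^2 / 2. *)

From HB Require Import structures.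
From mathcomp Require Import all_boot all_order all_algebra.
From mathcomp Require Import all_classical all_reals all_analysis.
From mathcomp Require Import measurable_realfun ring lra.
Require Import Defs.
Set Implicit Arguments.
Unset Strict Implicit.
Unset Printing Implicit Defensive.
Import Order.TTheory GRing.Theory Num.Theory.
Import numFieldNormedType.Exports.
Local Open Scope ring_scope.
Local Open Scope classical_set_scope.

(** * Change of variables on the line and in the plane *)

(** Both the coupling and the frame are tuned to keep the displacement parallel to the chord up to
    O(delta^3). Pairing t with delta + t would move points along the tangent at time delta / 2 + t,
    which makes an angle of order t with the chord: the transversal part would be O(delta^2), and
    its square divided by the length would cost O(delta^3). Points at t and delta - t are symmetric
    about the midpoint, where the even Taylor terms cancel. A frame twisting around the curve would
    likewise turn the offsets u, of size delta, by an angle of order delta, again a transversal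
    O(delta^2); hence a frame carried along by rotations without twist, rather than one attached to
    the curvature vector. The shift preserves volume because its inverse w |-> w - (|w|^2 - sigma^2)
    / 2 k has Jacobian determinant 1 - w.k and fixes the boundary circle. As this is exact, both
    marginals are exact images of one parameter law, and only the displacement has to be
    expanded. *)

Section density_measure.
Context d (T : measurableType d) (R : realType).
Variables (mu : {measure set T -> \bar R}) (h : T -> R).
Hypotheses (mh : measurable_fun setT h) (h0 : forall x, 0 <= h x).

Definition density (A : set T) : \bar R := (\int[mu]_(x in A) (h x)%:E)%E.

Let density0 : density set0 = 0%E.
Proof. exact: integral_set0. Qed.

Let density_ge0 A : (0 <= density A)%E.
Proof. by apply: integral_ge0 => x _; rewrite lee_fin. Qed.

Let density_sigma_additive : semi_sigma_additive density.
Proof.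
move=> F mF tF mUF; rewrite /density ge0_integral_bigcup//.
- apply: is_cvg_ereal_nneg_natsum_cond => n _ _.
  by apply: integral_ge0 => x _; rewrite lee_fin.
- by apply/measurable_EFinP; exact: measurable_funS mh.
- by move=> x _; rewrite lee_fin.
Qed.

HB.instance Definition _ := isMeasure.Build _ _ _
  density density0 density_ge0 density_sigma_additive.

Definition density_as_measure : {measure set T -> \bar R} := density.
End density_measure.

Definition image_measure d d' (T1 : measurableType d) (T2 : measurableType d')
    (R : realType) (m : {measure set T1 -> \bar R}) (f : T1 -> T2)
    (mf : measurable_fun setT f) : {measure set T2 -> \bar R} :=
  (measure_function_pushforward__canonical__measure_function_Measure m mf).

Section one_dim.
Context {R : realType}.
Notation mR := (measurableTypeR R).
Notation lam := (@lebesgue_measure R).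
Implicit Types (G g : R -> R).

Lemma is_derive_within_continuous G g (a b : R) :
  (forall t, a <= t <= b -> is_derive t 1 G (g t)) ->
  {within `[a, b], continuous G}.
Proof.
move=> dG; apply: derivable_within_continuous => t; rewrite in_itv/= => tab.
by have [] := dG _ tab.
Qed.

Lemma is_derive_increasing G g (a b : R) :
  (forall t, a <= t <= b -> is_derive t 1 G (g t)) ->
  (forall t, a <= t <= b -> 0 < g t) ->
  forall x y, a <= x -> x < y -> y <= b -> G x < G y.
Proof.
move=> dG g0 x y ax xy yb.
have H t : t \in `]x, y[%R -> is_derive t 1 G (g t).
  rewrite in_itv/= => /andP[xt ty]; apply: dG.
  by rewrite (le_trans ax (ltW xt)) (le_trans (ltW ty) yb).
have H2 : {within `[x, y], continuous G}.
  apply: (@is_derive_within_continuous _ g) => t /andP[xt ty]; apply: dG.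
  by rewrite (le_trans ax xt) (le_trans ty yb).
have [c] := MVT xy H H2.
rewrite in_itv/= => /andP[xc cy] /eqP; rewrite subr_eq => /eqP ->.
rewrite ltrDr mulr_gt0 ?subr_gt0//; apply: g0.
by rewrite (le_trans ax (ltW xc)) (le_trans (ltW cy) yb).
Qed.

Lemma FTC_is_derive G g (a b : R) : a <= b ->
  (forall t, a <= t <= b -> is_derive t 1 G (g t)) ->
  (forall t, a <= t <= b -> {for t, continuous g}) ->
  (\int[lam]_(t in `[a, b]) (g t)%:E = (G b - G a)%:E)%E.
Proof.
move=> ab dG cg; have [->|aneb] := eqVneq a b.
  by rewrite set_itv1 integral_set1 subrr.
have {aneb}ab : a < b by rewrite lt_neqAle aneb.
rewrite (@continuous_FTC2 R g G)//.
- apply: continuous_in_subspaceT => t; rewrite inE/= in_itv/= => tab.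
  exact: cg.
- have cG := @is_derive_within_continuous _ _ _ _ dG.
  have /(continuous_within_itvP _ ab)[_ ca cb] := cG.
  split => // t; rewrite in_itv/= => /andP[ta tb].
  by have [] : is_derive t 1 G (g t) by apply: dG; rewrite !ltW.
- move=> t; rewrite in_itv/= => /andP[ta tb]; rewrite derive1E.
  by have [_ ->] : is_derive t 1 G (g t) by apply: dG; rewrite !ltW.
Qed.

(** Both sides are measures in A, so it suffices to compare them on the rays [x, +oo[, a pi-system
    that generates the Borel sets. On these the preimage under G is an interval ending at b, and the
    fundamental theorem of calculus applies. *)
Lemma substitution_increasing G g (a b : R) : a <= b ->
  (forall t, a <= t <= b -> is_derive t 1 G (g t)) ->
  (forall t, a <= t <= b -> {for t, continuous g}) ->
  (forall t, a <= t <= b -> 0 < g t) ->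
  measurable_fun [set: mR] (G : mR -> mR) -> measurable_fun [set: mR] (g : mR -> mR) ->
  forall A : set mR, measurable A ->
  lam (A `&` `[G a, G b]) = (\int[lam]_(t in `[a, b]) (\1_A (G t) * g t)%:E)%E.
Proof.
move=> ab dG cg g0 mG mg A mA.
have incr := is_derive_increasing dG g0.
have ndecr x y : a <= x -> x <= y -> y <= b -> G x <= G y.
  by move=> ax; rewrite le_eqVlt => /predU1P[->//|xy] yb; apply/ltW/incr.
pose D : set mR := `[a, b].
have mD : measurable D by exact: measurable_itv.
(* A density must be nonnegative everywhere, and the sign of g is known on [a, b] only; hence the
   cutoff. *)
pose h (x : mR) : R := \1_D x * g x.
have mh : measurable_fun setT h.
  by apply: measurable_funM => //; exact: measurable_indic.
have h0 x : 0 <= h x.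
  rewrite /h indicE; case: (boolP (x \in D)) => [|_]; last by rewrite mul0r.
  by rewrite inE /D/= in_itv/= mul1r => /g0/ltW.
pose m1 : {measure set mR -> \bar R} := image_measure (density_as_measure lam mh h0) mG.
pose m2 : {measure set mR -> \bar R} := mrestr lam (measurable_itv `[G a, G b]%R).
have m1E B : measurable B -> m1 B = (\int[lam]_(t in `[a, b]) (\1_B (G t) * g t)%:E)%E.
  move=> mB; rewrite /m1/= /pushforward/= /density.
  rewrite integral_mkcond [RHS]integral_mkcond; apply: eq_integral => t _.
  rewrite !patchE; rewrite /h !indicE mem_setE.
  have -> : (t \in G @^-1` B) = (G t \in B) by apply/idP/idP; rewrite !inE.
  by case: (G t \in B); case: (t \in _) => //=; rewrite ?mul1r ?mul0r.
suff H B : measurable B -> m1 B = m2 B by rewrite -m1E// H.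
apply: (@measure_unique _ R mR (@RGenCInfty.G R)
  (fun n => `[- n%:R, +oo[%classic) _ _ _ _ m1 m2).
- exact: RGenCInfty.measurableE.
- move=> _ _ [x ->] [y ->]; exists (Num.max x y).
  apply/seteqP; split => z /=; rewrite !in_itv/= !andbT ge_max.
    by move=> [-> ->].
  by move=> /andP[].
- by move=> n; exists (- n%:R).
- apply/seteqP; split => // x _; exists `|Num.ceil (- x)|%N => //=.
  rewrite in_itv/= andbT lerNl natr_absz.
  by rewrite (le_trans (ceil_ge _))// ler_int ler_norm.
- move=> _ [x ->]; rewrite m1E; last exact: measurable_itv.
  have GaGb : G a <= G b by exact: ndecr.
  (* By the intermediate value theorem x' = G tau, so the ray pulls back to [tau, b]. Rays starting
     before G a are replaced by the one at G a; those starting after G b contribute nothing. *)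
  have step x' : G a <= x' <= G b ->
    (\int[lam]_(t in `[a, b]) (\1_`[x', +oo[ (G t) * g t)%:E)%E = (G b - x')%:E.
    move=> /andP[Gax xGb].
    have [|tau] := @IVT _ G a b x' ab (is_derive_within_continuous dG).
      by rewrite ge_min le_max Gax xGb orbT.
    rewrite in_itv/= => /andP[atau taub] <-.
    have dG' t : tau <= t <= b -> is_derive t 1 G (g t).
      by move=> /andP[? ?]; apply: dG; rewrite (le_trans atau).
    have cg' t : tau <= t <= b -> {for t, continuous g}.
      by move=> /andP[? ?]; apply: cg; rewrite (le_trans atau).
    rewrite -(FTC_is_derive taub dG' cg').
    rewrite integral_mkcond [RHS]integral_mkcond; apply: eq_integral => t _.
    rewrite !patchE !mem_setE !in_itv/= indicE mem_setE in_itv/= andbT.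
    have [at'|ta] /= := leP a t; last first.
      by rewrite (_ : tau <= t = false)//; apply/negbTE; rewrite -ltNge (lt_le_trans ta).
    have [tb|bt] /= := leP t b; last by rewrite andbF.
    rewrite andbT; have [taut|ttau] := leP tau t.
      by rewrite ndecr// mul1r.
    by rewrite leNgt incr//= mul0r.
  have [xGa|Gax] := ltP x (G a).
    transitivity (\int[lam]_(t in `[a, b]) (\1_`[G a, +oo[ (G t) * g t)%:E)%E.
      apply: eq_integral => t; rewrite inE/= in_itv/= => /andP[at' tb].
      by rewrite !indicE !mem_setE !in_itv/= !andbT (ltW (lt_le_trans xGa _)) ndecr.
    rewrite step ?lexx ?GaGb// /m2 /= /mrestr.
    rewrite (_ : _ `&` _ = `[G a, G b]); last first.
      apply/seteqP; split => z /=; rewrite !in_itv/= ?andbT; first by case.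
      by move=> /andP[az zb]; rewrite az zb; split=> //; exact: ltW (lt_le_trans xGa az).
    rewrite lebesgue_measure_itv/= lte_fin; case: ltgtP GaGb => // -> _.
    by rewrite subrr.
  have [xGb|Gbx] := leP x (G b).
    rewrite step ?Gax ?xGb// /m2 /= /mrestr.
    rewrite (_ : _ `&` _ = `[x, G b]); last first.
      apply/seteqP; split => z /=; rewrite !in_itv/= ?andbT.
        by move=> [-> /andP[_ ->]].
      by move=> /andP[az zb]; rewrite az zb (le_trans Gax).
    rewrite lebesgue_measure_itv/= lte_fin; case: ltgtP xGb => // -> _.
    by rewrite subrr.
  rewrite (@eq_integral _ _ _ lam _ (cst 0%E)); last first.
    move=> t; rewrite inE/= in_itv/= => /andP[at' tb].
    rewrite indicE mem_setE in_itv/= andbT leNgt (le_lt_trans _ Gbx)/= ?mul0r//.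
    exact: ndecr.
  rewrite integral0 /m2 /= /mrestr (_ : _ `&` _ = set0) ?measure0//.
  apply/seteqP; split => z //=; rewrite !in_itv/= andbT => -[xz /andP[_ zb]].
  by have := lt_le_trans Gbx (le_trans xz zb); rewrite ltxx.
- move=> k; apply: (@le_lt_trans _ _ (m1 setT)).
    by apply: le_measure; rewrite ?inE//=; exact: measurable_itv.
  rewrite m1E//.
  rewrite (@eq_integral _ _ _ lam _ (EFin \o g)); last first.
    by move=> t _; rewrite indicT mul1r.
  by rewrite (FTC_is_derive ab dG cg) ltry.
Qed.

(** A curve may run along a coordinate axis in either direction, hence the sign [sg]. When it is -1,
    reflect the target, which preserves Lebesgue measure. Taking A inside the image avoids naming an
    interval whose ends would depend on [sg]. *)
Lemma substitution_monotone G g (a b sg : R) : a <= b ->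
  sg = 1 \/ sg = -1 ->
  (forall t, a <= t <= b -> is_derive t 1 G (g t)) ->
  (forall t, a <= t <= b -> {for t, continuous g}) ->
  (forall t, a <= t <= b -> 0 < sg * g t) ->
  measurable_fun [set: mR] (G : mR -> mR) ->
  measurable_fun [set: mR] (g : mR -> mR) ->
  forall A : set mR, measurable A ->
  (forall x, A x -> exists2 t, a <= t <= b & G t = x) ->
  lam A = (\int[lam]_(t in `[a, b]) (\1_A (G t) * `|g t|)%:E)%E.
Proof.
move=> ab sgE dG cg g0 mG mg A mA AG.
case: sgE => sgE; rewrite {sg}sgE in g0.
  have {}g0 t : a <= t <= b -> 0 < g t by move/g0; rewrite mul1r.
  have incr := is_derive_increasing dG g0.
  have ndecr x y : a <= x -> x <= y -> y <= b -> G x <= G y.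
    by move=> ax; rewrite le_eqVlt => /predU1P[->//|xy] yb; apply/ltW/incr.
  rewrite (_ : A = A `&` `[G a, G b]); last first.
    rewrite setIidl// => x /AG[t /andP[at' tb] <-] /=.
    by rewrite in_itv/= !ndecr.
  rewrite (substitution_increasing ab dG cg g0)//.
  apply: eq_integral => t; rewrite inE/= in_itv/= => /andP[at' tb].
  rewrite gtr0_norm ?g0 ?at'//; congr ((_ * _)%:E); rewrite !indicE; congr (_%:R).
  apply: congr1; apply/idP/idP; rewrite !inE; last by case.
  by move=> AGt; split => //=; rewrite in_itv/= !ndecr.
have {}g0 t : a <= t <= b -> 0 < - g t by move/g0; rewrite mulN1r.
have dG' t : a <= t <= b -> is_derive t 1 (fun t => - G t) (- g t).
  by move=> tab; apply: is_deriveN; exact: dG.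
have cg' t : a <= t <= b -> {for t, continuous (fun t => - g t)}.
  by move=> tab; apply: (@continuousN R R R); exact: cg.
have incr := is_derive_increasing dG' g0.
have ndecr x y : a <= x -> x <= y -> y <= b -> - G x <= - G y.
  by move=> ax; rewrite le_eqVlt => /predU1P[->//|xy] yb; apply/ltW/incr.
have mN : measurable_fun [set: mR] (-%R : mR -> mR) by exact: oppr_measurable.
have mA' : measurable ((-%R : mR -> mR) @^-1` A).
  by rewrite -[X in measurable X]setTI; exact: mN.
rewrite -lebesgue_measureN// /pushforward.
rewrite (_ : _ @^-1` A = (-%R : mR -> mR) @^-1` A `&` `[- G a, - G b]); last first.
  rewrite setIidl// => x /= /AG[t /andP[at' tb] /esym/eqP].
  by rewrite eqr_oppLR => /eqP ->; rewrite in_itv/= !ndecr.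
rewrite (substitution_increasing ab dG' cg' g0)//; last 2 first.
- exact: (measurableT_comp mN mG).
- exact: (measurableT_comp mN mg).
apply: eq_integral => t; rewrite inE/= in_itv/= => /andP[at' tb].
rewrite ltr0_norm -?oppr_gt0 ?g0 ?at'//; congr ((_ * _)%:E).
rewrite !indicE; congr (_%:R).
apply: congr1; apply/idP/idP; rewrite !inE /=; rewrite opprK; by [].
Qed.

Lemma measurable_affine (a b : R) :
  measurable_fun [set: mR] (fun x : mR => a * x + b : mR).
Proof. by apply: measurable_funD => //; exact: measurable_funM. Qed.

(** The image of Lebesgue measure multiplied by |a| has the right value on half-open intervals, and
    uniqueness concludes. For a < 0 the preimage of ]c, d] is closed at the other end, with the same
    length. *)
Lemma lebesgue_measure_affine (a b : R) (A : set mR) : a != 0 -> measurable A ->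
  lam ((fun x : mR => a * x + b : mR) @^-1` A) = (`|a|^-1%:E * lam A)%E.
Proof.
move=> a0 mA.
pose m : {measure set mR -> \bar R} :=
  mscale (NngNum (normr_ge0 a)) (image_measure lam (measurable_affine a b)).
rewrite [in RHS](@lebesgue_measure_unique R m)//.
  by rewrite /m/= /mscale/= muleA -EFinM mulVf ?normr_eq0// mul1e.
move=> _ [[c d]] _ <-; rewrite /m/= /mscale/= /pushforward.
have [a_gt0|a_le0] := ltP 0 a.
  rewrite (_ : _ @^-1` _ = `](c - b) / a, (d - b) / a]); last first.
    apply/seteqP; split => x /=; rewrite !in_itv/=;
      by rewrite ltr_pdivrMr// ler_pdivlMr// ltrBlDr lerBrDr mulrC.
  rewrite !lebesgue_measure_itv/= !lte_fin ltr_pM2r ?invr_gt0// ltrD2r.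
  case: ifP => _; last by rewrite mule0.
  by rewrite gtr0_norm// -!EFinD -EFinM; congr EFin; field; rewrite gt_eqF.
have {a_le0}a_lt0 : a < 0 by rewrite lt_neqAle a0.
rewrite (_ : _ @^-1` _ = `[(d - b) / a, (c - b) / a[); last first.
  apply/seteqP; split => x /=; rewrite !in_itv/=;
    by rewrite ler_ndivrMr// ltr_ndivlMr// ltrBlDr lerBrDr mulrC andbC.
rewrite !lebesgue_measure_itv/= !lte_fin ltr_nM2r ?invr_lt0// ltrD2r.
case: ifP => _; last by rewrite mule0.
by rewrite ltr0_norm// -!EFinD -EFinM; congr EFin; field; rewrite lt_eqF.
Qed.

Lemma ge0_integral_affine (a b : R) (f : mR -> \bar R) : a != 0 ->
  measurable_fun setT f -> (forall x, 0 <= f x)%E ->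
  (\int[lam]_x f (a * x + b)%R = `|a|^-1%:E * \int[lam]_x f x)%E.
Proof.
move=> a0 mf f0; have ia0 : 0 <= `|a|^-1 by rewrite invr_ge0.
transitivity (\int[mscale (NngNum ia0) lam]_x f x)%E; last first.
  by rewrite ge0_integral_mscale.
rewrite [RHS](@eq_measure_integral _ _ _ _
  (image_measure lam (measurable_affine a b))).
  by rewrite [RHS]ge0_integral_pushforward//; exact: measurable_affine.
by move=> A mA _; rewrite /= /pushforward lebesgue_measure_affine.
Qed.
End one_dim.

Section measurable_real_functions.
Context {R : realType}.
Context d (T : measurableType d).
Implicit Types f g : T -> measurableTypeR R.

Lemma measurable_invr : measurable_fun [set: measurableTypeR R]
  (fun x : measurableTypeR R => x^-1 : measurableTypeR R).
Proof.
(* The real power is thus taken of a nonnegative number only; at 0 both sides vanish, the inverse of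
   0 being 0. *)
rewrite (_ : (fun x => _) = (fun x : R => x * (x ^+ 2) `^ (-1))); last first.
  apply/funext => x; rewrite powR_inv1 ?sqr_ge0//.
  by have [->|x0] := eqVneq x 0; [rewrite invr0 mul0r|field].
apply: measurable_funM => //.
have mp : measurable_fun [set: measurableTypeR R]
  (fun x : measurableTypeR R => x `^ (-1) : measurableTypeR R).
  exact: measurable_powR.
have mx : measurable_fun [set: measurableTypeR R]
  (fun x : measurableTypeR R => x ^+ 2 : measurableTypeR R).
  exact: exprn_measurable.
exact: (measurableT_comp mp mx).
Qed.

Lemma measurable_sqrtr : measurable_fun [set: measurableTypeR R]
  (fun x : measurableTypeR R => Num.sqrt x : measurableTypeR R).
Proof. by apply: continuous_measurable_fun => x; exact: sqrt_continuous. Qed.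

Lemma measurable_funV f : measurable_fun setT f ->
  measurable_fun setT (fun x => (f x)^-1 : measurableTypeR R).
Proof. by move=> mf; exact: (measurableT_comp measurable_invr mf). Qed.

Lemma measurable_fun_sqrt f : measurable_fun setT f ->
  measurable_fun setT (fun x => Num.sqrt (f x) : measurableTypeR R).
Proof. by move=> mf; exact: (measurableT_comp measurable_sqrtr mf). Qed.

Lemma measurable_set_ler f g : measurable_fun setT f -> measurable_fun setT g ->
  measurable [set x | f x <= g x].
Proof.
move=> mf mg.
have := measurable_fun_ler mf mg => /(_ measurableT [set true] I).
rewrite setTI; congr measurable; apply/seteqP; split => x //=.
Qed.

Lemma measurable_set_ltr f g : measurable_fun setT f -> measurable_fun setT g ->
  measurable [set x | f x < g x].
Proof.
move=> mf mg.
have := measurable_fun_ltr mf mg => /(_ measurableT [set true] I).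
rewrite setTI; congr measurable; apply/seteqP; split => x //=.
Qed.
End measurable_real_functions.

Ltac measurability := cbv beta; lazymatch goal with
  | |- measurable_fun _ (fun _ => (_, _)) => apply: measurable_fun_pair; measurability
  | |- measurable_fun _ (fun _ => GRing.add _ (GRing.opp _)) =>
      apply: measurable_funB; measurability
  | |- measurable_fun _ (fun _ => GRing.add _ _) => apply: measurable_funD; measurability
  | |- measurable_fun _ (fun _ => GRing.mul _ _) => apply: measurable_funM; measurability
  | |- measurable_fun _ (fun _ => GRing.inv _) => apply: measurable_funV; measurability
  | |- measurable_fun _ (fun _ => GRing.opp _) => apply: measurable_funN; measurability
  | |- measurable_fun _ (fun _ => Num.sqrt _) => apply: measurable_fun_sqrt; measurability
  | |- measurable_fun _ (fun _ => GRing.exp _ _) => apply: measurable_funX; measurability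
  | |- measurable_fun _ (fun _ => ?c) => exact: measurable_cst
  | |- measurable_fun _ (fun x => x) => exact: measurable_id
  | |- measurable_fun _ (fun x => fst x) => exact: measurable_fst
  | |- measurable_fun _ (fun x => snd x) => exact: measurable_snd
  | |- measurable_fun _ (fun x => fst _) =>
      apply: (measurableT_comp measurable_fst); measurability
  | |- measurable_fun _ (fun x => snd _) =>
      apply: (measurableT_comp measurable_snd); measurability
  | |- _ => first
    [ exact: measurable_id | exact: measurable_cst | exact: measurable_fst
    | exact: measurable_snd | eassumption
    | apply: measurableT_comp => //; measurability ]
  end.

Lemma measure_integral_indic d (T : measurableType d) (R : realType)
    (mu : {measure set T -> \bar R}) (A : set T) : measurable A ->
  mu A = (\int[mu]_x (\1_A x)%:E)%E.
Proof. by move=> mA; rewrite integral_indic// setIT. Qed.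

(** * Linear changes of variables in the plane and the bent disc *)

Section two_dim.
Context {R : realType}.
Notation mR := (measurableTypeR R).
Notation lam := (@lebesgue_measure R).
Notation lam2 := (lam \x lam)%E.
Local Open Scope ereal_scope.

Lemma ge0_integral_swap (F : mR * mR -> \bar R) : measurable_fun setT F ->
  (forall x, 0 <= F x) ->
  \int[lam2]_y F (y.2, y.1) = \int[lam2]_y F y.
Proof.
move=> mF F0; rewrite [RHS]fubini_tonelli2// fubini_tonelli1//.
apply: (measurableT_comp mF); measurability.
Qed.

(** Gaussian elimination with pivot a: an affine change in the first variable with factor a, then,
    after exchanging the integrals, one in the second variable with factor (a d - b c) / a. *)
Lemma ge0_integral_linear_ne0 (a b c d e f : R) (F : mR * mR -> \bar R) :
  a != 0%R -> (a * d - b * c != 0)%R ->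
  measurable_fun setT F -> (forall x, 0 <= F x) ->
  \int[lam2]_y F (a * y.1 + b * y.2 + e, c * y.1 + d * y.2 + f)%R
  = `|a * d - b * c|^-1%:E * \int[lam2]_w F w.
Proof.
move=> a0 D0 mF F0.
rewrite fubini_tonelli2//; last first.
  by apply: (measurableT_comp mF); measurability.
rewrite /fubini_G/=.
transitivity (\int[lam]_y \int[lam]_x (`|a|^-1%:E *
   F (x, (a * d - b * c) / a * y + ((c / a) * (x - e) + f))%R)).
  apply: eq_integral => y _.
  rewrite ge0_integralZl//; last by apply: (measurableT_comp mF); measurability.
  rewrite -(@ge0_integral_affine R a (b * y + e)
    (fun x => F (x, ((a * d - b * c) / a * y + ((c / a) * (x - e) + f))%R)))//.
    by apply: eq_integral => x _; congr F; congr pair; [ring|field].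
  by apply: (measurableT_comp mF); measurability.
rewrite (fubini_tonelli (m1 := lam) (m2 := lam) (fun z => `|a|^-1%:E *
   F (z.2, (a * d - b * c) / a * z.1 + ((c / a) * (z.2 - e) + f))%R)); last 2 first.
- apply: emeasurable_funM => //.
  by apply: (measurableT_comp mF); measurability.
- by move=> z; rewrite mule_ge0// lee_fin invr_ge0.
transitivity (\int[lam]_x (`|a * d - b * c|^-1%:E * \int[lam]_y F (x, y))).
  apply: eq_integral => x _.
  rewrite ge0_integralZl//; last by apply: (measurableT_comp mF); measurability.
  have Da0 : ((a * d - b * c) / a != 0)%R by rewrite mulf_neq0// invr_eq0.
  have mFx : measurable_fun [set: mR] (fun y => F (x, y)).
    by apply: (measurableT_comp mF); measurability.
  have /= -> := ge0_integral_affine ((c / a) * (x - e) + f) Da0 mFx (fun y => F0 (x, y)).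
  rewrite muleA -EFinM normrM normfV invfM invrK mulrCA mulVf ?normr_eq0//.
  by rewrite mulr1.
rewrite ge0_integralZl//; last 2 first.
- exact: (measurable_fun_fubini_tonelli_F (m2 := lam) F).
- by move=> x _; exact: integral_ge0.
by rewrite [in RHS]fubini_tonelli1.
Qed.

(** If a = 0 then b is a pivot, and exchanging the two variables reduces to the previous case. *)
Lemma ge0_integral_linear (a b c d e f : R) (F : mR * mR -> \bar R) :
  (a * d - b * c != 0)%R ->
  measurable_fun setT F -> (forall x, 0 <= F x) ->
  \int[lam2]_y F (a * y.1 + b * y.2 + e, c * y.1 + d * y.2 + f)%R
  = `|a * d - b * c|^-1%:E * \int[lam2]_w F w.
Proof.
move=> D0 mF F0; have [a0|a0] := eqVneq a 0%R; last exact: ge0_integral_linear_ne0.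
have b0 : b != 0%R by apply: contra D0 => /eqP ->; rewrite a0 !mul0r subrr.
rewrite -ge0_integral_swap//=; last first.
  by apply: (measurableT_comp mF); measurability.
rewrite distrC -(@ge0_integral_linear_ne0 b a d c e f)//; last first.
  by rewrite -opprB oppr_eq0.
by apply: eq_integral => y _; congr F; congr (_ + _, _ + _)%R; rewrite addrC.
Qed.

Local Close Scope ereal_scope.

Definition disc (s : R) : set (mR * mR) := [set u | u.1 ^+ 2 + u.2 ^+ 2 <= s ^+ 2].

(* The root [l] of [l = (|u + l k|^2 - s^2) / 2] which is small when [k] is;
   written so as to make sense for [k = 0] too. *)
Definition bend_shift (s k1 k2 : R) (u : mR * mR) : R :=
  let q := 1 - (u.1 * k1 + u.2 * k2) in
  let n := u.1 ^+ 2 + u.2 ^+ 2 - s ^+ 2 in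
  n / (q + Num.sqrt (q ^+ 2 - (k1 ^+ 2 + k2 ^+ 2) * n)).

Definition bend (s k1 k2 : R) (u : mR * mR) : mR * mR :=
  (u.1 + bend_shift s k1 k2 u * k1, u.2 + bend_shift s k1 k2 u * k2).

Lemma measurable_disc s : measurable (disc s).
Proof. by apply: measurable_set_ler; measurability. Qed.

Lemma measurable_bend s k1 k2 : measurable_fun setT (bend s k1 k2).
Proof. by rewrite /bend /bend_shift; measurability. Qed.

(** Here the curvature vector is (K, 0) and b is the unaffected coordinate; [bend] has to send v
    back to a. The discriminant equals (1 - K a)^2, and the positivity of 1 - K a decides the sign
    of its root. *)
Lemma bend_shift_rot (s k K a b v : R) : 0 < K -> k = K ^+ 2 ->
  1 - K * a > 0 -> a ^+ 2 + b ^+ 2 <= s ^+ 2 -> v ^+ 2 + b ^+ 2 <= s ^+ 2 ->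
  v = a + K / 2 * (s ^+ 2 - b ^+ 2 - a ^+ 2) -> 1 - K * v > 0 ->
  let q := 1 - v * K in let n := v ^+ 2 + b ^+ 2 - s ^+ 2 in
  n / (q + Num.sqrt (q ^+ 2 - k * n)) = (a - v) / K.
Proof.
move=> K0 -> Ka ab vb vE Kv q n.
have -> : q ^+ 2 - K ^+ 2 * n = (1 - K * a) ^+ 2.
  by rewrite /q /n vE; field.
rewrite sqrtr_sqr gtr0_norm//.
have qp : 0 < q + (1 - K * a) by rewrite /q [v * K]mulrC addr_gt0.
apply/eqP; rewrite eqr_div ?(gt_eqF qp) ?(gt_eqF K0)//; apply/eqP.
by rewrite /n /q vE; field.
Qed.

(** The inverse of [bend] has differential I - k w^T, of determinant 1 - w.k, and maps the disc onto
    itself. Once k is rotated onto the first axis it moves points only along the chords parallel to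
    k, and the claim becomes a one-dimensional substitution on each chord. *)
Lemma disc_substitution (s k1 k2 : R) (E : set (mR * mR)) :
  0 < s -> (k1 ^+ 2 + k2 ^+ 2) * s ^+ 2 < 1 -> measurable E ->
  (\int[lam2]_w (\1_(E `&` disc s) w * (1 - (w.1 * k1 + w.2 * k2)))%:E =
   lam2 (disc s `&` bend s k1 k2 @^-1` E))%E.
Proof.
move=> s0 ks mE.
have mdisc := measurable_disc s.
have mED : measurable (E `&` disc s) by exact: measurableI.
have mbE : measurable (disc s `&` bend s k1 k2 @^-1` E).
  by apply: measurableI => //; rewrite -[X in measurable X]setTI; exact: measurable_bend.
have disc_lt1 (w : mR * mR) : disc s w -> w.1 * k1 + w.2 * k2 < 1.
  rewrite /disc/= => ws.
  have : (w.1 * k1 + w.2 * k2) ^+ 2 < 1.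
    apply: le_lt_trans ks; apply: (@le_trans _ _ ((w.1 ^+ 2 + w.2 ^+ 2) * (k1 ^+ 2 + k2 ^+ 2))).
      by have := sqr_ge0 (w.1 * k2 - w.2 * k1); nra.
    by rewrite mulrC ler_wpM2l ?addr_ge0 ?sqr_ge0.
  by nra.
have F0 (w : mR * mR) : 0 <= \1_(E `&` disc s) w * (1 - (w.1 * k1 + w.2 * k2)).
  rewrite indicE; case: (boolP (_ \in _)); last by rewrite mul0r.
  by rewrite inE => -[_ /disc_lt1]; rewrite mul1r subr_ge0 => /ltW.
(* The rotation used below divides by |k|. For k = 0 the map [bend] is the identity. *)
have [/eqP k0|k0] := eqVneq (k1 ^+ 2 + k2 ^+ 2) 0.
  have /andP[/eqP k10 /eqP k20] : (k1 == 0) && (k2 == 0).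
    by move: k0; rewrite paddr_eq0 ?sqr_ge0// !sqrf_eq0.
  rewrite k10 k20 (_ : bend s 0 0 = id); last first.
    by apply/funext => -[u1 u2]; rewrite /bend !mulr0 !addr0.
  rewrite preimage_id setIC measure_integral_indic; last exact: measurableI.
  by apply: eq_integral => w _; rewrite !mulr0 addr0 subr0 mulr1.
pose K := Num.sqrt (k1 ^+ 2 + k2 ^+ 2).
have kge0 : 0 <= k1 ^+ 2 + k2 ^+ 2 by rewrite addr_ge0 ?sqr_ge0.
have K0 : 0 < K by rewrite sqrtr_gt0 lt_neqAle eq_sym k0 kge0.
have KK : k1 ^+ 2 + k2 ^+ 2 = K ^+ 2 by rewrite sqr_sqrtr.
have Ks : K * s < 1.
  by rewrite KK -exprMn in ks; have := mulr_gt0 K0 s0; nra.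
pose rot (y : mR * mR) : mR * mR :=
  (k1 / K * y.1 + (- (k2 / K)) * y.2 + 0, k2 / K * y.1 + k1 / K * y.2 + 0).
have detE : k1 / K * (k1 / K) - - (k2 / K) * (k2 / K) = 1.
  transitivity ((k1 ^+ 2 + k2 ^+ 2) / K ^+ 2); first by field; rewrite gt_eqF.
  by rewrite KK divff// expf_neq0// gt_eqF.
have mrot : measurable_fun setT rot by rewrite /rot; measurability.
have rotint (F : mR * mR -> \bar R) : measurable_fun setT F -> (forall x, 0 <= F x)%E ->
    (\int[lam2]_w F w = \int[lam2]_y F (rot y))%E.
  move=> mF F0'; rewrite ge0_integral_linear ?detE ?oner_eq0//.
  by rewrite normr1 invr1 mul1e.
have rot_disc y : disc s (rot y) = (y.1 ^+ 2 + y.2 ^+ 2 <= s ^+ 2) :> Prop.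
  rewrite /disc/= /rot/=; congr (is_true (_ <= _)).
  transitivity ((k1 ^+ 2 + k2 ^+ 2) / K ^+ 2 * (y.1 ^+ 2 + y.2 ^+ 2)).
    by field; rewrite gt_eqF.
  by rewrite KK divff ?mul1r// expf_neq0// gt_eqF.
have rot_dot y : (rot y).1 * k1 + (rot y).2 * k2 = y.1 * K.
  rewrite /rot/=; transitivity ((k1 ^+ 2 + k2 ^+ 2) / K * y.1); first by field; rewrite gt_eqF.
  by rewrite KK; field; rewrite gt_eqF.
have mF1 : measurable_fun setT (fun w : mR * mR =>
    (\1_(E `&` disc s) w * (1 - (w.1 * k1 + w.2 * k2)))%:E).
  apply/measurable_EFinP; apply: measurable_funM; first exact: measurable_indic.
  by measurability.
have mF2 : measurable_fun setT (fun w : mR * mR =>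
    (\1_(disc s `&` bend s k1 k2 @^-1` E) w : R)%:E).
  by apply/measurable_EFinP; exact: measurable_indic.
rewrite (rotint _ mF1)// (measure_integral_indic _ mbE) (rotint _ mF2)//.
rewrite fubini_tonelli2; [|exact: (measurableT_comp mF1 mrot)|by move=> w; rewrite lee_fin].
rewrite [RHS]fubini_tonelli2; [|exact: (measurableT_comp mF2 mrot)|by move=> w; rewrite lee_fin].
apply: eq_integral => b _; rewrite /fubini_G.
have [bs|sb] := leP (b ^+ 2) (s ^+ 2); last first.
  have nd y : ~ disc s (rot (y, b)).
    by rewrite rot_disc/=; apply/negP; rewrite -ltNge (lt_le_trans sb)// lerDr sqr_ge0.
  transitivity (\int[lam]_x (cst 0%E x))%E; last apply/esym; apply: eq_integral => x _.
    by rewrite indicE memNset ?mul0r// => -[_ /nd].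
  by rewrite indicE memNset// => -[/nd].
pose c := Num.sqrt (s ^+ 2 - b ^+ 2).
have cc : c ^+ 2 = s ^+ 2 - b ^+ 2 by rewrite sqr_sqrtr// subr_ge0.
have c0 : 0 <= c by rewrite sqrtr_ge0.
have cs : c <= s by nra.
have cN : - c <= c by lra.
have in_c x : (x ^+ 2 + b ^+ 2 <= s ^+ 2) = (- c <= x <= c).
  by rewrite -lerBrDr -cc -ler_norml -[x ^+ 2]real_normK ?num_real// ler_pXn2r.
(* The inverse of [bend] on the chord at height b, of half-length c: it fixes both ends, and its
   derivative 1 - K a is the density to absorb. *)
pose G (a : mR) : mR := a + K / 2 * (c ^+ 2 - a ^+ 2).
pose g (a : mR) : mR := 1 - K * a.
have mG : measurable_fun [set: mR] G by rewrite /G; measurability.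
have mg : measurable_fun [set: mR] g by apply: measurable_funB => //; exact: measurable_funM.
have g0 t : - c <= t <= c -> 0 < 1 * g t.
  by move=> /andP[? tc]; rewrite mul1r /g; nra.
have dG t : - c <= t <= c -> is_derive t 1 G (g t).
  move=> _; rewrite /G /g; apply: is_derive_eq.
  by rewrite /GRing.scale/=; field.
have cg t : - c <= t <= c -> {for t, continuous g}.
  move=> _; rewrite /g; apply: cvgB; first exact: cvg_cst.
  by apply: cvgM; [exact: cvg_cst|exact: cvg_id].
have incr t x : - c <= t -> t <= x -> x <= c -> G t <= G x.
  move=> ct; rewrite le_eqVlt => /predU1P[->//|tx] xc.
  apply/ltW/(is_derive_increasing dG) => // y yc.
  by have := g0 y yc; rewrite mul1r.
have GNc : G (- c) = - c by rewrite /G; ring.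
have Gc : G c = c by rewrite /G; ring.
pose A : set mR := [set v | (disc s `&` bend s k1 k2 @^-1` E) (rot (v, b))].
have mA : measurable A.
  have mrb : measurable_fun [set: mR] (fun v : mR => rot (v, b)).
    by apply: (measurableT_comp mrot); measurability.
  by rewrite /A -[X in measurable X]setTI; exact: mrb.
have AG x : A x -> exists2 t, - c <= t <= c & G t = x.
  move=> [/= + _]; rewrite -/(disc s (rot (x, b))) rot_disc/= in_c => xc.
  have [|t] := @IVT _ G (- c) c x cN (is_derive_within_continuous dG).
    by rewrite GNc Gc ge_min le_max; case/andP: xc => -> ->; rewrite orbT.
  by rewrite in_itv/= => tc <-; exists t.
have AGa a : - c <= a <= c -> A (G a) <-> (E `&` disc s) (rot (a, b)).
  move=> ac.
  have Gac : - c <= G a <= c.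
    by case/andP: ac => a1 a2; rewrite -{1}GNc -{2}Gc !incr.
  have shiftE : bend_shift s k1 k2 (rot (G a, b)) = (a - G a) / K.
    have nE : (rot (G a, b)).1 ^+ 2 + (rot (G a, b)).2 ^+ 2 = G a ^+ 2 + b ^+ 2.
      rewrite /rot/=; transitivity ((k1 ^+ 2 + k2 ^+ 2) / K ^+ 2 * (G a ^+ 2 + b ^+ 2)).
        by field; rewrite gt_eqF.
      by rewrite KK divff ?mul1r// expf_neq0// gt_eqF.
    rewrite /bend_shift rot_dot/= nE.
    apply: bend_shift_rot => //; rewrite ?in_c//.
    - by have := g0 a ac; rewrite mul1r.
    - by rewrite /G cc; ring.
    - by have := g0 (G a) Gac; rewrite mul1r.
  have bendE : bend s k1 k2 (rot (G a, b)) = rot (a, b).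
    rewrite /bend shiftE /rot/=; congr pair.
      by field; rewrite gt_eqF.
    by field; rewrite gt_eqF.
  rewrite /A/= bendE -/(disc s (rot (G a, b))) -/(disc s (rot (a, b))) !rot_disc/= !in_c ac Gac.
  by split => -[].
transitivity (lam A); last by rewrite measure_integral_indic.
rewrite (substitution_monotone cN (or_introl erefl) dG cg g0)//.
rewrite [RHS]integral_mkcond; apply: eq_integral => a _.
rewrite patchE mem_setE in_itv/=; case: ifPn => ac.
  have /= -> := rot_dot (a, b); rewrite gtr0_norm; last by have := g0 a ac; rewrite mul1r.
  rewrite /g [a * K]mulrC; congr ((_ * _)%:E).
  rewrite !indicE; congr (_%:R); apply: congr1.
  by apply/idP/idP; rewrite !inE => /AGa; apply.
rewrite indicE memNset ?mul0r// => -[_]; rewrite rot_disc/= in_c.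
exact/negP.
Qed.
End two_dim.

(** * Euclidean geometry of curves *)

Section euclidean.
Context {R : realType}.
Implicit Types (x y z w : space3 R) (a b : R).

Lemma space3P x y : x.1.1 = y.1.1 -> x.1.2 = y.1.2 -> x.2 = y.2 -> x = y.
Proof. by case: x => -[? ?] ?; case: y => -[? ?] ? /= -> -> ->. Qed.

Lemma dotC x y : dot x y = dot y x.
Proof. by rewrite /dot; ring. Qed.
Lemma dotDl x y z : dot (x + y) z = dot x z + dot y z.
Proof. by rewrite /dot/=; ring. Qed.
Lemma dotDr x y z : dot z (x + y) = dot z x + dot z y.
Proof. by rewrite /dot/=; ring. Qed.
Lemma dotNl x z : dot (- x) z = - dot x z.
Proof. by rewrite /dot/=; ring. Qed.
Lemma dotNr x z : dot z (- x) = - dot z x.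
Proof. by rewrite /dot/=; ring. Qed.
Lemma dotZl a x z : dot (a *: x) z = a * dot x z.
Proof. by rewrite /dot/=/GRing.scale/=; ring. Qed.
Lemma dotZr a x z : dot z (a *: x) = a * dot z x.
Proof. by rewrite /dot/=/GRing.scale/=; ring. Qed.
Lemma dot0l z : dot 0 z = 0.
Proof. by rewrite /dot/=; ring. Qed.
Lemma dot0r z : dot z 0 = 0.
Proof. by rewrite /dot/=; ring. Qed.

Definition dotE := (dotDl, dotDr, dotNl, dotNr, dotZl, dotZr, dot0l, dot0r).

Lemma dot_ge0 x : 0 <= dot x x.
Proof. by rewrite /dot -!expr2 !addr_ge0 ?sqr_ge0. Qed.

Lemma enorm_ge0 x : 0 <= enorm x.
Proof. exact: sqrtr_ge0. Qed.

Lemma sqr_enorm x : enorm x ^+ 2 = dot x x.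
Proof. by rewrite sqr_sqrtr// dot_ge0. Qed.

Lemma dot_eq0 x : (dot x x == 0) = (x == 0).
Proof.
apply/idP/idP => [|/eqP ->]; last by rewrite dot0l.
rewrite /dot -!expr2 !paddr_eq0 ?addr_ge0 ?sqr_ge0// !sqrf_eq0.
by move=> /andP[/andP[/eqP x1 /eqP x2] /eqP x3]; apply/eqP; exact: space3P.
Qed.

Lemma enorm_eq0 x : (enorm x == 0) = (x == 0).
Proof. by rewrite -(sqrf_eq0 (enorm x)) sqr_enorm dot_eq0. Qed.

Lemma enorm_gt0 x : (0 < enorm x) = (x != 0).
Proof. by rewrite lt_neqAle enorm_ge0 andbT eq_sym enorm_eq0. Qed.

Lemma enorm0 : enorm (0 : space3 R) = 0.
Proof. by apply/eqP; rewrite enorm_eq0. Qed.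

Lemma dot_le_enorm x y : `|dot x y| <= enorm x * enorm y.
Proof.
rewrite -(@ler_pXn2r _ 2)// ?nnegrE ?mulr_ge0 ?enorm_ge0//.
rewrite real_normK ?num_real// exprMn !sqr_enorm /dot.
set a := x.1.1; set b := x.1.2; set c := x.2.
set d := y.1.1; set e := y.1.2; set f := y.2.
have -> : (a * a + b * b + c * c) * (d * d + e * e + f * f) =
  (a * d + b * e + c * f) ^+ 2 +
  ((a * e - b * d) ^+ 2 + (a * f - c * d) ^+ 2 + (b * f - c * e) ^+ 2) by ring.
by rewrite lerDl !addr_ge0 ?sqr_ge0.
Qed.

Lemma ler_dot x y : dot x y <= enorm x * enorm y.
Proof. exact: le_trans (ler_norm _) (dot_le_enorm _ _). Qed.

Lemma enormN x : enorm (- x) = enorm x.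
Proof. by rewrite /enorm dotNl dotNr opprK. Qed.

Lemma enorm_distC x y : enorm (x - y) = enorm (y - x).
Proof. by rewrite -enormN opprB. Qed.

Lemma enormZ a x : enorm (a *: x) = `|a| * enorm x.
Proof. by rewrite /enorm dotZl dotZr mulrA -expr2 sqrtrM ?sqr_ge0// sqrtr_sqr. Qed.

Lemma ler_enorm_sqr x a : 0 <= a -> dot x x <= a ^+ 2 -> enorm x <= a.
Proof. by move=> a0; rewrite -sqr_enorm ler_pXn2r// nnegrE enorm_ge0. Qed.

Lemma enorm_le_sqr x a : 0 <= a -> (enorm x <= a) = (dot x x <= a ^+ 2).
Proof. by move=> a0; rewrite -sqr_enorm ler_pXn2r// nnegrE enorm_ge0. Qed.

Lemma ler_enormD x y : enorm (x + y) <= enorm x + enorm y.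
Proof.
apply: ler_enorm_sqr; first by rewrite addr_ge0 ?enorm_ge0.
rewrite dotDl !dotDr sqrrD !sqr_enorm (dotC y x).
by have := ler_dot x y; lra.
Qed.

Lemma ler_enormB x y : enorm (x - y) <= enorm x + enorm y.
Proof. by rewrite -(enormN y) ler_enormD. Qed.

Lemma ler_enorm_distD z x y : enorm (x - y) <= enorm (x - z) + enorm (z - y).
Proof. by rewrite -{1}(subrK z x) -addrA ler_enormD. Qed.

(** Turns scalar Taylor estimates, tested against every direction w, into estimates in norm. For x =
    0 a nonzero test vector is still needed, to see that a is nonnegative. *)
Lemma enorm_le_dot x a : (forall w, dot x w <= a * enorm w) -> enorm x <= a.
Proof.
have [->|x0] := eqVneq x 0 => xa.
  rewrite enorm0 leNgt; apply/negP => a0.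
  have := xa (1, 0, 0); rewrite dot0l leNgt nmulr_rlt0// enorm_gt0 => /negP.
  by apply; apply/eqP => -[] /eqP; rewrite oner_eq0.
have := xa x; rewrite -sqr_enorm expr2 ler_pM2r// enorm_gt0//.
Qed.

Lemma ler_coord1 x : `|x.1.1| <= enorm x.
Proof.
rewrite -(@ler_pXn2r _ 2)// ?nnegrE ?enorm_ge0// real_normK ?num_real// sqr_enorm.
by rewrite /dot -!expr2 -addrA lerDl addr_ge0 ?sqr_ge0.
Qed.

Lemma ler_coord2 x : `|x.1.2| <= enorm x.
Proof.
rewrite -(@ler_pXn2r _ 2)// ?nnegrE ?enorm_ge0// real_normK ?num_real// sqr_enorm.
by rewrite /dot -!expr2; have := sqr_ge0 x.1.1; have := sqr_ge0 x.2; lra.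
Qed.

Lemma ler_coord3 x : `|x.2| <= enorm x.
Proof.
rewrite -(@ler_pXn2r _ 2)// ?nnegrE ?enorm_ge0// real_normK ?num_real// sqr_enorm.
by rewrite /dot -!expr2 lerDr addr_ge0 ?sqr_ge0.
Qed.

Lemma ler_enorm_coord x : enorm x <= `|x.1.1| + `|x.1.2| + `|x.2|.
Proof.
apply: ler_enorm_sqr; first by rewrite !addr_ge0.
rewrite /dot -!expr2 -[x.1.1 ^+ 2]real_normK ?num_real//.
rewrite -[x.1.2 ^+ 2]real_normK ?num_real// -[x.2 ^+ 2]real_normK ?num_real//.
have := normr_ge0 x.1.1; have := normr_ge0 x.1.2; have := normr_ge0 x.2.
move: `|x.1.1| `|x.1.2| `|x.2| => a b c; nra.
Qed.

Definition frame (t p q : space3 R) :=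
  [/\ dot t t = 1, dot p p = 1 & dot q q = 1] /\
  [/\ dot p t = 0, dot q t = 0 & dot p q = 0].

Definition det3 (t p q : space3 R) : R :=
  t.1.1 * (p.1.2 * q.2 - p.2 * q.1.2)
  - t.1.2 * (p.1.1 * q.2 - p.2 * q.1.1)
  + t.2 * (p.1.1 * q.1.2 - p.1.2 * q.1.1).

(** The squared determinant is the Gram determinant. *)
Lemma sqr_det3 t p q : frame t p q -> det3 t p q ^+ 2 = 1.
Proof.
move=> [[tt pp qq] [pt qt pq]].
transitivity (dot t t * (dot p p * dot q q - dot p q * dot p q)
  - dot p t * (dot p t * dot q q - dot p q * dot q t)
  + dot q t * (dot p t * dot p q - dot p p * dot q t)).
  by rewrite /det3 /dot; ring.
by rewrite tt pp qq pt qt pq; ring.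
Qed.

(** The residue is orthogonal to the three frame vectors, so Cramer's rule with the nonzero
    determinant makes its coordinates vanish. *)
Lemma frame_decomp t p q x : frame t p q ->
  x = dot x t *: t + dot x p *: p + dot x q *: q.
Proof.
move=> tpq; have [[tt pp qq] [pt qt pq]] := tpq.
apply/eqP; rewrite -subr_eq0; set r := x - _.
have rt : dot r t = 0 by rewrite /r !dotE tt pt qt; ring.
have rp : dot r p = 0 by rewrite /r !dotE (dotC t p) (dotC q p) pp pt pq; ring.
have rq : dot r q = 0 by rewrite /r !dotE (dotC t q) qq pq qt; ring.
have D0 : det3 t p q != 0.
  by rewrite -sqrf_eq0 sqr_det3// oner_eq0.
clearbody r; apply/eqP; apply: space3P => /=; apply: (mulfI D0); rewrite mulr0.
- transitivity (dot r t * (p.1.2 * q.2 - p.2 * q.1.2)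
    + dot r p * (q.1.2 * t.2 - q.2 * t.1.2)
    + dot r q * (t.1.2 * p.2 - t.2 * p.1.2)); first by rewrite /det3 /dot; ring.
  by rewrite rt rp rq; ring.
- transitivity (dot r t * (p.2 * q.1.1 - p.1.1 * q.2)
    + dot r p * (q.2 * t.1.1 - q.1.1 * t.2)
    + dot r q * (t.2 * p.1.1 - t.1.1 * p.2)); first by rewrite /det3 /dot; ring.
  by rewrite rt rp rq; ring.
- transitivity (dot r t * (p.1.1 * q.1.2 - p.1.2 * q.1.1)
    + dot r p * (q.1.1 * t.1.2 - q.1.2 * t.1.1)
    + dot r q * (t.1.1 * p.1.2 - t.1.2 * p.1.1)); first by rewrite /det3 /dot; ring.
  by rewrite rt rp rq; ring.
Qed.
End euclidean.

Section curve_derivatives.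
Context {R : realType}.

Definition is_derive3 (f f' : R -> space3 R) (t : R) :=
  [/\ is_derive t 1 (fun t => (f t).1.1) (f' t).1.1,
      is_derive t 1 (fun t => (f t).1.2) (f' t).1.2 &
      is_derive t 1 (fun t => (f t).2) (f' t).2].

Lemma is_derive3_dot (f f' : R -> space3 R) t w : is_derive3 f f' t ->
  is_derive t 1 (fun t => dot (f t) w) (dot (f' t) w).
Proof.
move=> [d1 d2 d3]; rewrite /dot.
apply: is_derive_eq.
by rewrite /GRing.scale/=; ring.
Qed.

Lemma is_derive_continuous (f : R -> R) (d t : R) :
  is_derive t 1 f d -> {for t, continuous f}.
Proof. by move=> [df _]; apply: differentiable_continuous; apply/derivable1_diffP. Qed.

Lemma is_derive_div (f g : R -> R) (df dg t : R) : g t != 0 ->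
  is_derive t 1 f df -> is_derive t 1 g dg ->
  is_derive t 1 (fun x => f x / g x) (df / g t - f t * dg / (g t) ^+ 2).
Proof.
move=> g0 hf hg.
have hV : is_derive t 1 (fun x => (g x)^-1) (- (g t) ^- 2 * dg).
  have [dg1 dg2] := hg; apply: DeriveDef; first exact: derivableV.
  by rewrite deriveV// dg2.
apply: is_derive_eq.
by rewrite /GRing.scale/=; field.
Qed.

(** One step of the induction behind Taylor's formula, on either side of a. The mean value theorem
    loses the factor 1 / (n + 1) of an integration, which only affects constants. *)
Lemma mvt_le (f f' : R -> R) (a b K : R) (n : nat) :
  (forall t, Num.min a b <= t <= Num.max a b -> is_derive t 1 f (f' t)) ->
  (forall t, Num.min a b <= t <= Num.max a b -> `|f' t| <= K * `|t - a| ^+ n) ->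
  0 <= K -> f a = 0 -> `|f b| <= K * `|b - a| ^+ n.+1.
Proof.
move=> df bf K0 fa0.
have [ab|ba|<-] := ltgtP a b; last by rewrite fa0 normr0 mulr_ge0// exprn_ge0.
- rewrite (min_idPl (ltW ab)) (max_idPr (ltW ab)) in df bf.
  have [||c] := @MVT_segment _ f f' _ _ (ltW ab).
  + by move=> x; rewrite in_itv/= => /andP[? ?]; apply: df; rewrite !ltW.
  + apply: derivable_within_continuous => x; rewrite in_itv/= => xab.
    by have [] := df _ xab.
  rewrite in_itv/= fa0 subr0 => cab ->; rewrite normrM exprSr mulrA.
  rewrite ler_pM// (le_trans (bf _ cab))// ler_wpM2l// lerXn2r ?nnegrE//.
  by case/andP: cab => ac cb; rewrite !ger0_norm ?subr_ge0// ?lerB// ltW.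
- rewrite (min_idPr (ltW ba)) (max_idPl (ltW ba)) in df bf.
  have [||c] := @MVT_segment _ f f' _ _ (ltW ba).
  + by move=> x; rewrite in_itv/= => /andP[? ?]; apply: df; rewrite !ltW.
  + apply: derivable_within_continuous => x; rewrite in_itv/= => xab.
    by have [] := df _ xab.
  rewrite in_itv/= fa0 sub0r => cab E; rewrite -normrN E normrM exprSr mulrA (distrC a b).
  rewrite ler_pM// (le_trans (bf _ cab))// ler_wpM2l// lerXn2r ?nnegrE//.
  case/andP: cab => ac cb; rewrite distrC (distrC b a) !ger0_norm ?subr_ge0//; last exact: ltW.
  by rewrite lerB.
Qed.
End curve_derivatives.

(** * Volume of a tube *)

Section tube_coordinates.
Context {R : realType}.
Notation mR := (measurableTypeR R).
Notation lam := (@lebesgue_measure R).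
Notation lam2 := (lam \x lam)%E.
Implicit Types (g T k p q : R -> space3 R) (s eps sigma t : R).

(** Local form of [tube_ball]: the nearest-point condition is replaced by orthogonality to the
    tangent. [tube_ballE] shows that they agree near the base point. *)
Definition slab_tube g T s eps sigma : set (space3 R) :=
  [set z | exists t, [/\ `|t - s| < eps, dot (z - g t) (T t) = 0 &
                         dot (z - g t) (z - g t) <= sigma ^+ 2]].

Definition tube_map sigma g k p q (t : R) (u : mR * mR) : space3 R :=
  let w := bend sigma (dot (p t) (k t)) (dot (q t) (k t)) u in
  g t + w.1 *: p t + w.2 *: q t.

Definition tube_params (sigma s eps : R) : set (mR * (mR * mR)) :=
  [set tu | `|tu.1 - s| < eps /\ disc sigma tu.2].

Definition measurable_curve g :=
  [/\ measurable_fun [set: mR] (fun t : mR => (g t).1.1 : mR),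
      measurable_fun [set: mR] (fun t : mR => (g t).1.2 : mR) &
      measurable_fun [set: mR] (fun t : mR => (g t).2 : mR)].

Lemma measurable_tube_params sigma s eps : measurable (tube_params sigma s eps).
Proof.
apply: measurableI.
  apply: measurable_set_ltr; last by measurability.
  apply: (measurableT_comp (@normr_measurable R setT)).
  by apply: measurable_funB => //; exact: measurable_fst.
have := @measurable_snd _ _ mR (mR * mR)%type => /(_ measurableT _ (measurable_disc sigma)).
by rewrite setTI.
Qed.

Lemma measurable_tube_map sigma g k p q :
  measurable_curve g -> measurable_curve k -> measurable_curve p ->
  measurable_curve q ->
  measurable_fun setT (fun tu : mR * (mR * mR) =>
    tube_map sigma g k p q tu.1 tu.2 : mspace3 R).
Proof.
move=> [g1 g2 g3] [k1 k2 k3] [p1 p2 p3] [q1 q2 q3].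
have m1 (f : mR -> mR) : measurable_fun setT f ->
    measurable_fun setT (fun tu : mR * (mR * mR) => f tu.1).
  by move=> mf; apply: (measurableT_comp mf); exact: measurable_fst.
have mdot (f h : R -> space3 R) : measurable_curve f -> measurable_curve h ->
    measurable_fun setT (fun tu : mR * (mR * mR) => dot (f tu.1) (h tu.1) : mR).
  move=> [f1 f2 f3] [h1 h2 h3].
  apply: measurable_funD; first apply: measurable_funD.
  - by apply: measurable_funM; [exact: (m1 _ f1)|exact: (m1 _ h1)].
  - by apply: measurable_funM; [exact: (m1 _ f2)|exact: (m1 _ h2)].
  - by apply: measurable_funM; [exact: (m1 _ f3)|exact: (m1 _ h3)].
have mk1 := mdot p k (And3 p1 p2 p3) (And3 k1 k2 k3).
have mk2 := mdot q k (And3 q1 q2 q3) (And3 k1 k2 k3).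
have mu1 : measurable_fun setT (fun tu : mR * (mR * mR) => tu.2.1 : mR).
  by apply: measurableT_comp; [exact: measurable_fst|exact: measurable_snd].
have mu2 : measurable_fun setT (fun tu : mR * (mR * mR) => tu.2.2 : mR).
  by apply: measurableT_comp; [exact: measurable_snd|exact: measurable_snd].
have mn : measurable_fun setT (fun tu : mR * (mR * mR) =>
    tu.2.1 ^+ 2 + tu.2.2 ^+ 2 - sigma ^+ 2 : mR).
  apply: measurable_funB => //; apply: measurable_funD; exact: measurable_funX.
have mq : measurable_fun setT (fun tu : mR * (mR * mR) =>
    1 - (tu.2.1 * dot (p tu.1) (k tu.1) + tu.2.2 * dot (q tu.1) (k tu.1)) : mR).
  apply: measurable_funB => //; apply: measurable_funD; exact: measurable_funM.
have mshift : measurable_fun setT (fun tu : mR * (mR * mR) =>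
    bend_shift sigma (dot (p tu.1) (k tu.1)) (dot (q tu.1) (k tu.1)) tu.2 : mR).
  rewrite /bend_shift; apply: measurable_funM => //; apply: measurable_funV.
  apply: measurable_funD => //; apply: measurable_fun_sqrt.
  apply: measurable_funB; first exact: measurable_funX.
  apply: measurable_funM => //.
  by apply: measurable_funD; apply: measurable_funX.
have mw1 : measurable_fun setT (fun tu : mR * (mR * mR) =>
    (bend sigma (dot (p tu.1) (k tu.1)) (dot (q tu.1) (k tu.1)) tu.2).1 : mR).
  by apply: measurable_funD => //; exact: measurable_funM.
have mw2 : measurable_fun setT (fun tu : mR * (mR * mR) =>
    (bend sigma (dot (p tu.1) (k tu.1)) (dot (q tu.1) (k tu.1)) tu.2).2 : mR).
  by apply: measurable_funD => //; exact: measurable_funM.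
apply: measurable_fun_pair; first apply: measurable_fun_pair.
- apply: measurable_funD; first apply: measurable_funD.
  + exact: (m1 _ g1).
  + by apply: measurable_funM => //; exact: (m1 _ p1).
  + by apply: measurable_funM => //; exact: (m1 _ q1).
- apply: measurable_funD; first apply: measurable_funD.
  + exact: (m1 _ g2).
  + by apply: measurable_funM => //; exact: (m1 _ p2).
  + by apply: measurable_funM => //; exact: (m1 _ q2).
- apply: measurable_funD; first apply: measurable_funD.
  + exact: (m1 _ g3).
  + by apply: measurable_funM => //; exact: (m1 _ p3).
  + by apply: measurable_funM => //; exact: (m1 _ q3).
Qed.
End tube_coordinates.

(** * Slices of a tube by lines parallel to the first axis *)

Section slicing.
Context {R : realType}.
Notation mR := (measurableTypeR R).
Notation lam := (@lebesgue_measure R).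
Notation lam2 := (lam \x lam)%E.
Implicit Types (g T k p q : R -> space3 R) (s eps sigma t : R) (y : mR * mR).

(** Abscissa at which the line parallel to the first axis, with remaining coordinates y, crosses the
    normal plane of the curve at time t. *)
Definition plane_x g T t y : R := (g t).1.1 -
  ((y.1 - (g t).1.2) * (T t).1.2 + (y.2 - (g t).2) * (T t).2) / (T t).1.1.

Definition plane_pt g T t y : space3 R := ((plane_x g T t y, y.1), y.2).

(** The speed of that crossing point along the line: the usual tube density 1 - w.k divided by the
    cosine of the angle between the line and the tangent. *)
Definition plane_jac g T k t y : R :=
  (1 - dot (plane_pt g T t y - g t) (k t)) / (T t).1.1.

Lemma plane_pt_orth g T t y : (T t).1.1 != 0 ->
  dot (plane_pt g T t y - g t) (T t) = 0.
Proof. by move=> T0; rewrite /dot/= /plane_x; field. Qed.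

Lemma plane_ptP g T t (z : space3 R) : (T t).1.1 != 0 ->
  dot (z - g t) (T t) = 0 -> z = plane_pt g T t (z.1.2, z.2).
Proof.
move=> T0 zT; apply: space3P => //=; rewrite /plane_x/=.
apply: (mulIf T0); rewrite mulrBl divfK//; move: zT; rewrite /dot/=.
by move=> zT; apply/eqP; rewrite -subr_eq0 -[X in _ == X]zT; apply/eqP; ring.
Qed.

Lemma is_derive_plane_x g T k t y : is_derive3 g T t -> is_derive3 T k t ->
  dot (T t) (T t) = 1 -> (T t).1.1 != 0 ->
  is_derive t 1 (fun t => plane_x g T t y) (plane_jac g T k t y).
Proof.
move=> [g1 g2 g3] [T1 T2 T3] TT T0; rewrite /plane_x.
set N := fun t => (y.1 - (g t).1.2) * (T t).1.2 + (y.2 - (g t).2) * (T t).2.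
pose N' := - (T t).1.2 ^+ 2 - (T t).2 ^+ 2
  + (y.1 - (g t).1.2) * (k t).1.2 + (y.2 - (g t).2) * (k t).2.
have dN : is_derive t 1 N N'.
  rewrite /N; apply: is_derive_eq.
  by rewrite /GRing.scale/= /N'; ring.
have dNT : is_derive t 1 (fun t => N t / (T t).1.1)
  (N' / (T t).1.1 - N t * (k t).1.1 / (T t).1.1 ^+ 2) by exact: is_derive_div.
apply: is_derive_eq.
apply: (mulIf T0); rewrite /plane_jac divfK//.
(* The 1 in [plane_jac] is the squared speed of the curve, produced by the motion of the base
   point. *)
rewrite -[X in _ = X - dot _ _]TT.
by rewrite /N' /N /dot/= /plane_x; field.
Qed.

Lemma continuous_plane_jac g T k t y :
  is_derive3 g T t -> is_derive3 T k t -> (T t).1.1 != 0 ->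
  [/\ {for t, continuous (fun t => (k t).1.1)}, {for t, continuous (fun t => (k t).1.2)}
    & {for t, continuous (fun t => (k t).2)}] ->
  {for t, continuous (fun t => plane_jac g T k t y)}.
Proof.
move=> [/is_derive_continuous g1 /is_derive_continuous g2 /is_derive_continuous g3].
move=> [/is_derive_continuous T1 /is_derive_continuous T2 /is_derive_continuous T3].
move=> T0 [k1 k2 k3].
have cV : {for t, continuous (fun t => (T t).1.1^-1)} by exact: cvgV.
have cX : {for t, continuous (fun t => plane_x g T t y)}.
  apply: cvgB => //; apply: cvgM => //; apply: cvgD.
    by apply: cvgM => //; apply: cvgB => //; exact: cvg_cst.
  by apply: cvgM => //; apply: cvgB => //; exact: cvg_cst.
rewrite /plane_jac /dot/=; apply: cvgM => //; apply: cvgB; first exact: cvg_cst.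
apply: cvgD; first apply: cvgD; apply: cvgM => //; apply: cvgB => //; exact: cvg_cst.
Qed.

Section measurability.
Variables (g T k : R -> space3 R).
Hypotheses (mg : measurable_curve g) (mT : measurable_curve T)
  (mk : measurable_curve k).

Let m1 (f : mR -> mR) : measurable_fun setT f ->
  measurable_fun setT (fun ty : mR * (mR * mR) => f ty.1).
Proof. by move=> mf; apply: (measurableT_comp mf); exact: measurable_fst. Qed.

Let my1 : measurable_fun setT (fun ty : mR * (mR * mR) => ty.2.1 : mR).
Proof. by apply: measurableT_comp; [exact: measurable_fst|exact: measurable_snd]. Qed.

Let my2 : measurable_fun setT (fun ty : mR * (mR * mR) => ty.2.2 : mR).
Proof. by apply: measurableT_comp; [exact: measurable_snd|exact: measurable_snd]. Qed.

Lemma measurable_plane_x : measurable_fun setT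
  (fun ty : mR * (mR * mR) => plane_x g T ty.1 ty.2 : mR).
Proof.
have [g1 g2 g3] := mg; have [T1 T2 T3] := mT.
apply: measurable_funB; first exact: (m1 g1).
apply: measurable_funM; last by apply: measurable_funV; exact: (m1 T1).
apply: measurable_funD; apply: measurable_funM.
- by apply: measurable_funB => //; exact: (m1 g2).
- exact: (m1 T2).
- by apply: measurable_funB => //; exact: (m1 g3).
- exact: (m1 T3).
Qed.

Lemma measurable_plane_pt : measurable_fun setT
  (fun ty : mR * (mR * mR) => plane_pt g T ty.1 ty.2 : mspace3 R).
Proof.
apply: measurable_fun_pair; first apply: measurable_fun_pair => //.
  exact: measurable_plane_x.
by [].
Qed.

Lemma measurable_plane_dot : measurable_fun setT
  (fun ty : mR * (mR * mR) => dot (plane_pt g T ty.1 ty.2 - g ty.1)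
     (plane_pt g T ty.1 ty.2 - g ty.1) : mR).
Proof.
have [g1 g2 g3] := mg.
have d1 : measurable_fun setT (fun ty : mR * (mR * mR) =>
  plane_x g T ty.1 ty.2 - (g ty.1).1.1 : mR).
  by apply: measurable_funB; [exact: measurable_plane_x|exact: (m1 g1)].
have d2 : measurable_fun setT (fun ty : mR * (mR * mR) => ty.2.1 - (g ty.1).1.2 : mR).
  by apply: measurable_funB => //; exact: (m1 g2).
have d3 : measurable_fun setT (fun ty : mR * (mR * mR) => ty.2.2 - (g ty.1).2 : mR).
  by apply: measurable_funB => //; exact: (m1 g3).
by apply: measurable_funD; [apply: measurable_funD|]; apply: measurable_funM.
Qed.

Lemma measurable_plane_jac : measurable_fun setT
  (fun ty : mR * (mR * mR) => plane_jac g T k ty.1 ty.2 : mR).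
Proof.
have [g1 g2 g3] := mg; have [T1 T2 T3] := mT; have [k1 k2 k3] := mk.
apply: measurable_funM; last by apply: measurable_funV; exact: (m1 T1).
apply: measurable_funB => //; apply: measurable_funD; first apply: measurable_funD.
- apply: measurable_funM; last exact: (m1 k1).
  by apply: measurable_funB; [exact: measurable_plane_x|exact: (m1 g1)].
- apply: measurable_funM; last exact: (m1 k2).
  by apply: measurable_funB => //; exact: (m1 g2).
- apply: measurable_funM; last exact: (m1 k3).
  by apply: measurable_funB => //; exact: (m1 g3).
Qed.
End measurability.

Definition slab_slices g T s eps sigma (A : set (mspace3 R)) : set (mR * (mR * mR)) :=
  [set ty | [/\ `|ty.1 - s| < eps, A (plane_pt g T ty.1 ty.2) &
    dot (plane_pt g T ty.1 ty.2 - g ty.1) (plane_pt g T ty.1 ty.2 - g ty.1)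
      <= sigma ^+ 2]].

Lemma measurable_slab_slices g T s eps sigma A :
  measurable_curve g -> measurable_curve T -> measurable A ->
  measurable (slab_slices g T s eps sigma A).
Proof.
move=> mg mT mA.
rewrite (_ : slab_slices _ _ _ _ _ _ = [set ty | `|ty.1 - s| < eps] `&`
  ((fun ty => plane_pt g T ty.1 ty.2) @^-1` A `&`
  [set ty | dot (plane_pt g T ty.1 ty.2 - g ty.1) (plane_pt g T ty.1 ty.2 - g ty.1)
      <= sigma ^+ 2])); last first.
  by apply/seteqP; split => ty /=; [case|case=> ? []].
apply: measurableI; last apply: measurableI.
- apply: measurable_set_ltr; last by [].
  apply: (measurableT_comp (@normr_measurable R setT)).
  by apply: measurable_funB => //; exact: measurable_fst.
- by rewrite -[X in measurable X]setTI; exact: measurable_plane_pt.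
- by apply: measurable_set_ler => //; exact: measurable_plane_dot.
Qed.
End slicing.

Section slice_measure.
Context {R : realType}.
Notation mR := (measurableTypeR R).
Notation lam := (@lebesgue_measure R).
Notation lam2 := (lam \x lam)%E.
Implicit Types (g T k p q : R -> space3 R) (t : R) (y : mR * mR).

Lemma measurable_section_x (A : set (mspace3 R)) (y : mR * mR) : measurable A ->
  measurable [set x : mR | A ((x, y.1), y.2)].
Proof.
move=> mA.
have m : measurable_fun [set: mR] (fun x : mR => ((x, y.1), y.2) : mspace3 R).
  by apply: measurable_fun_pair => //; exact: measurable_fun_pair.
by rewrite -[X in measurable X]setTI; exact: m.
Qed.

Section one_line.
Variables (g T k : R -> space3 R) (sg c K s eps sigma : R).
Hypotheses (mg : measurable_curve g) (mT : measurable_curve T)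
  (mk : measurable_curve k).
Hypotheses (eps0 : 0 < eps) (sigma0 : 0 < sigma) (c0 : 0 < c) (K0 : 0 <= K).
Hypothesis sgE : sg = 1 \/ sg = -1.
Hypothesis dg : forall t, `|t - s| <= eps -> is_derive3 g T t.
Hypothesis dT : forall t, `|t - s| <= eps -> is_derive3 T k t.
Hypothesis ck : forall t, `|t - s| <= eps ->
  [/\ {for t, continuous (fun t => (k t).1.1)}, {for t, continuous (fun t => (k t).1.2)}
    & {for t, continuous (fun t => (k t).2)}].
Hypothesis TT : forall t, `|t - s| <= eps -> dot (T t) (T t) = 1.
Hypothesis Tc : forall t, `|t - s| <= eps -> c <= sg * (T t).1.1.
Hypothesis kK : forall t, `|t - s| <= eps -> enorm (k t) <= K.
Hypothesis small : K * (sigma + 2 * eps) * (2 / c + 2) < 1.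

Let T0 t : `|t - s| <= eps -> (T t).1.1 != 0.
Proof.
move=> /Tc; apply: contraTneq => ->; rewrite mulr0.
by rewrite -ltNge.
Qed.

Let coord_lip (f df : R -> R) t t' :
  (forall t, `|t - s| <= eps -> is_derive t 1 f (df t)) ->
  (forall t, `|t - s| <= eps -> `|df t| <= 1) ->
  `|t - s| <= eps -> `|t' - s| <= eps -> `|f t' - f t| <= `|t' - t|.
Proof.
move=> H1 H2 ts t's; rewrite -[`|t' - t|]expr1 -[X in _ <= X]mul1r.
have between z : Num.min t t' <= z <= Num.max t t' -> `|z - s| <= eps.
  move: ts t's; rewrite !ler_distl !ge_min !le_max.
  by move=> /andP[a b] /andP[a' b'] /andP[/orP[]h1 /orP[]h2]; apply/andP; split; lra.
apply: (@mvt_le R (fun z => f z - f t) df t t' 1 0) => //; last by rewrite subrr.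
- move=> z /between zs; have := H1 _ zs => hz.
  by apply: is_derive_eq; rewrite subr0.
- by move=> z /between zs; rewrite expr0 mulr1; exact: H2.
Qed.

Let T_coord t : `|t - s| <= eps -> [/\ `|(T t).1.1| <= 1, `|(T t).1.2| <= 1 & `|(T t).2| <= 1].
Proof.
move=> ts; have e : enorm (T t) = 1 by rewrite /enorm TT// sqrtr1.
by rewrite -e; split; [exact: ler_coord1|exact: ler_coord2|exact: ler_coord3].
Qed.

(** Once the line enters the slab at a time t0, its crossing with any normal plane of the slab has
    coordinates relative to the base point at most rho = sigma + 2 eps, twice, and 2 rho / c, as the
    tangent makes a slope of at least c with the plane of y. The assumption [small] then keeps 1 -
    w.k positive, so the crossing point moves monotonically. *)
Let jac_gt0 y t0 t : `|t0 - s| < eps ->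
  dot (plane_pt g T t0 y - g t0) (plane_pt g T t0 y - g t0) <= sigma ^+ 2 ->
  `|t - s| <= eps -> 0 < sg * plane_jac g T k t y.
Proof.
move=> t0s Pt0 ts.
have rt : `|t - t0| <= 2 * eps.
  rewrite (le_trans (ler_distD s _ _))// (distrC s) mulr2n mulrDl mul1r lerD//.
  exact: ltW.
have Pn : enorm (plane_pt g T t0 y - g t0) <= sigma by rewrite enorm_le_sqr// ltW.
pose rho := sigma + 2 * eps.
have rho0 : 0 <= rho by rewrite addr_ge0 ?mulr_ge0 ?ltW.
have y1 : `|y.1 - (g t).1.2| <= rho.
  rewrite (le_trans (ler_distD (g t0).1.2 _ _))// lerD//.
    by rewrite (le_trans _ Pn)// (le_trans _ (ler_coord2 _)).
  rewrite distrC (le_trans _ rt)//.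
  apply: (@coord_lip (fun t => (g t).1.2) (fun t => (T t).1.2) t0 t _ _ (ltW t0s) ts).
  - by move=> z /dg[].
  - by move=> z /T_coord[].
have y2 : `|y.2 - (g t).2| <= rho.
  rewrite (le_trans (ler_distD (g t0).2 _ _))// lerD//.
    by rewrite (le_trans _ Pn)// (le_trans _ (ler_coord3 _)).
  rewrite distrC (le_trans _ rt)//.
  apply: (@coord_lip (fun t => (g t).2) (fun t => (T t).2) t0 t _ _ (ltW t0s) ts).
  - by move=> z /dg[].
  - by move=> z /T_coord[].
have [_ T2 T3] := T_coord ts.
have T1c : c <= `|(T t).1.1|.
  rewrite (le_trans (Tc ts))//; case: sgE => ->; rewrite ?mul1r ?mulN1r ?ler_norm//.
  by rewrite -normrN ler_norm.
have x1 : `|plane_x g T t y - (g t).1.1| <= 2 * rho / c.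
  rewrite /plane_x addrAC subrr sub0r normrN normrM normfV.
  apply: ler_pM; rewrite ?invr_ge0//; last by rewrite lef_pV2// posrE ?(lt_le_trans c0).
  have -> : 2 * rho = rho + rho by ring.
  rewrite (le_trans (ler_normD _ _))// !normrM lerD//.
    by rewrite -[rho]mulr1 ler_pM.
  by rewrite -[rho]mulr1 ler_pM.
have kt := kK ts.
have k1 := le_trans (ler_coord1 (k t)) kt.
have k2 := le_trans (ler_coord2 (k t)) kt.
have k3 := le_trans (ler_coord3 (k t)) kt.
have dk : `|dot (plane_pt g T t y - g t) (k t)| < 1.
  apply: le_lt_trans small.
  rewrite /dot/= (le_trans (ler_normD _ _))//.
  have -> : K * rho * (2 / c + 2) = (2 * rho / c) * K + rho * K + rho * K by ring.
  rewrite lerD//; last by rewrite normrM ler_pM.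
  by rewrite (le_trans (ler_normD _ _))// lerD// normrM ler_pM.
have := Tc ts; rewrite /plane_jac mulrA.
have J0 : 0 < 1 - dot (plane_pt g T t y - g t) (k t).
  by rewrite subr_gt0; case/ltr_normlP: dk.
case: sgE => ->; rewrite ?mul1r ?mulN1r => Tc'.
  by rewrite divr_gt0// (lt_le_trans c0).
by rewrite mulNr -mulrN -invrN divr_gt0// (lt_le_trans c0).
Qed.

(** Substitution x = [plane_x] t along a line that meets the slab; on a line that misses it both
    sides vanish. *)
Lemma line_slice (A : set (mspace3 R)) y : measurable A ->
  measurable (slab_tube g T s eps sigma : set (mspace3 R)) ->
  lam [set x : mR | (A `&` slab_tube g T s eps sigma) ((x, y.1), y.2)] =
  (\int[lam]_t (\1_(slab_slices g T s eps sigma A) (t, y) *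
     `|plane_jac g T k t y|)%:E)%E.
Proof.
move=> mA mS; set B := [set x : mR | _].
have mB : measurable B.
  by apply: (@measurable_section_x (A `&` slab_tube g T s eps sigma)); exact: measurableI.
have BP x : B x -> exists t, [/\ `|t - s| < eps, x = plane_x g T t y,
    A (plane_pt g T t y) &
    dot (plane_pt g T t y - g t) (plane_pt g T t y - g t) <= sigma ^+ 2].
  move=> [Ax [t [ts zT zs]]]; exists t.
  have := plane_ptP (T0 (ltW ts)) zT; rewrite /= -surjective_pairing => E.
  by split => //; [case: E|rewrite -E|rewrite -E].
have [[t0 [t0s Pt0]]|nt0] := pselect (exists t0, `|t0 - s| < eps /\
  dot (plane_pt g T t0 y - g t0) (plane_pt g T t0 y - g t0) <= sigma ^+ 2); last first.
  rewrite (_ : B = set0); last first.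
    by apply/seteqP; split => // x /BP[t [ts _ _ Pt]]; apply: nt0; exists t.
  rewrite measure0; apply/esym/integral0_eq => t _.
  by rewrite indicE memNset ?mul0r// => -[/= ts _ Pt]; apply: nt0; exists t.
pose G (t : R) : R := plane_x g T t y.
pose J (t : R) : R := plane_jac g T k t y.
have itvE t : (s - eps <= t <= s + eps) = (`|t - s| <= eps) by rewrite ler_distl.
have itvE' t : (s - eps < t < s + eps) = (`|t - s| < eps) by rewrite ltr_distl.
have dG t : s - eps <= t <= s + eps -> is_derive t 1 G (J t).
  rewrite itvE => ts; exact: (is_derive_plane_x y (dg ts) (dT ts) (TT ts) (T0 ts)).
have cJ t : s - eps <= t <= s + eps -> {for t, continuous J}.
  rewrite itvE => ts; exact: (continuous_plane_jac (dg ts) (dT ts) (T0 ts) (ck ts)).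
have J0 t : s - eps <= t <= s + eps -> 0 < sg * J t.
  by rewrite itvE => ts; exact: jac_gt0 t0s Pt0 ts.
have my (f : mR * (mR * mR) -> mR) : measurable_fun setT f ->
    measurable_fun [set: mR] (fun t : mR => f (t, y)).
  by move=> mf; apply: (measurableT_comp mf); exact: measurable_fun_pair.
have mG : measurable_fun [set: mR] (G : mR -> mR) by exact: (my _ (measurable_plane_x mg mT)).
have mJ : measurable_fun [set: mR] (J : mR -> mR) by exact: (my _ (measurable_plane_jac mg mT mk)).
have se : s - eps <= s + eps.
  by rewrite lerD2l (le_trans _ (ltW eps0))// oppr_le0 ltW.
rewrite (substitution_monotone se sgE dG cJ J0 mG mJ mB); last first.
  by move=> x /BP[t [ts -> _ _]]; exists t => //; rewrite itvE ltW.
(* The slab requires |t - s| < eps strictly, while the substitution was made on the closed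
   interval. *)
rewrite integral_itv_bndoo; last first.
  apply/measurable_EFinP; apply: (@measurable_funS _ _ _ _ setT) => //.
  apply: measurable_funM; last first.
    by apply: measurableT_comp => //; exact: normr_measurable.
  by apply: measurableT_comp => //; exact: measurable_indic.
rewrite integral_mkcond; apply: eq_integral => t _.
rewrite patchE mem_setE in_itv/= itvE'; case: ifPn => ts; last first.
  rewrite indicE memNset ?mul0r// => -[/= ts' _ _].
  by move/negP: ts.
congr (_ * _)%:E; rewrite !indicE; congr (_%:R); apply: congr1.
apply/idP/idP; rewrite !inE; last first.
  move=> [/= _ APt Pt]; split => //; exists t; split => //.
  exact/plane_pt_orth/T0/ltW.
move=> /BP[t' [t's GG APt Pt]].
suff -> : t = t' by split.
(* A point of the slab is given by some time t', a priori different from the time t of the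
   integrand; strict monotonicity of the crossing point identifies them. *)
have injG a b : `|a - s| < eps -> `|b - s| < eps -> a < b -> G a <> G b.
  rewrite -!itvE' => /andP[a1 a2] /andP[b1 b2] ab Gab.
  have H z : a <= z <= b -> is_derive z 1 (fun z => sg * G z) (sg * J z).
    move=> /andP[az zb]; have := dG z.
    rewrite (le_trans (ltW a1) az) (le_trans zb (ltW b2)) => /(_ isT) hz.
    by apply: is_derive_eq; rewrite /GRing.scale/=; ring.
  have H' z : a <= z <= b -> 0 < sg * J z.
    by move=> /andP[az zb]; apply: J0; rewrite (le_trans (ltW a1) az) (le_trans zb (ltW b2)).
  by have := is_derive_increasing H H' (lexx a) ab (lexx b); rewrite Gab ltxx.
have [tt'|t't|//] := ltgtP t t'.
  by have := injG _ _ ts t's tt'.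
by have := injG _ _ t's ts t't; rewrite GG.
Qed.
End one_line.

(** At fixed t, passing from y to the frame coordinates w of the normal plane is affine with
    determinant +-1 / (T t).1.1. This cancels the denominator of [plane_jac], and the remaining
    factor 1 - w.k is absorbed by [disc_substitution]. *)
Lemma plane_slice g T k p q (K s eps sigma t : R) (A : set (mspace3 R)) :
  measurable A -> 0 < sigma -> 0 <= K -> K * sigma < 1 ->
  (T t).1.1 != 0 -> frame (T t) (p t) (q t) -> enorm (k t) <= K ->
  `|t - s| < eps ->
  (\int[lam2]_y (\1_(slab_slices g T s eps sigma A) (t, y) *
     `|plane_jac g T k t y|)%:E)%E =
  lam2 (disc sigma `&` (tube_map sigma g k p q t) @^-1` A).
Proof.
move=> mA sigma0 K0 Ks T0 fr kK ts.
pose k1 := dot (p t) (k t); pose k2 := dot (q t) (k t).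
have kk : k1 ^+ 2 + k2 ^+ 2 <= K ^+ 2.
  have : dot (k t) (k t) <= K ^+ 2 by rewrite -enorm_le_sqr.
  apply: le_trans; have kE := frame_decomp (k t) fr.
  have -> : dot (k t) (k t) = dot (k t) (T t) ^+ 2 + k1 ^+ 2 + k2 ^+ 2.
    by rewrite {1}kE !dotE /k1 /k2 (dotC (p t)) (dotC (q t)) (dotC (T t)); ring.
  by rewrite -addrA lerDr sqr_ge0.
have kks : (k1 ^+ 2 + k2 ^+ 2) * sigma ^+ 2 < 1.
  apply: (@le_lt_trans _ _ ((K * sigma) ^+ 2)).
    by rewrite exprMn ler_wpM2r// sqr_ge0.
  by rewrite expr_lt1// mulr_ge0// ltW.
pose E := [set w : mR * mR | A (g t + w.1 *: p t + w.2 *: q t)].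
have mE : measurable E.
  have m : measurable_fun setT (fun w : mR * mR =>
      g t + w.1 *: p t + w.2 *: q t : mspace3 R).
    apply: measurable_fun_pair; first apply: measurable_fun_pair.
    - apply: measurable_funD; first apply: measurable_funD => //.
        by apply: measurable_funM => //; exact: measurable_fst.
      by apply: measurable_funM => //; exact: measurable_snd.
    - apply: measurable_funD; first apply: measurable_funD => //.
        by apply: measurable_funM => //; exact: measurable_fst.
      by apply: measurable_funM => //; exact: measurable_snd.
    - apply: measurable_funD; first apply: measurable_funD => //.
        by apply: measurable_funM => //; exact: measurable_fst.
      by apply: measurable_funM => //; exact: measurable_snd.
  by rewrite -[X in measurable X]setTI; exact: m.
pose F (w : mR * mR) : R :=
  \1_(E `&` disc sigma) w * `|1 - (w.1 * k1 + w.2 * k2)|.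
transitivity (\int[lam2]_w (F w)%:E)%E; last first.
  rewrite [RHS](_ : _ = lam2 (disc sigma `&` bend sigma k1 k2 @^-1` E)); last by [].
  rewrite -disc_substitution//; apply: eq_integral => w _; congr EFin.
  rewrite /F indicE; case: (boolP (_ \in _)); last by rewrite !mul0r.
  rewrite inE => -[_ wd]; rewrite !mul1r gtr0_norm// subr_gt0.
  have : (w.1 * k1 + w.2 * k2) ^+ 2 < 1.
    apply: le_lt_trans kks; apply: (@le_trans _ _ ((w.1 ^+ 2 + w.2 ^+ 2) * (k1 ^+ 2 + k2 ^+ 2))).
      by have := sqr_ge0 (w.1 * k2 - w.2 * k1); nra.
    by rewrite mulrC ler_wpM2l ?addr_ge0 ?sqr_ge0.
  by nra.
pose T1 := (T t).1.1; pose T2 := (T t).1.2; pose T3 := (T t).2.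
(* Coefficients of y in the scalar product of v with [plane_pt] minus the base point, once the first
   coordinate is eliminated through the equation of the plane. *)
pose lin (v : space3 R) : R * R :=
  (v.1.2 - v.1.1 * T2 / T1, v.2 - v.1.1 * T3 / T1).
pose a := (lin (p t)).1; pose b := (lin (p t)).2.
pose c := (lin (q t)).1; pose d := (lin (q t)).2.
pose e := - (a * (g t).1.2 + b * (g t).2).
pose f := - (c * (g t).1.2 + d * (g t).2).
have detE : (a * d - b * c) = det3 (T t) (p t) (q t) / T1.
  by rewrite /a /b /c /d /lin /det3/= /T1 /T2 /T3; field.
have ndet : `|a * d - b * c| = `|T1|^-1.
  rewrite detE normrM normfV; have := sqr_det3 fr.
  rewrite -[X in _ = X](expr1n _ 2) => /eqP; rewrite eqf_sqr => /orP[]/eqP ->;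
  by rewrite ?normrN normr1 mul1r.
have det0 : a * d - b * c != 0.
  by rewrite -normr_eq0 ndet invr_eq0 normr_eq0.
pose w y : mR * mR := (a * y.1 + b * y.2 + e, c * y.1 + d * y.2 + f).
have wE y : w y = (dot (plane_pt g T t y - g t) (p t), dot (plane_pt g T t y - g t) (q t)).
  rewrite /w /e /f /a /b /c /d /lin /dot/= /plane_x -/T1 -/T2 -/T3; congr pair.
    by field.
  by field.
have PE y : plane_pt g T t y = g t + (w y).1 *: p t + (w y).2 *: q t.
  rewrite -addrA; apply/eqP; rewrite addrC -subr_eq; apply/eqP.
  rewrite [LHS](frame_decomp _ fr) plane_pt_orth// scale0r add0r wE.
  by [].
have PgE y : plane_pt g T t y - g t = (w y).1 *: p t + (w y).2 *: q t.
  rewrite PE; move: (_ *: p t) (_ *: q t) => u v.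
  by apply: space3P => /=; ring.
have [[tt pp qq] [pt qt pq]] := fr.
have ddE y : dot (plane_pt g T t y - g t) (plane_pt g T t y - g t) =
    (w y).1 ^+ 2 + (w y).2 ^+ 2.
  by rewrite PgE !dotE (dotC (q t) (p t)) pp qq pq; ring.
have dkE y : dot (plane_pt g T t y - g t) (k t) = (w y).1 * k1 + (w y).2 * k2.
  by rewrite PgE !dotE.
transitivity (\int[lam2]_y (`|T1|^-1%:E * (F (w y))%:E))%E.
  apply: eq_integral => y _; rewrite -EFinM; congr EFin.
  rewrite /F /plane_jac -/T1 dkE normrM normfV [RHS]mulrC -[RHS]mulrA; congr (_ * _).
  rewrite !indicE; congr (_%:R); apply: congr1; apply/idP/idP; rewrite !inE.
    by move=> [/= _ APt]; rewrite ddE => wd; split; rewrite /E/= -?PE.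
  by move=> [/= Ew wd]; split => //=; rewrite ?ddE// PE.
have mF : measurable_fun setT (fun w : mR * mR => (F w)%:E).
  apply/measurable_EFinP; apply: measurable_funM.
    by apply: measurable_indic; apply: measurableI => //; exact: measurable_disc.
  apply: (measurableT_comp (@normr_measurable R setT)).
  by apply: measurable_funB => //; apply: measurable_funD; exact: measurable_funM.
have F0 z : (0 <= (F z)%:E)%E by rewrite lee_fin mulr_ge0// indicE.
have mlin (a' b' c' d' e' f' : R) : measurable_fun setT (fun y : mR * mR =>
    (a' * y.1 + b' * y.2 + e', c' * y.1 + d' * y.2 + f') : mR * mR) by measurability.
rewrite ge0_integralZl//; last first.
  exact: (measurableT_comp mF (mlin a b c d e f)).
rewrite (ge0_integral_linear e f det0 mF F0) muleA -EFinM ndet invrK mulVf ?mul1e//.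
by rewrite normr_eq0.
Qed.
End slice_measure.

Section plane_measure.
Context {R : realType}.
Notation mR := (measurableTypeR R).
Notation lam := (@lebesgue_measure R).

(** Named so as to carry the sigma-finite structure that Fubini's theorem asks for when it is the
    second factor of [lebesgue12]. *)
Definition lebesgue2 : set (mR * mR) -> \bar R := (lam \x lam)%E.

HB.instance Definition _ := Measure.copy lebesgue2 (lam \x lam)%E.

Lemma sigma_finite_lebesgue2 : sigma_finite setT lebesgue2.
Proof.
pose F (n : nat) : set mR := `]- n%:R, n%:R[.
have mF n : measurable (F n) by exact: measurable_itv.
have Fx (x : mR) : exists N, forall n, (N <= n)%N -> F n x.
  exists (Num.truncn `|x|).+1 => n Nn; rewrite /F/= in_itv/= -ltr_norml.
  by rewrite (lt_le_trans (truncnS_gt _))// ler_nat.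
exists (fun n => F n `*` F n).
  apply/seteqP; split => // -[x y] _.
  have [N FN] := Fx x; have [M FM] := Fx y.
  by exists (maxn N M) => //; split => /=; [apply: FN|apply: FM];
    rewrite ?leq_maxl ?leq_maxr.
move=> n; split; first exact: measurableX.
have -> : lebesgue2 (F n `*` F n) = (lam (F n) * lam (F n))%E by exact: product_measure1E.
have fF : (lam (F n) < +oo)%E.
  by rewrite lebesgue_measure_itv/= lte_fin; case: ifP => _; rewrite ?ltry// -EFinD ltry.
by rewrite lte_mul_pinfty// ge0_fin_numE.
Qed.

HB.instance Definition _ := Measure_isSigmaFinite.Build _ _ _ lebesgue2
  sigma_finite_lebesgue2.

Definition lebesgue12 : set (mR * (mR * mR)) -> \bar R := (lam \x lebesgue2)%E.

HB.instance Definition _ := Measure.copy lebesgue12 (lam \x lebesgue2)%E.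
End plane_measure.

(** * Slicing the space along any of the three axes *)

Section iterated_integrals.
Context {R : realType}.
Notation mR := (measurableTypeR R).
Notation lam := (@lebesgue_measure R).
Notation lam2 := (lam \x lam)%E.
Implicit Type h : mspace3 R -> \bar R.

Let m_p1 : measurable_fun setT (fun z : mR * mR * mR => z.1.1).
Proof. by apply: measurableT_comp; exact: measurable_fst. Qed.
Let m_p2 : measurable_fun setT (fun z : mR * mR * mR => z.1.2).
Proof. by apply: measurableT_comp; [exact: measurable_snd|exact: measurable_fst]. Qed.
Let m_p3 : measurable_fun setT (fun z : mR * mR * mR => z.2).
Proof. exact: measurable_snd. Qed.

Lemma measurable_inner_integral h : measurable_fun setT h ->
  (forall x, (0 <= h x)%E) ->
  measurable_fun setT (fun y : mR * mR => \int[lam]_x h (y.1, y.2, x))%E.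
Proof.
move=> mh h0; have := measurable_fun_fubini_tonelli_F (m2 := lam) _ mh (fun z => h0 _).
by apply: eq_measurable_fun => -[a b] _.
Qed.

Lemma integral_perm_inner h : measurable_fun setT h -> (forall x, (0 <= h x)%E) ->
  (\int[lam2]_y \int[lam]_x h (y.1, y.2, x) =
   \int[lam2]_y \int[lam]_x h (y.1, x, y.2))%E.
Proof.
move=> mh h0.
have mh' : measurable_fun setT (fun z : mspace3 R => h (z.1.1, z.2, z.1.2)).
  by apply: (measurableT_comp mh); do 2!apply: measurable_fun_pair => //.
rewrite fubini_tonelli1; [|exact: measurable_inner_integral|
  by move=> y; exact: integral_ge0].
rewrite [RHS]fubini_tonelli1; [|exact: (measurable_inner_integral mh')|
  by move=> y; exact: integral_ge0].
apply: eq_integral => a _; rewrite /fubini_F/=.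
apply: (fubini_tonelli (m1 := lam) (m2 := lam) (fun z => h (a, z.1, z.2))) => //.
apply: (measurableT_comp mh); apply: measurable_fun_pair => //.
by apply: measurable_fun_pair => //.
Qed.

Lemma integral_perm_outer h : measurable_fun setT h -> (forall x, (0 <= h x)%E) ->
  (\int[lam2]_y \int[lam]_x h (y.1, y.2, x) =
   \int[lam2]_y \int[lam]_x h (y.2, y.1, x))%E.
Proof.
move=> mh h0; apply/esym.
apply: (ge0_integral_swap (F := fun y => \int[lam]_x h (y.1, y.2, x))%E).
  exact: measurable_inner_integral.
by move=> y; exact: integral_ge0.
Qed.

Definition swap12 (z : space3 R) : space3 R := ((z.1.2, z.1.1), z.2).
Definition swap13 (z : space3 R) : space3 R := ((z.2, z.1.2), z.1.1).

(* The volume of a tube is computed from its slices by lines parallel to a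
   coordinate axis which is transversal to the curve. *)
Definition coord_swap (P : space3 R -> space3 R) := P = id \/ P = swap12 \/ P = swap13.

Lemma coord_swapK P z : coord_swap P -> P (P z) = z.
Proof. by case=> [->|[]->]; case: z => -[]. Qed.

Lemma coord_swap_dot P z w : coord_swap P -> dot (P z) (P w) = dot z w.
Proof. by case=> [->|[]->]; rewrite /dot/=; ring. Qed.

Lemma coord_swapB P z w : coord_swap P -> P (z - w) = P z - P w.
Proof. by case=> [->|[]->]. Qed.

Lemma measurable_coord_swap P : coord_swap P ->
  measurable_fun setT (P : mspace3 R -> mspace3 R).
Proof.
by case=> [->|[]->]; first exact: measurable_id; do 2!apply: measurable_fun_pair => //.
Qed.

(** Tonelli's theorem in the order that leaves innermost the coordinate which P brings to the first
    place; [lebesgue3] itself integrates the last one innermost. *)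
Lemma lebesgue3_slices P (B : set (mspace3 R)) : coord_swap P -> measurable B ->
  lebesgue3 B = (\int[lam2]_y lam [set x : mR | B (P ((x, y.1), y.2))])%E.
Proof.
move=> swP mB.
pose h z : \bar R := (\1_B z : R)%:E.
have mh : measurable_fun setT h by apply/measurable_EFinP; exact: measurable_indic.
have h0 z : (0 <= h z)%E by rewrite lee_fin.
have secE (f : mR -> mspace3 R) : measurable_fun setT f ->
    lam [set x | B (f x)] = (\int[lam]_x h (f x))%E.
  move=> mf; rewrite measure_integral_indic//.
  by rewrite -[X in measurable X]setTI; exact: mf.
have -> : lebesgue3 B = (\int[lam2]_y \int[lam]_x h (y.1, y.2, x))%E.
  rewrite (_ : lebesgue3 B = \int[lam2]_y (lam \o xsection B) y)%E; last by [].
  apply: eq_integral => -[a b] _; rewrite [LHS]/=.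
  rewrite -secE; last by apply: measurable_fun_pair.
  by congr (lam _); apply/seteqP; split => x /=; rewrite /xsection/= inE.
case: swP => [->|[]->].
- rewrite integral_perm_outer//.
  rewrite (integral_perm_inner (h := fun z => h (z.1.2, z.1.1, z.2)))//; last first.
    by apply: (measurableT_comp mh); do 2!apply: measurable_fun_pair => //.
  apply: eq_integral => y _; rewrite secE//.
  by do 2!apply: measurable_fun_pair => //.
- rewrite integral_perm_inner//; apply: eq_integral => y _; rewrite secE//.
  by rewrite /swap12/=; do 2!apply: measurable_fun_pair => //.
- rewrite integral_perm_outer//; apply: eq_integral => y _; rewrite secE//.
  by rewrite /swap13/=; do 2!apply: measurable_fun_pair => //.
Qed.
End iterated_integrals.

Section tube_volume.
Context {R : realType}.
Notation mR := (measurableTypeR R).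
Notation lam := (@lebesgue_measure R).
Notation lam2 := (lam \x lam)%E.
Implicit Types (g T k p q : R -> space3 R) (K s eps sigma : R).

Lemma fubini_slices (F : mR * (mR * mR) -> \bar R) : measurable_fun setT F ->
  (forall x, (0 <= F x)%E) ->
  (\int[lam2]_y \int[lam]_t F (t, y) = \int[lam]_t \int[lam2]_y F (t, y))%E.
Proof.
move=> mF F0.
by have := fubini_tonelli (m1 := lam) (m2 := @lebesgue2 R) F mF F0 => ->.
Qed.

(** T and k are the first two derivatives of g. The frame (p, q) enters one normal plane at a time,
    so of its dependence on t only measurability is recorded. *)
Record tube_data g T k p q K s eps sigma : Prop := TubeData {
  td_mg : measurable_curve g; td_mT : measurable_curve T;
  td_mk : measurable_curve k; td_mp : measurable_curve p;
  td_mq : measurable_curve q;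
  td_eps : 0 < eps; td_sigma : 0 < sigma; td_K : 0 <= K;
  td_dg : forall t, `|t - s| <= eps -> is_derive3 g T t;
  td_dT : forall t, `|t - s| <= eps -> is_derive3 T k t;
  td_ck : forall t, `|t - s| <= eps ->
    [/\ {for t, continuous (fun t => (k t).1.1)},
        {for t, continuous (fun t => (k t).1.2)} &
        {for t, continuous (fun t => (k t).2)}];
  td_frame : forall t, `|t - s| <= eps -> frame (T t) (p t) (q t);
  td_kK : forall t, `|t - s| <= eps -> enorm (k t) <= K }.

(** Insert the line slices, exchange the integrals over y and t, and evaluate each time t in its own
    normal plane. *)
Lemma tube_volume_x g T k p q K s eps sigma sg c (A : set (mspace3 R)) :
  tube_data g T k p q K s eps sigma ->
  sg = 1 \/ sg = -1 -> 0 < c ->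
  (forall t, `|t - s| <= eps -> c <= sg * (T t).1.1) ->
  K * (sigma + 2 * eps) * (2 / c + 2) < 1 ->
  measurable A -> measurable (slab_tube g T s eps sigma : set (mspace3 R)) ->
  (\int[lam2]_y lam [set x : mR |
    (A `&` slab_tube g T s eps sigma) ((x, y.1), y.2)])%E =
  lebesgue12 (tube_params sigma s eps `&`
    (fun tu => tube_map sigma g k p q tu.1 tu.2) @^-1` A).
Proof.
move=> [mg mT mk mp mq eps0 sigma0 K0 dg dT ck fr kK] sgE c0 Tc small mA mS.
have Tn0 t : `|t - s| <= eps -> (T t).1.1 != 0.
  by move=> /Tc; apply: contraTneq => ->; rewrite mulr0 -ltNge.
have Ks : K * sigma < 1.
  apply: le_lt_trans small; rewrite -mulrA ler_wpM2l//.
  have ic : 0 <= 2 / c by rewrite divr_ge0// ltW.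
  by nra.
under eq_integral => y _.
  rewrite (line_slice mg mT mk eps0 sigma0 c0 sgE dg dT ck _ Tc kK small y mA mS);
    last by move=> t /fr[[]].
  over.
have mQ := measurable_slab_slices s eps sigma mg mT mA.
have mJ := measurable_plane_jac mg mT mk.
have mF : measurable_fun setT (fun ty : mR * (mR * mR) =>
    (\1_(slab_slices g T s eps sigma A) ty * `|plane_jac g T k ty.1 ty.2|)%:E).
  apply/measurable_EFinP; apply: measurable_funM; first exact: measurable_indic.
  exact: (measurableT_comp (@normr_measurable R setT) mJ).
rewrite (fubini_slices mF); last by move=> ty; rewrite lee_fin mulr_ge0// indicE.
set B := _ `&` _.
rewrite (_ : lebesgue12 B = \int[lam]_t (lam2 \o xsection B) t)%E; last by [].
apply: eq_integral => t _; rewrite [RHS]/comp {}/B.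
have [ts|ts] := ltP `|t - s| eps; last first.
  rewrite (_ : xsection _ _ = set0); last first.
    apply/seteqP; split => u //; rewrite /xsection/= inE => -[[/= + _] _].
    by rewrite ltNge ts.
  rewrite measure0; apply: integral0_eq => y _.
  by rewrite indicE memNset ?mul0r// => -[/= + _ _]; rewrite ltNge ts.
rewrite (@plane_slice _ g T k p q K)//; last 3 first.
- exact/Tn0/ltW.
- exact/fr/ltW.
- exact/kK/ltW.
congr (lam2 _); apply/seteqP; split => u; rewrite /xsection/= inE.
  by move=> [].
by move=> [[]].
Qed.

(** P is an isometric involution, so the tube data can be conjugated by it, which moves the
    transversal axis to the first place. *)
Lemma tube_volume g T k p q K s eps sigma sg c P (A : set (mspace3 R)) :
  tube_data g T k p q K s eps sigma ->
  coord_swap P -> sg = 1 \/ sg = -1 -> 0 < c ->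
  (forall t, `|t - s| <= eps -> c <= sg * (P (T t)).1.1) ->
  K * (sigma + 2 * eps) * (2 / c + 2) < 1 ->
  measurable A -> measurable (slab_tube g T s eps sigma : set (mspace3 R)) ->
  lebesgue3 (A `&` slab_tube g T s eps sigma) =
  lebesgue12 (tube_params sigma s eps `&`
    (fun tu => tube_map sigma g k p q tu.1 tu.2) @^-1` A).
Proof.
move=> td swP sgE c0 Tc small mA mS.
rewrite (lebesgue3_slices swP); last exact: measurableI.
have mP := measurable_coord_swap swP.
have Pinj z w : P z = P w -> z = w.
  by move=> /(congr1 P); rewrite !coord_swapK.
have slabP : P @^-1` slab_tube g T s eps sigma =
    slab_tube (P \o g) (P \o T) s eps sigma.
  apply/seteqP; split => z [t [ts zT zs]]; exists t; split => //=.
  - by rewrite -(coord_swap_dot _ _ swP) coord_swapB// !coord_swapK.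
  - by rewrite -(coord_swap_dot _ _ swP) coord_swapB// !coord_swapK.
  - by rewrite -zT -[RHS](coord_swap_dot _ _ swP) coord_swapB// !coord_swapK.
  - by rewrite (le_trans _ zs)// -[leRHS](coord_swap_dot _ _ swP) coord_swapB// !coord_swapK.
have mcP f : measurable_curve f -> measurable_curve (P \o f).
  by move=> [? ? ?]; case: swP => [->|[]->]; split.
have dP f f' t : is_derive3 f f' t -> is_derive3 (P \o f) (P \o f') t.
  by move=> [? ? ?]; case: swP => [->|[]->]; split.
have [mg mT mk mp mq eps0 sigma0 K0 dg dT ck fr kK] := td.
have tdP : tube_data (P \o g) (P \o T) (P \o k) (P \o p) (P \o q) K s eps sigma.
  have dgP t : `|t - s| <= eps -> is_derive3 (P \o g) (P \o T) t by move=> /dg; exact: dP.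
  have dTP t : `|t - s| <= eps -> is_derive3 (P \o T) (P \o k) t by move=> /dT; exact: dP.
  refine (TubeData (mcP _ mg) (mcP _ mT) (mcP _ mk) (mcP _ mp) (mcP _ mq)
    eps0 sigma0 K0 dgP dTP _ _ _).
  - by move=> t /ck[? ? ?]; case: swP => [->|[]->]; split.
  - move=> t /fr[[h1 h2 h3] [h4 h5 h6]].
    by split; split; rewrite /= coord_swap_dot.
  - by move=> t /kK; rewrite /enorm /= coord_swap_dot.
have mA' : measurable (P @^-1` A : set (mspace3 R)).
  by rewrite -[X in measurable X]setTI; exact: mP.
have mS' : measurable (slab_tube (P \o g) (P \o T) s eps sigma : set (mspace3 R)).
  by rewrite -slabP -[X in measurable X]setTI; exact: mP.
have := tube_volume_x tdP sgE c0 Tc small mA' mS'.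
rewrite -slabP => ->; congr (_ (_ `&` _)).
have tmE t u : P (tube_map sigma (P \o g) (P \o k) (P \o p) (P \o q) t u) =
    tube_map sigma g k p q t u.
  rewrite /tube_map/= !coord_swap_dot//.
  by case: swP => [->|[]->]; apply: space3P.
by apply/seteqP; split => -[t u]; rewrite /preimage/= tmE.
Qed.
End tube_volume.

(** * Unit speed arcs and their tubes *)

Section product_derivative.
Context {R : realType}.

Lemma near_norm_lt (t r : R) : `|t| < r -> \forall u \near t, `|u| < r.
Proof.
rewrite ltr_norml => tr; near=> u; rewrite ltr_norml.
have : u \in `]- r, r[%R by near: u; apply: near_in_itvoo; rewrite in_itv.
by rewrite in_itv.
Unshelve. all: by end_near. Qed.

Lemma is_derive_comp_linear (V W : normedModType R) (f : R -> V) (L : V -> W) (t : R) :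
  continuous L -> (forall a x y, L (a *: (x - y)) = a *: (L x - L y)) ->
  derivable f t 1 -> is_derive t 1 (fun x => L (f x)) (L (f^`() t)).
Proof.
move=> cL LE df.
have H : h^-1 *: ((f \o shift t) (h *: 1) - f t) @[h --> 0^'] --> 'D_1 f t by exact: df.
have H' : h^-1 *: (((fun x => L (f x)) \o shift t) (h *: 1) - L (f t)) @[h --> 0^']
    --> L ('D_1 f t).
  have := cvg_comp _ _ H (cL ('D_1 f t)).
  rewrite (_ : L \o _ = (fun h : R => h^-1 *: (((fun x => L (f x)) \o shift t) (h *: 1) - L (f t))))//.
  by apply/funext => h /=; rewrite LE.
rewrite derive1E; apply: DeriveDef; first by apply: cvgP; exact: H'.
by apply: cvg_lim; first exact: norm_hausdorff.
Qed.

Lemma derivable_is_derive3 (f : R -> space3 R) t : derivable f t 1 ->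
  is_derive3 f (f^`()) t.
Proof.
move=> df; split.
- apply: (@is_derive_comp_linear _ _ f (fun z : space3 R => z.1.1)) => //.
  by move=> z; apply: (cvg_comp _ _ cvg_fst); exact: cvg_fst.
- apply: (@is_derive_comp_linear _ _ f (fun z : space3 R => z.1.2)) => //.
  by move=> z; apply: (cvg_comp _ _ cvg_fst); exact: cvg_snd.
- apply: (@is_derive_comp_linear _ _ f (fun z : space3 R => z.2)) => //.
  by move=> z; exact: cvg_snd.
Qed.

Lemma is_derive3_continuous (f f' : R -> space3 R) t : is_derive3 f f' t ->
  [/\ {for t, continuous (fun t => (f t).1.1)},
      {for t, continuous (fun t => (f t).1.2)} &
      {for t, continuous (fun t => (f t).2)}].
Proof. by move=> [? ? ?]; split; apply: is_derive_continuous. Qed.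

Lemma bounded_curve (f f' : R -> space3 R) (r : R) : 0 < r ->
  (forall t, `|t| <= r -> is_derive3 f f' t) ->
  exists2 K, 0 <= K & forall t, `|t| <= r -> enorm (f t) <= K.
Proof.
move=> r0 df.
have bnd (h : R -> R) : (forall t, `|t| <= r -> {for t, continuous h}) ->
    exists2 M, 0 <= M & forall t, `|t| <= r -> `|h t| <= M.
  move=> ch; have rr : - r <= r by rewrite ge0_cp// ltW.
  have cn : {within `[- r, r], continuous (fun t => `|h t|)}.
    apply: continuous_in_subspaceT => t; rewrite inE/= in_itv/= -ler_norml => tr.
    by apply: cvg_norm; exact: ch.
  have [c _ cmax] := EVT_max rr cn.
  exists `|h c| => // t tr; apply: cmax.
  by rewrite in_itv/= -ler_norml.
have [M1 M10 h1] := bnd (fun t => (f t).1.1) (fun t tr => let: And3 c _ _ := is_derive3_continuous (df t tr) in c).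
have [M2 M20 h2] := bnd (fun t => (f t).1.2) (fun t tr => let: And3 _ c _ := is_derive3_continuous (df t tr) in c).
have [M3 M30 h3] := bnd (fun t => (f t).2) (fun t tr => let: And3 _ _ c := is_derive3_continuous (df t tr) in c).
exists (M1 + M2 + M3); first by rewrite !addr_ge0.
move=> t tr; rewrite (le_trans (ler_enorm_coord _))// !lerD//; [exact: h1|exact: h2|exact: h3].
Qed.

Lemma exists_frame (T : space3 R) : dot T T = 1 -> exists p q, frame T p q.
Proof.
move=> TT; pose n := T.1.1 ^+ 2 + T.1.2 ^+ 2.
have n0 : 0 <= n by rewrite addr_ge0 ?sqr_ge0.
have nE : n = 1 - T.2 ^+ 2 by rewrite /n -TT /dot; ring.
have [n00|nn0] := eqVneq n 0.
  have /andP[/eqP T1 /eqP T2] : (T.1.1 == 0) && (T.1.2 == 0).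
    by move/eqP: n00; rewrite /n paddr_eq0 ?sqr_ge0// !sqrf_eq0.
  exists ((1, 0), 0), ((0, 1), 0).
  by split; split; rewrite // /dot/= ?T1 ?T2; ring.
pose m := Num.sqrt n.
have m0 : m != 0 by rewrite gt_eqF// sqrtr_gt0 lt_neqAle eq_sym nn0.
have mm : m ^+ 2 = n by rewrite sqr_sqrtr.
(* A horizontal unit vector orthogonal to T, completed below by its cross product with T. *)
exists ((- T.1.2 / m, T.1.1 / m), 0).
exists ((- T.2 * (T.1.1 / m), - T.2 * (T.1.2 / m)), m).
split; split => //; rewrite /dot/=.
- by transitivity (n / m ^+ 2); [rewrite /n; field|rewrite mm divff].
- transitivity (T.2 ^+ 2 * (n / m ^+ 2) + m ^+ 2); first by rewrite /n; field.
  by rewrite mm divff// nE; ring.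
- by field.
- transitivity (T.2 / m * (m ^+ 2 - n)); first by rewrite /n; field.
  by rewrite mm subrr mulr0.
- by field.
Qed.
End product_derivative.

(** * Taylor expansions of a unit speed arc *)

Section regular_arc.
Context {R : realType}.

(** c n stands for the n-th derivative of the curve on ]-r, r[, extended measurably to the line. A
    common bound up to n = 4 suffices, since the deepest expansion is the fourth-order one of
    [taylor4]. *)
Record regular_arc (c : nat -> R -> space3 R) (r K : R) : Prop := RegularArc {
  ra_meas : forall n, measurable_curve (c n);
  ra_r : 0 < r; ra_K : 0 <= K;
  ra_d : forall n t, `|t| < r -> is_derive3 (c n) (c n.+1) t;
  ra_bnd : forall n t, (n <= 4)%N -> `|t| < r -> enorm (c n t) <= K;
  ra_unit : forall t, `|t| < r -> dot (c 1%N t) (c 1%N t) = 1 }.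

Section taylor.
Variables (c : nat -> R -> space3 R) (r K : R).
Hypothesis ra : regular_arc c r K.

Let between x y z : `|x| < r -> `|y| < r ->
  Num.min x y <= z <= Num.max x y -> `|z| < r.
Proof.
rewrite !ltr_norml ge_min le_max => /andP[? ?] /andP[? ?] /andP[/orP[]? /orP[]?];
  apply/andP; split; lra.
Qed.

Let dd n (w : space3 R) (t : R) : `|t| < r ->
  is_derive t 1 (fun t => dot (c n t) w) (dot (c n.+1 t) w).
Proof. by move=> tr; apply: is_derive3_dot; exact: (ra_d ra). Qed.

Let bd n w t : (n <= 4)%N -> `|t| < r -> `|dot (c n t) w| <= K * enorm w.
Proof.
move=> n4 tr; rewrite (le_trans (dot_le_enorm _ _))// ler_wpM2r ?enorm_ge0//.
exact: (ra_bnd ra).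
Qed.

Let Kw w : 0 <= K * enorm w.
Proof. by rewrite mulr_ge0 ?enorm_ge0//; exact: (ra_K ra). Qed.

(** Remainders of orders 1 to 4: the derivative in y of a remainder is the preceding remainder of
    the next derivative, so [mvt_le] climbs one order at a time while the admissible n drops by
    one. *)
Let dot1 n x y w : (n <= 3)%N -> `|x| < r -> `|y| < r ->
  `|dot (c n y) w - dot (c n x) w| <= K * enorm w * `|y - x|.
Proof.
move=> n3 xr yr; rewrite -[`|y - x|]expr1.
apply: (@mvt_le R (fun y => dot (c n y) w - dot (c n x) w)
  (fun y => dot (c n.+1 y) w) x y _ 0) => //; last by rewrite subrr.
- move=> z /(between xr yr) zr; have := dd n w zr => H.
  by apply: is_derive_eq; rewrite subr0.
- by move=> z /(between xr yr) zr; rewrite expr0 mulr1; apply: bd.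
Qed.

Let dot2 n x y w : (n <= 2)%N -> `|x| < r -> `|y| < r ->
  `|dot (c n y) w - dot (c n x) w - (y - x) * dot (c n.+1 x) w|
    <= K * enorm w * `|y - x| ^+ 2.
Proof.
move=> n3 xr yr.
apply: (@mvt_le R (fun y => dot (c n y) w - dot (c n x) w - (y - x) * dot (c n.+1 x) w)
  (fun y => dot (c n.+1 y) w - dot (c n.+1 x) w) x y _ 1); [| |exact: Kw|by rewrite !subrr mul0r subr0].
- move=> z /(between xr yr) zr; have := dd n w zr => H.
  by apply: is_derive_eq; rewrite /GRing.scale/=; ring.
- by move=> z /(between xr yr) zr; rewrite expr1; apply: dot1.
Qed.

Let dot3 n x y w : (n <= 1)%N -> `|x| < r -> `|y| < r ->
  `|dot (c n y) w - dot (c n x) w - (y - x) * dot (c n.+1 x) w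
    - (y - x) ^+ 2 / 2 * dot (c n.+2 x) w| <= K * enorm w * `|y - x| ^+ 3.
Proof.
move=> n3 xr yr.
apply: (@mvt_le R (fun y => dot (c n y) w - dot (c n x) w - (y - x) * dot (c n.+1 x) w
    - (y - x) ^+ 2 / 2 * dot (c n.+2 x) w)
  (fun y => dot (c n.+1 y) w - dot (c n.+1 x) w - (y - x) * dot (c n.+2 x) w) x y _ 2); [| |exact: Kw|by rewrite !subrr expr0n/= !mul0r !subr0].
- move=> z /(between xr yr) zr; have := dd n w zr => H.
  by apply: is_derive_eq; rewrite /GRing.scale/=; field.
- by move=> z /(between xr yr) zr; apply: dot2.
Qed.

Let dot4 x y w : `|x| < r -> `|y| < r ->
  `|dot (c 0%N y) w - dot (c 0%N x) w - (y - x) * dot (c 1%N x) w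
    - (y - x) ^+ 2 / 2 * dot (c 2%N x) w
    - (y - x) ^+ 3 / 6 * dot (c 3%N x) w| <= K * enorm w * `|y - x| ^+ 4.
Proof.
move=> xr yr.
apply: (@mvt_le R (fun y => dot (c 0%N y) w - dot (c 0%N x) w - (y - x) * dot (c 1%N x) w
    - (y - x) ^+ 2 / 2 * dot (c 2%N x) w - (y - x) ^+ 3 / 6 * dot (c 3%N x) w)
  (fun y => dot (c 1%N y) w - dot (c 1%N x) w - (y - x) * dot (c 2%N x) w
    - (y - x) ^+ 2 / 2 * dot (c 3%N x) w) x y _ 3); [| |exact: Kw|by rewrite !subrr !expr0n/= !mul0r !subr0].
- move=> z /(between xr yr) zr; have := dd 0%N w zr => H.
  by apply: is_derive_eq; rewrite /GRing.scale/=; field.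
- by move=> z /(between xr yr) zr; apply: dot3.
Qed.

Lemma taylor1 n x y : (n <= 3)%N -> `|x| < r -> `|y| < r ->
  enorm (c n y - c n x) <= K * `|y - x|.
Proof.
move=> n3 xr yr; apply: enorm_le_dot => w; rewrite [_ * enorm w]mulrAC.
by apply: le_trans (dot1 w n3 xr yr); rewrite !dotE ler_norm.
Qed.

Lemma taylor2 n x y : (n <= 2)%N -> `|x| < r -> `|y| < r ->
  enorm (c n y - c n x - (y - x) *: c n.+1 x) <= K * `|y - x| ^+ 2.
Proof.
move=> n3 xr yr; apply: enorm_le_dot => w; rewrite [_ * enorm w]mulrAC.
by apply: le_trans (dot2 w n3 xr yr); rewrite !dotE ler_norm.
Qed.

Lemma taylor3 n x y : (n <= 1)%N -> `|x| < r -> `|y| < r ->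
  enorm (c n y - c n x - (y - x) *: c n.+1 x - ((y - x) ^+ 2 / 2) *: c n.+2 x)
    <= K * `|y - x| ^+ 3.
Proof.
move=> n3 xr yr; apply: enorm_le_dot => w; rewrite [_ * enorm w]mulrAC.
by apply: le_trans (dot3 w n3 xr yr); rewrite !dotE ler_norm.
Qed.

Lemma taylor4 x y : `|x| < r -> `|y| < r ->
  enorm (c 0%N y - c 0%N x - (y - x) *: c 1%N x - ((y - x) ^+ 2 / 2) *: c 2%N x
    - ((y - x) ^+ 3 / 6) *: c 3%N x) <= K * `|y - x| ^+ 4.
Proof.
move=> xr yr; apply: enorm_le_dot => w; rewrite [_ * enorm w]mulrAC.
by apply: le_trans (dot4 w xr yr); rewrite !dotE ler_norm.
Qed.

Let d_const (f : R -> R) (a t d : R) : (forall t, `|t| < r -> f t = a) ->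
  `|t| < r -> is_derive t 1 f d -> d = 0.
Proof.
move=> fa tr df.
have nr : \near t, cst a t = f t.
  by near=> u; rewrite fa//; near: u; exact: near_norm_lt.
have d0 := near_eq_is_derive nr (is_derive_cst a t 1).
by have [_ <-] := df; have [_ <-] := d0.
Unshelve. all: by end_near. Qed.

Lemma dot_c1_c2 t : `|t| < r -> dot (c 1%N t) (c 2%N t) = 0.
Proof.
move=> tr; have [d1 d2 d3] := ra_d ra 1 tr.
have H : is_derive t 1 (fun t => dot (c 1%N t) (c 1%N t)) (2 * dot (c 1%N t) (c 2%N t)).
  by rewrite /dot; apply: is_derive_eq; rewrite /GRing.scale/=; ring.
have /eqP := d_const (ra_unit ra) tr H.
by rewrite mulf_eq0 pnatr_eq0/= => /eqP.
Qed.

(** Second derivative of the unit speed condition. This is how the squared curvature enters the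
    result. *)
Lemma dot_c1_c3 t : `|t| < r -> dot (c 1%N t) (c 3%N t) = - dot (c 2%N t) (c 2%N t).
Proof.
move=> tr; have [d1 d2 d3] := ra_d ra 1 tr; have [e1 e2 e3] := ra_d ra 2 tr.
have H : is_derive t 1 (fun t => dot (c 1%N t) (c 2%N t))
    (dot (c 2%N t) (c 2%N t) + dot (c 1%N t) (c 3%N t)).
  by rewrite /dot; apply: is_derive_eq; rewrite /GRing.scale/=; ring.
have /eqP := d_const dot_c1_c2 tr H.
by rewrite addrC addr_eq0 => /eqP.
Qed.
End taylor.
End regular_arc.

(** * Measurability of the slab *)

Section measurable_slab_tube.
Context {R : realType}.
Notation mR := (measurableTypeR R).
Variables (c : nat -> R -> space3 R) (r K : R).
Hypothesis ra : regular_arc c r K.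
Variables (s eps sigma : R).
Hypotheses (eps0 : 0 < eps) (sigma0 : 0 < sigma) (ser : `|s| + eps < r)
  (small : K * (2 * sigma + 2 * K * eps) < 1).

Let F z t := dot (z - c 0%N t) (c 1%N t).
Let h z t := dot (z - c 0%N t) (z - c 0%N t).

Let in_r t : `|t - s| <= eps -> `|t| < r.
Proof.
move=> ts; apply: le_lt_trans ser.
by rewrite -{1}(subrK s t) addrC (le_trans (ler_normD _ _))// lerD2l.
Qed.

Let K0 : 0 <= K. Proof. exact: (ra_K ra). Qed.

Let dF z t : `|t - s| <= eps ->
  is_derive t 1 (fun t => - F z t) (1 - dot (z - c 0%N t) (c 2%N t)).
Proof.
move=> /in_r tr; rewrite /F -[X in X - dot _ _](ra_unit ra tr).
have [d1 d2 d3] := ra_d ra 0 tr; have [e1 e2 e3] := ra_d ra 1 tr.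
rewrite /dot; apply: is_derive_eq.
by rewrite /GRing.scale/=; ring.
Qed.

Let dh z t : `|t - s| <= eps -> is_derive t 1 (h z) (- 2 * F z t).
Proof.
move=> /in_r tr; rewrite /F /h.
have [d1 d2 d3] := ra_d ra 0 tr.
rewrite /dot; apply: is_derive_eq.
by rewrite /GRing.scale/=; ring.
Qed.

Let itvE t : (s - eps <= t <= s + eps) = (`|t - s| <= eps).
Proof. by rewrite ler_distl. Qed.

(** The derivative of -F is 1 - (z - c).c'', positive for z near the arc. The radius 2 sigma leaves
    room for points that are only approximately in the tube. *)
Let F_decr z t1 : `|t1 - s| <= eps -> enorm (z - c 0%N t1) <= 2 * sigma ->
  forall a b, s - eps <= a -> a < b -> b <= s + eps -> F z b < F z a.
Proof.
move=> t1s zt1 a b sa ab bs.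
rewrite -ltrN2; apply: (is_derive_increasing (G := fun t => - F z t)
  (g := fun t => 1 - dot (z - c 0%N t) (c 2%N t)) _ _ sa ab bs).
  by move=> t; rewrite itvE => ts; exact: dF.
move=> t; rewrite itvE => ts; rewrite subr_gt0.
apply: (le_lt_trans (ler_dot _ _)); apply: le_lt_trans small.
rewrite mulrC; apply: ler_pM; rewrite ?enorm_ge0//.
  by apply: (ra_bnd ra) => //; exact: in_r.
rewrite (le_trans (ler_enorm_distD (c 0%N t1) _ _))// lerD//.
rewrite (le_trans (taylor1 ra _ (in_r ts) (in_r t1s)))//.
rewrite (_ : 2 * K * eps = K * (2 * eps)); last by ring.
rewrite ler_wpM2l// (le_trans (ler_distD s _ _))// (distrC s).
by rewrite (_ : 2 * eps = eps + eps); [rewrite lerD|ring].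
Qed.

(** The quantifier over t is made countable. The two sign conditions give F z a zero t0 inside the
    interval; since h z has derivative -2 F z, it is minimal at t0, so its nearly small values at
    rational times bound its value at t0. *)
Let slabE : slab_tube (c 0%N) (c 1%N) s eps sigma =
  [set z | 0 < F z (s - eps)] `&` [set z | F z (s + eps) < 0] `&`
  \bigcap_(n : nat) \bigcup_(q : rat) [set z | `|ratr q - s| <= eps /\
      h z (ratr q) < sigma ^+ 2 + n.+1%:R^-1].
Proof.
have s1 : `|s - eps - s| <= eps by rewrite addrAC subrr add0r normrN gtr0_norm.
have s2 : `|s + eps - s| <= eps by rewrite addrAC subrr add0r gtr0_norm.
apply/seteqP; split => z.
  move=> [t [ts zT zs]].
  have tse := ltW ts; move: (ts); rewrite ltr_distl => /andP[st te].
  have zt : enorm (z - c 0%N t) <= 2 * sigma.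
    rewrite (@le_trans _ _ sigma)//; first by rewrite enorm_le_sqr// ltW.
    by rewrite ler_peMl// ?ler1n// ltW.
  have decr := F_decr tse zt.
  split; first split => /=.
  - by rewrite -zT; apply: decr => //; exact: ltW.
  - by rewrite -zT; apply: decr => //; exact: ltW.
  - move=> n _.
    have cont : {for t, continuous (h z)} by exact: is_derive_continuous (dh z tse).
    have lt1 : h z t < sigma ^+ 2 + n.+1%:R^-1.
      by rewrite (le_lt_trans zs)// ltrDl invr_gt0.
    have nr : \forall u \near t, `|u - s| <= eps /\ h z u < sigma ^+ 2 + n.+1%:R^-1.
      near=> u; split.
        have : u \in `]s - eps, s + eps[%R.
          by near: u; apply: near_in_itvoo; rewrite in_itv/= st.
        by rewrite in_itv/= -ltr_distl => /ltW.
      by near: u; exact: (cvgr_lt _ cont).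
    have [q [qs hq]] : exists q : rat, `|ratr q - s| <= eps /\
        h z (ratr q) < sigma ^+ 2 + n.+1%:R^-1.
      move: nr => /nbhs_ballP[e /= e0 eP].
      have [q] : exists q : rat, ratr q \in `]t - e, t + e[%R.
        by apply: rat_in_itvoo; rewrite ltrD2l gtrN.
      rewrite in_itv/= -ltr_distlC => qt; exists q.
      by apply: eP; rewrite /ball/=.
    by exists q.
move=> [[/= F1 F2] H].
(* Taking 1 / (n + 1) < 3 sigma^2 in the hypothesis puts z within 2 sigma of the arc, which is what
   [F_decr] requires. *)
have [q0 _ [q0s hq0]] : (\bigcup_(q : rat) [set z | `|ratr q - s| <= eps /\
      h z (ratr q) < (2 * sigma) ^+ 2]) z.
  have [n sn] : exists n : nat, n.+1%:R^-1 < 3 * sigma ^+ 2.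
    have s30 : 0 < 3 * sigma ^+ 2 by rewrite mulr_gt0// exprn_gt0.
    by have [n _ /(_ n (leqnn n))] := near_infty_natSinv_lt (PosNum s30); exists n.
  have [q _ [qs hq]] := H n I; exists q => //; split => //.
  apply: (lt_trans hq); rewrite (_ : (2 * sigma) ^+ 2 = sigma ^+ 2 + 3 * sigma ^+ 2).
    by rewrite ltrD2l.
  by ring.
have zq0 : enorm (z - c 0%N (ratr q0)) <= 2 * sigma.
  by rewrite enorm_le_sqr ?mulr_ge0 ?(ltW sigma0)//; exact: ltW.
have decr := F_decr q0s zq0.
have se : s - eps <= s + eps.
  by rewrite lerD2l (le_trans _ (ltW eps0))// oppr_le0 ltW.
have cF : {within `[s - eps, s + eps], continuous (fun t => - F z t)}.
  apply: (is_derive_within_continuous (g := fun t => 1 - dot (z - c 0%N t) (c 2%N t))) => t.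
  by rewrite itvE => ts; exact: dF.
have [|t0] := IVT se cF (v := 0).
  by rewrite ge_min le_max !oppr_le0 !oppr_ge0 (ltW F1) (ltW F2) !orbT.
rewrite in_itv/= => /andP[st0 t0e] /eqP; rewrite oppr_eq0 => /eqP Ft0.
have t0s : `|t0 - s| < eps.
  rewrite ltr_distl !lt_neqAle st0 t0e !andbT; apply/andP; split.
    by apply/eqP => E; move: F1; rewrite E Ft0 ltxx.
  by apply/eqP => E; move: F2; rewrite -E Ft0 ltxx.
exists t0; split => //; rewrite -/(h z t0).
(* F z is positive before t0 and negative after it, so h z decreases and then increases. *)
have ht0 q : `|q - s| <= eps -> h z t0 <= h z q.
  move=> qs; move: (qs); rewrite -itvE => /andP[sq qe].
  have ok a b x : s - eps <= a -> b <= s + eps -> x \in `]a, b[%R -> `|x - s| <= eps.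
    by rewrite in_itv/= -itvE => sa be /andP[ax xb];
      rewrite (le_trans sa (ltW ax)) (le_trans (ltW xb) be).
  have okc a b : s - eps <= a -> b <= s + eps -> {within `[a, b], continuous (h z)}.
    move=> sa be; apply: (is_derive_within_continuous (g := fun t => - 2 * F z t)) => x /andP[ax xb].
    by apply: dh; rewrite -itvE (le_trans sa ax) (le_trans xb be).
  have [qt|tq|->//] := ltgtP q t0.
    have [x xin E] := MVT qt (fun x xin => dh z (ok _ _ _ sq t0e xin)) (okc _ _ sq t0e).
    move: (xin); rewrite in_itv/= => /andP[qx xt].
    have Fx : 0 < F z x by rewrite -Ft0; apply: decr => //; exact: le_trans sq (ltW qx).
    rewrite -subr_le0 E pmulr_lle0 ?subr_gt0//.
    by rewrite mulNr oppr_le0 mulr_ge0// ltW.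
  have [x xin E] := MVT tq (fun x xin => dh z (ok _ _ _ st0 qe xin)) (okc _ _ st0 qe).
  move: (xin); rewrite in_itv/= => /andP[tx xq].
  have Fx : F z x < 0 by rewrite -Ft0; apply: decr => //; exact: le_trans (ltW xq) qe.
  rewrite -subr_ge0 E mulr_ge0// ?subr_ge0 ?(ltW tq)//.
  by rewrite mulNr -mulrN mulr_ge0// oppr_ge0 ltW.
apply/ler_addgt0Pr => e e0.
have [n _ /(_ n (leqnn n)) /= ne] := near_infty_natSinv_lt (PosNum e0).
have [q _ [qs hq]] := H n I.
by rewrite (le_trans (ht0 _ qs))// (le_trans (ltW hq))// lerD2l ltW.
Unshelve. all: by end_near. Qed.

Lemma measurable_slab_tube :
  measurable (slab_tube (c 0%N) (c 1%N) s eps sigma : set (mspace3 R)).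
Proof.
have mdotl (w v : space3 R) : measurable_fun setT
    (fun z : mspace3 R => dot ((z : space3 R) - w) v : mR).
  have m1 : measurable_fun setT (fun z : mspace3 R => z.1.1).
    by apply: measurableT_comp; exact: measurable_fst.
  have m2 : measurable_fun setT (fun z : mspace3 R => z.1.2).
    by apply: measurableT_comp; [exact: measurable_snd|exact: measurable_fst].
  have m3 : measurable_fun setT (fun z : mspace3 R => z.2) by exact: measurable_snd.
  apply: measurable_funD; first apply: measurable_funD.
  - by apply: measurable_funM => //; exact: measurable_funB.
  - by apply: measurable_funM => //; exact: measurable_funB.
  - by apply: measurable_funM => //; exact: measurable_funB.
have mh t : measurable_fun setT (fun z : mspace3 R => h z t : mR).
  have hE z : h z t = dot (z - c 0%N t) ((1, 0, 0) : space3 R) ^+ 2 +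
      dot (z - c 0%N t) ((0, 1, 0) : space3 R) ^+ 2 +
      dot (z - c 0%N t) ((0, 0, 1) : space3 R) ^+ 2.
    by rewrite /h /dot/=; ring.
  under eq_fun do rewrite hE.
  by apply: measurable_funD; first apply: measurable_funD; apply: measurable_funX; exact: mdotl.
rewrite slabE; apply: measurableI; first apply: measurableI.
- by apply: measurable_set_ltr => //; exact: mdotl.
- by apply: measurable_set_ltr => //; exact: mdotl.
- apply: bigcapT_measurable => n; apply: bigcupT_measurable_rat => q.
  have [qs|qs] := boolP (`|ratr q - s| <= eps); last first.
    by rewrite (_ : [set _ | _] = set0)//; apply/seteqP; split => // z [].
  rewrite (_ : [set _ | _] = [set z | h z (ratr q) < sigma ^+ 2 + n.+1%:R^-1]).
    by apply: measurable_set_ltr => //; exact: mh.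
  by apply/seteqP; split => z //= [].
Qed.
End measurable_slab_tube.

(** * From the embedded curve to local slabs *)

Section smooth_curve.
Context {R : realType}.
Notation mR := (measurableTypeR R).
Variables (delta0 : R) (gamma : R -> space3 R).
Let I : set R := [set t | - delta0 < t < delta0].
Hypotheses (d00 : 0 < delta0) (smooth : smooth_on I gamma)
  (unit_speed : unit_speed_on I gamma) (emb : embedding_on I gamma).

Let IE t : I t <-> `|t| < delta0.
Proof. by rewrite /I/= ltr_norml. Qed.

Let gamma_derive n t : `|t| < delta0 -> is_derive3 (gamma^`(n)) (gamma^`(n.+1)) t.
Proof.
by move=> /IE It; rewrite derive1nS; apply: derivable_is_derive3; exact: smooth.
Qed.

(* Freezing the curve outside of [[-r, r]] makes it measurable on the whole line. *)
Definition clamp (r t : R) : R := Num.max (- r) (Num.min r t).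

Let clamp_id r t : `|t| <= r -> clamp r t = t.
Proof.
rewrite ler_norml => /andP[rt tr]; rewrite /clamp.
by rewrite (min_idPr tr) (max_idPr rt).
Qed.

Let clamp_le r t : 0 <= r -> `|clamp r t| <= r.
Proof.
move=> r0; rewrite ler_norml /clamp le_max lexx/= ge_max ge_min lexx/= andbT.
by rewrite (le_trans _ r0)// oppr_le0.
Qed.

Let continuous_clamp r t : {for t, continuous (clamp r)}.
Proof.
apply: (@continuous_max R R^o (cst (- r)) (fun t => Num.min r t)); first exact: cvg_cst.
apply: (@continuous_min R R^o (cst r) id); first exact: cvg_cst.
exact: cvg_id.
Qed.

Lemma exists_regular_arc : exists c r K, [/\ regular_arc c r K, r <= delta0 &
  forall n t, `|t| <= r -> c n t = gamma^`(n) t].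
Proof.
(* Halving leaves the closed interval [-r, r] inside the domain, so that the derivatives are bounded
   on it by compactness. *)
pose r := delta0 / 2.
have r0 : 0 < r by rewrite divr_gt0.
have rd (t : R) : `|t| <= r -> `|t| < delta0.
  by move=> /le_lt_trans; apply; rewrite ltr_pdivrMr// ltr_pMr// ltr1n.
pose c n t := gamma^`(n) (clamp r t).
have [K0 K00 B0] := bounded_curve r0 (fun t tr => gamma_derive 0 (rd t tr)).
have [K1 K10 B1] := bounded_curve r0 (fun t tr => gamma_derive 1 (rd t tr)).
have [K2 K20 B2] := bounded_curve r0 (fun t tr => gamma_derive 2 (rd t tr)).
have [K3 K30 B3] := bounded_curve r0 (fun t tr => gamma_derive 3 (rd t tr)).
have [K4 K40 B4] := bounded_curve r0 (fun t tr => gamma_derive 4 (rd t tr)).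
have cE n t : `|t| <= r -> c n t = gamma^`(n) t by move=> tr; rewrite /c clamp_id.
exists c, r, (K0 + K1 + K2 + K3 + K4); split => //; last first.
  by rewrite ler_pdivrMr// ler_pMr// ler1n.
split => //.
- move=> n.
  have ct t : [/\ {for t, continuous (fun t => (c n t).1.1)},
      {for t, continuous (fun t => (c n t).1.2)} & {for t, continuous (fun t => (c n t).2)}].
    have cr := clamp_le t (ltW r0).
    have [c1 c2 c3] := is_derive3_continuous (gamma_derive n (rd _ cr)).
    split.
    + exact: (continuous_comp (continuous_clamp (r:=r) (t:=t)) c1).
    + exact: (continuous_comp (continuous_clamp (r:=r) (t:=t)) c2).
    + exact: (continuous_comp (continuous_clamp (r:=r) (t:=t)) c3).
  by split; apply: continuous_measurable_fun => t; have [] := ct t.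
- by rewrite !addr_ge0.
- move=> n t tr; have [d1 d2 d3] := gamma_derive n (rd _ (ltW tr)).
  have nr : \forall u \near t, gamma^`(n) u = c n u.
    by near=> u; rewrite cE//; apply: ltW; near: u; exact: near_norm_lt.
  rewrite /is_derive3 cE ?ltW//; split.
  + by apply: near_eq_is_derive d1; apply: filterS nr => u ->.
  + by apply: near_eq_is_derive d2; apply: filterS nr => u ->.
  + by apply: near_eq_is_derive d3; apply: filterS nr => u ->.
- move=> n t n4 /ltW tr; rewrite cE//.
  case: n n4 => [|[|[|[|[|]]]]]// _.
  + by rewrite (le_trans (B0 t tr))// -!addrA lerDl !addr_ge0.
  + by rewrite (le_trans (B1 t tr))// (addrC K0) -!addrA lerDl !addr_ge0.
  + by rewrite (le_trans (B2 t tr))// (addrC _ K2) -!addrA lerDl !addr_ge0.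
  + by rewrite (le_trans (B3 t tr))// (addrC _ K3) -!addrA lerDl !addr_ge0.
  + by rewrite (le_trans (B4 t tr))// (addrC _ K4) lerDl !addr_ge0.
- move=> t tr; rewrite cE ?ltW// -sqr_enorm.
  by rewrite (_ : enorm _ = 1) ?expr1n//; apply: unit_speed; apply/IE/rd/ltW.
Unshelve. all: by end_near. Qed.

(** The image of ]-r, r[ is relatively open in the curve. This prevents distant parameters from
    returning close to gamma 0 and competing for the nearest point. *)
Lemma embedding_near (r : R) : 0 < r -> exists2 eta, 0 < eta &
  forall u, I u -> enorm (gamma u - gamma 0) < eta -> `|u| < r.
Proof.
move=> r0; have [inj _ /(_ [set u | `|u| < r])[]] := emb.
  rewrite (_ : [set _ | _] = `]- r, r[%classic); first exact: itv_open.
  by apply/seteqP; split => u /=; rewrite in_itv/= ltr_norml.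
move=> V oV VE.
have I0 : I 0 by apply/IE; rewrite normr0.
have V0 : V (gamma 0).
  have : (gamma @` ([set u | `|u| < r] `&` I)) (gamma 0).
    by exists 0 => //; split => //=; rewrite normr0.
  by rewrite VE => -[].
have /nbhs_ballP[e /= e0 eV] : nbhs (gamma 0) V by apply: open_nbhs_nbhs.
exists e => // u Iu ue.
have Vu : V (gamma u).
  apply: eV; rewrite enorm_distC in ue; split; first split.
  - by rewrite /ball/=; apply: le_lt_trans ue; apply: le_trans (ler_coord1 _).
  - by rewrite /ball/=; apply: le_lt_trans ue; apply: le_trans (ler_coord2 _).
  - by rewrite /ball/=; apply: le_lt_trans ue; apply: le_trans (ler_coord3 _).
have : (V `&` gamma @` I) (gamma u) by split => //; exists u.
rewrite -VE => -[u' [u'r Iu'] E].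
by rewrite -(inj _ _ _ _ E)//; apply/mem_set.
Qed.

Lemma curve_paramE t : I t -> curve_param I gamma (gamma t) = t.
Proof.
move=> It; rewrite /curve_param; case: xgetP => [u -> [Iu E]|/(_ t)[]//].
have [inj _ _] := emb.
by apply: inj => //; apply/mem_set.
Qed.

Lemma arc_distE s t : I s -> I t ->
  arc_dist I gamma (gamma t) (gamma s) = (`|t - s|)%:E.
Proof.
move=> Is It; rewrite /arc_dist !curve_paramE//.
transitivity (\int[lebesgue_measure]_(u in `[Num.min t s, Num.max t s]) (1%:E : \bar R))%E.
  apply: eq_integral => u; rewrite inE/= in_itv/= ge_min le_max => u1.
  rewrite unit_speed//; move: Is It; rewrite /I/= => /andP[? ?] /andP[? ?].
  by move: u1 => /andP[/orP[]? /orP[]?]; apply/andP; split; lra.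
rewrite integral_cst//= mul1e lebesgue_measure_itv/= lte_fin -EFinD.
have [ts|st|->] := ltgtP t s.
- by rewrite ts ltr0_norm ?subr_lt0// opprB.
- by rewrite st gtr0_norm ?subr_gt0.
- by rewrite ltxx subrr normr0.
Qed.

(** First-order condition at an interior minimum of the squared distance. *)
Lemma proj_orth z t : I t -> is_proj (gamma @` I) z (gamma t) ->
  dot (z - gamma t) (derive1 gamma t) = 0.
Proof.
move=> It [_ zmin].
pose phi u := dot (z - gamma u) (z - gamma u).
have dphi u : I u -> is_derive u 1 phi (- 2 * dot (z - gamma u) (derive1 gamma u)).
  move=> /IE ud; have [d1 d2 d3] := gamma_derive 0 ud.
  rewrite /phi /dot; apply: is_derive_eq.
  by rewrite /GRing.scale/=; ring.
have d0 : is_derive t 1 phi 0.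
  apply: (@derive1_at_min _ phi (- delta0) delta0).
  - by rewrite ge0_cp// ltW.
  - by move=> u; rewrite in_itv/= => Iu; have [] := dphi u Iu.
  - by rewrite in_itv.
  - move=> u; rewrite in_itv/= => Iu; rewrite /phi -!sqr_enorm.
    rewrite ler_pXn2r ?nnegrE ?enorm_ge0//.
    have [->//|ne] := pselect (gamma u = gamma t).
    by apply/ltW/zmin => //; exists u.
have [_ E1] := d0; have [_ E2] := dphi t It.
have /eqP : - 2 * dot (z - gamma t) (derive1 gamma t) = 0 by rewrite -E2 E1.
by rewrite mulf_eq0 oppr_eq0 pnatr_eq0/= => /eqP.
Qed.

(** A projection is orthogonal, and no farther from z than the foot of z in [tube], hence within
    sigma. Conversely a foot of the slab must be strictly nearest: this is global, and combines the
    embedding for distant rivals with a second-order expansion for the others. *)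
Lemma tube_ballE c r K : regular_arc c r K -> r <= delta0 ->
  (forall n t, `|t| <= r -> c n t = gamma^`(n) t) ->
  exists2 r1, 0 < r1 & forall s sigma eps, 0 < sigma -> 0 < eps ->
    `|s| + eps + sigma < r1 ->
    tube_ball I gamma sigma eps (gamma s) = slab_tube (c 0%N) (c 1%N) s eps sigma.
Proof.
move=> ra rd0 cE.
have r0 := ra_r ra; have K0 := ra_K ra.
(* For parameters below r2 the quadratic Taylor error is at most half of |u - t|, so |gamma u -
   gamma t| >= |u - t| / 2. *)
pose r2 := Num.min r (4 * (K + 1))^-1.
have r20 : 0 < r2 by rewrite lt_min r0 invr_gt0 mulr_gt0// ltr_wpDl.
have r2r : r2 <= r by rewrite ge_min lexx.
have Kr2 : 4 * (K * r2) <= 1.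
  have : r2 <= (4 * (K + 1))^-1 by rewrite ge_min lexx orbT.
  rewrite -[X in _ <= X]mul1r ler_pdivlMr ?mulr_gt0 ?ltr_wpDl//.
  by move: (ltW r20); nra.
have [eta eta0 etaP] := embedding_near r20.
(* The second bound makes 2 sigma + K |t| < eta. The third bounds the cross term 2 v.D by |u - t|^2
   / 8, below the lower bound |u - t|^2 / 4 of |D|^2. *)
pose r1 := Num.min r2 (Num.min (eta / (2 + K)) (16 * (K + 1))^-1).
have r10 : 0 < r1.
  rewrite lt_min r20/= lt_min divr_gt0 ?ltr_wpDr//=.
  by rewrite invr_gt0 mulr_gt0// ltr_wpDl.
exists r1 => // s sigma eps sigma0 eps0 small.
have r1r2 : r1 <= r2 by rewrite ge_min lexx.
have r1eta : r1 * (2 + K) <= eta.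
  by rewrite -ler_pdivlMr ?ltr_wpDr// !ge_min lexx !orbT.
have Kr1 : 16 * (K * r1) <= 1.
  have : r1 <= (16 * (K + 1))^-1 by rewrite !ge_min lexx !orbT.
  rewrite -[X in _ <= X]mul1r ler_pdivlMr ?mulr_gt0 ?ltr_wpDl//.
  by move: (ltW r10); nra.
have sr1 : `|s| < r1 by apply: le_lt_trans small; rewrite -addrA lerDl addr_ge0// ltW.
have sgr1 : sigma < r1 by apply: le_lt_trans small; rewrite lerDr addr_ge0// ltW.
have rI t : `|t| < r -> I t by move=> tr; apply/IE/(lt_le_trans tr).
have Is : I s by apply: rI; rewrite (lt_le_trans sr1)// (le_trans r1r2).
have in_r1 t : `|t - s| < eps -> `|t| < r1.
  move=> ts; apply: le_lt_trans small.
  rewrite -{1}(subrK s t) addrC (le_trans (ler_normD _ _))//.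
  by rewrite -addrA lerD2l (le_trans (ltW ts))// lerDl ltW.
have c0E t : `|t| < r -> c 0%N t = gamma t by move=> tr; rewrite cE ?ltW.
have c1E t : `|t| < r -> c 1%N t = derive1 gamma t by move=> tr; rewrite cE ?ltW.
have [inj _ _] := emb.
have [xr1 xr2] : (forall t : R, `|t| < r1 -> `|t| < r2) /\ (forall t : R, `|t| < r2 -> `|t| < r).
  by split => t tr; apply: (lt_le_trans tr).
apply/seteqP; split => z.
  move=> [[x [v [[u Iu gu] vT vs zE]]] [p [zp pe]]].
  have [[t It gt] zmin] := zp.
  rewrite -gt in zp pe zmin.
  rewrite arc_distE// lte_fin in pe.
  have tr := xr2 _ (xr1 _ (in_r1 _ pe)).
  exists t; rewrite c0E// c1E//; split => //; first exact: proj_orth.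
  have xz : enorm (z - x) <= sigma by rewrite zE addrC addKr.
  have zt : enorm (z - gamma t) <= sigma.
    have [E|ne] := pselect (x = gamma t); first by rewrite -E.
    by apply: le_trans xz; apply/ltW/zmin => //; exists u.
  by rewrite -enorm_le_sqr// ltW.
move=> [t [ts zT zs]].
have tr1 := in_r1 _ ts; have tr := xr2 _ (xr1 _ tr1).
rewrite c0E// c1E// in zT zs.
have It := rI _ tr.
have zts : enorm (z - gamma t) <= sigma by rewrite enorm_le_sqr// ltW.
split.
  exists (gamma t), (z - gamma t); split => //.
  - move=> w [t' [a [It' gt' ->]]]; rewrite dotZr.
    have -> : t' = t by apply: inj => //; apply/mem_set.
    by rewrite zT mulr0.
  - by rewrite addrC subrK.
exists (gamma t); split; last by rewrite arc_distE// lte_fin.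
split; first by exists t.
move=> _ [u Iu <-] ne; rewrite ltNge; apply/negP => zu.
(* A rival at least as close to z lies within 2 sigma of gamma t, hence within eta of gamma 0. *)
have ur2 : `|u| < r2.
  apply: etaP => //.
  apply: (@lt_le_trans _ _ (r1 * (2 + K))) => //.
  apply: (@le_lt_trans _ _ (sigma + (sigma + K * `|t|))).
    rewrite (le_trans (ler_enorm_distD z _ _))// lerD//.
      by rewrite enorm_distC (le_trans zu).
    rewrite (le_trans (ler_enorm_distD (gamma t) _ _))// lerD//.
    rewrite -[gamma t]c0E// -[gamma 0]c0E ?normr0//.
    by have := taylor1 ra (n:=0%N) isT (_ : `|0| < r) tr; rewrite subr0 normr0; apply.
  rewrite mulrDr mulr_natr mulr2n -addrA ltrD// ltr_leD//.
  by rewrite mulrC ler_wpM2r// ltW.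
have ur := xr2 _ ur2.
have ut : u != t by apply/eqP => E; apply: ne; rewrite E.
have := taylor2 ra (n:=0%N) isT tr ur; rewrite c0E// c0E// c1E//.
set E := _ - _ - _ => HE.
have duE : gamma u - gamma t = (u - t) *: derive1 gamma t + E.
  by rewrite /E; move: (_ *: _) => w; apply: space3P => /=; ring.
have d0 : 0 < `|u - t| by rewrite normr_gt0 subr_eq0.
have dr2 : `|u - t| <= 2 * r2.
  by rewrite (le_trans (ler_normB _ _))// mulr_natl mulr2n lerD// ltW//; exact: xr1.
pose d := `|u - t|.
have T1 : enorm (derive1 gamma t) = 1 by exact: unit_speed.
have low : d / 2 <= enorm (gamma u - gamma t).
  have : d <= enorm (gamma u - gamma t) + enorm E.
    have -> : d = enorm ((u - t) *: derive1 gamma t) by rewrite enormZ T1 mulr1.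
    have -> : (u - t) *: derive1 gamma t = (gamma u - gamma t) - E by rewrite duE; apply: space3P => /=; ring.
    exact: ler_enormB.
  have : K * d ^+ 2 <= d / 2.
    by rewrite expr2 mulrA mulrC ler_pM2l// /d; nra.
  by move: HE; rewrite -/d; lra.
have : dot (z - gamma u) (z - gamma u) <= dot (z - gamma t) (z - gamma t).
  by rewrite -!sqr_enorm ler_pXn2r ?nnegrE ?enorm_ge0.
have -> : z - gamma u = (z - gamma t) - (gamma u - gamma t).
  by apply: space3P => /=; ring.
set v := z - gamma t; set D := gamma u - gamma t.
have vD : dot v D = dot v E by rewrite /D duE dotDr dotZr zT mulr0 add0r.
have -> : dot (v - D) (v - D) = dot v v - 2 * dot v D + dot D D.
  by rewrite [dot (v - D) _]dotDl [dot v _]dotDr [dot (- D) _]dotNl dotDr !dotNr (dotC D v); ring.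
rewrite vD -[dot D D]sqr_enorm.
have : dot v E <= r1 * (K * d ^+ 2).
  apply: (le_trans (ler_dot _ _)); apply: ler_pM; rewrite ?enorm_ge0//.
  by rewrite (le_trans zts)// ltW.
have : (d / 2) ^+ 2 <= enorm D ^+ 2.
  by rewrite ler_pXn2r ?nnegrE ?enorm_ge0 ?divr_ge0 ?normr_ge0.
have d20 : 0 < d ^+ 2 by rewrite exprn_gt0.
have : r1 * (K * d ^+ 2) <= d ^+ 2 / 16.
  by rewrite mulrA [_ / 16]mulrC ler_pM2r//; lra.
rewrite exprMn exprVn; move: (dot v v) (dot v E) (enorm D ^+ 2) d20 => a b e.
by move: (d ^+ 2) (r1 * _) => x y; lra.
Qed.
End smooth_curve.

(** * Displacement along the chord *)

Section transported_frame.
Context {R : realType}.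
Implicit Types T v w : space3 R.

Definition tilt (T0 : space3 R) T v : R := dot v T / (1 + dot T0 T).

(* The rotation taking [T0] to [T] in the plane they span, restricted to the
   plane orthogonal to [T0]. *)
Definition transport (T0 : space3 R) T v : space3 R := v - tilt T0 T v *: (T0 + T).

Lemma transport_frame (T0 : space3 R) T v w : dot T T = 1 -> 1 + dot T0 T != 0 ->
  frame T0 v w -> frame T (transport T0 T v) (transport T0 T w).
Proof.
move=> TT den [[T0T0 vv ww] [vT0 wT0 vw]].
have tE x : dot x T = tilt T0 T x * (1 + dot T0 T) by rewrite /tilt divfK.
have dd x y : dot x T0 = 0 -> dot y T0 = 0 ->
    dot (transport T0 T x) (transport T0 T y) = dot x y.
  move=> xT0 yT0; rewrite /transport; move: (tE x) (tE y).
  move: (tilt T0 T x) (tilt T0 T y) => a b xT yT.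
  rewrite !(dotDl, dotDr, dotNl, dotNr, dotZl, dotZr) (dotC T0 y) (dotC T y).
  by rewrite (dotC T T0) xT0 yT0 xT yT TT T0T0; ring.
have dT x : dot (transport T0 T x) T = 0.
  rewrite /transport !(dotDl, dotNl, dotZl) TT (tE x); ring.
by split; split; rewrite ?dd.
Qed.
End transported_frame.

Section bend_shift_bounds.
Context {R : realType}.

(** The denominator is 1 - u.k plus a square root that stays within 3 K s of 1, so it differs from 2
    by at most 4 K s. *)
Lemma bend_shift_bounds (K s k1 k2 : R) u : 0 <= K -> 0 < s -> K * s <= 1 / 2 ->
  k1 ^+ 2 + k2 ^+ 2 <= K ^+ 2 -> disc s u ->
  `|bend_shift s k1 k2 u| <= 2 * s ^+ 2 /\
  `|bend_shift s k1 k2 u - (u.1 ^+ 2 + u.2 ^+ 2 - s ^+ 2) / 2| <= 5 * K * s ^+ 3.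
Proof.
move=> K0 s0 Ks kK us; rewrite /bend_shift.
set uk := u.1 * k1 + u.2 * k2; set n := u.1 ^+ 2 + u.2 ^+ 2 - s ^+ 2.
have n0 : n <= 0 by rewrite subr_le0.
have ns : - s ^+ 2 <= n by rewrite /n lerDr addr_ge0 ?sqr_ge0.
have uk1 : `|uk| <= K * s.
  rewrite -(@ler_pXn2r _ 2)// ?nnegrE ?mulr_ge0 ?(ltW s0)//.
  rewrite real_normK ?num_real// exprMn.
  apply: (@le_trans _ _ ((u.1 ^+ 2 + u.2 ^+ 2) * (k1 ^+ 2 + k2 ^+ 2))).
    by rewrite /uk; have := sqr_ge0 (u.1 * k2 - u.2 * k1); nra.
  by rewrite mulrC ler_pM ?addr_ge0 ?sqr_ge0.
have kn : 0 <= - ((k1 ^+ 2 + k2 ^+ 2) * n) <= (K * s) ^+ 2.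
  rewrite -mulrN mulr_ge0 ?addr_ge0 ?sqr_ge0 ?oppr_ge0//= exprMn.
  by apply: ler_pM; rewrite ?addr_ge0 ?sqr_ge0 ?oppr_ge0// lerNl.
set kkn := (k1 ^+ 2 + k2 ^+ 2) * n in kn *.
have a0 : 0 <= K * s by rewrite mulr_ge0// ltW.
set a := K * s in a0 Ks uk1 kn *.
have [uka uka'] : - a <= uk /\ uk <= a by move: uk1; rewrite ler_norml => /andP[].
have X0 : 0 <= (1 - uk) ^+ 2 - kkn by case/andP: kn => kn _; rewrite addr_ge0 ?sqr_ge0.
set S := Num.sqrt _.
have S0 : 0 <= S by exact: sqrtr_ge0.
have SS : S ^+ 2 = (1 - uk) ^+ 2 - kkn by rewrite sqr_sqrtr.
have [S1 S2] : 1 - 3 * a <= S /\ S <= 1 + 3 * a.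
  case/andP: kn => kn1 kn2; move: SS; rewrite !expr2 in kn2 * => SS.
  split; rewrite leNgt; apply/negP => H; nra.
set Dn := 1 - uk + S.
have D1 : 1 / 2 <= Dn by rewrite /Dn; lra.
have Dp : 0 < Dn by lra.
have D2 : `|2 - Dn| <= 4 * a by rewrite ler_norml /Dn; apply/andP; split; lra.
have nn : `|n| <= s ^+ 2 by rewrite ler_norml ns (le_trans n0)// sqr_ge0.
have iD : `|Dn^-1| <= 2.
  rewrite normfV gtr0_norm// invf_ple ?posrE//; lra.
split.
  by rewrite normrM mulrC ler_pM.
rewrite (_ : n / Dn - n / 2 = n * ((2 - Dn) / 2 * Dn^-1)); last by field; rewrite gt_eqF.
rewrite (_ : 5 * K * s ^+ 3 = s ^+ 2 * (5 * a)); last by rewrite /a; ring.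
rewrite normrM ler_pM// normrM.
apply: (@le_trans _ _ (4 * a / 2 * 2)); last by lra.
by rewrite ler_pM// normrM ler_pM// gtr0_norm ?invr_gt0.
Qed.
End bend_shift_bounds.

Section displacement.
Context {R : realType}.
Notation mR := (measurableTypeR R).
Variables (c : nat -> R -> space3 R) (r K : R).
Hypothesis ra : regular_arc c r K.
Variables (v1 v2 : space3 R).
Hypothesis fr0 : frame (c 1%N 0) v1 v2.
Variables (d sigma : R).
Hypotheses (K1 : 1 <= K) (d0 : 0 < d) (d1 : d <= 1) (dr : 2 * d < r)
  (Kd : K * d <= 1 / 64) (sigma0 : 0 < sigma) (sigmad : sigma <= d / 4).

Let T0 := c 1%N 0.
Let fr v t := transport T0 (c 1%N t) v.
Let lambda t (u : mR * mR) :=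
  bend_shift sigma (dot (fr v1 t) (c 2%N t)) (dot (fr v2 t) (c 2%N t)) u.

Definition arc_map t (u : mR * mR) : space3 R :=
  tube_map sigma (c 0%N) (c 2%N) (fr v1) (fr v2) t u.

Let r0 : 0 < r. Proof. exact: (ra_r ra). Qed.
Let K0 : 0 <= K. Proof. exact: (ra_K ra). Qed.
Let zr : `|0 : R| < r. Proof. by rewrite normr0. Qed.
Let in_r (t : R) : `|t| <= 2 * d -> `|t| < r.
Proof. by move=> td; exact: le_lt_trans dr. Qed.

Let unitT t : `|t| < r -> enorm (c 1%N t) = 1.
Proof. by move=> tr; rewrite /enorm (ra_unit ra)// sqrtr1. Qed.

Let T_near t : `|t| <= 2 * d -> enorm (c 1%N t - T0) <= 2 * K * d.
Proof.
move=> td; rewrite (le_trans (taylor1 ra _ zr (in_r td)))// subr0.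
rewrite (_ : 2 * K * d = K * (2 * d)); last by ring.
by rewrite ler_wpM2l.
Qed.

Let den_ge1 t : `|t| <= 2 * d -> 1 <= 1 + dot T0 (c 1%N t).
Proof.
move=> td; have := dot_le_enorm T0 (c 1%N t - T0).
rewrite unitT// mul1r => /le_trans/(_ (T_near td)).
rewrite dotDr dotNr (ra_unit ra)// ler_norml => /andP[].
by move: Kd; lra.
Qed.

Lemma arc_frame t : `|t| <= 2 * d -> frame (c 1%N t) (fr v1 t) (fr v2 t).
Proof.
move=> td; apply: transport_frame => //; first exact: (ra_unit ra (in_r td)).
by rewrite gt_eqF// (lt_le_trans _ (den_ge1 td)).
Qed.

Let tilt_le v t : dot v T0 = 0 -> enorm v = 1 -> `|t| <= 2 * d ->
  `|tilt T0 (c 1%N t) v| <= 2 * K * d.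
Proof.
move=> vT v_1 td; have den := den_ge1 td.
have -> : tilt T0 (c 1%N t) v = dot v (c 1%N t - T0) / (1 + dot T0 (c 1%N t)).
  by rewrite /tilt dotDr dotNr vT subr0.
rewrite normrM -[2 * K * d]mulr1 ler_pM//.
  by rewrite (le_trans (dot_le_enorm _ _))// v_1 mul1r T_near.
by rewrite normfV invf_le1 ?normr_gt0 ?gt_eqF ?(lt_le_trans _ den)// (le_trans den)// ler_norm.
Qed.

(** To first order the transported vectors vary along the tangent only. Indeed T0 + T is 2 T0 + (T -
    T0), where both [tilt] and T - T0 are O(d), so the non-tangential part is a product of two small
    factors. *)
Let fr_var v x y : dot v T0 = 0 -> enorm v = 1 -> `|x| <= 2 * d -> `|y| <= 2 * d ->
  exists2 a, `|a| <= 8 * K * d &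
    enorm (fr v y - fr v x - a *: T0) <= 8 * K ^+ 2 * d ^+ 2.
Proof.
move=> vT v_1 xd yd; rewrite /fr /transport.
have := tilt_le vT v_1 xd; have := tilt_le vT v_1 yd.
have := T_near xd; have := T_near yd.
move: (tilt T0 _ v) (tilt T0 _ v) => p q.
set Tx := c 1%N x; set Ty := c 1%N y => Ty0 Tx0 qd pd.
exists (- 2 * (q - p)).
  rewrite normrM normrN normr_nat.
  have := ler_normB q p; lra.
have -> : v - q *: (T0 + Ty) - (v - p *: (T0 + Tx)) - (- 2 * (q - p)) *: T0 =
    p *: (Tx - T0) - q *: (Ty - T0).
  by apply: space3P => /=; rewrite /GRing.scale/=; ring.
rewrite (le_trans (ler_enormB _ _))// !enormZ.
have Kd0 : 0 <= 2 * K * d by rewrite !mulr_ge0// ltW.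
have := ler_pM (normr_ge0 p) (enorm_ge0 _) pd Tx0.
have := ler_pM (normr_ge0 q) (enorm_ge0 _) qd Ty0.
by rewrite !expr2; lra.
Qed.

Let v1T : dot v1 T0 = 0. Proof. by case: fr0 => _ []. Qed.
Let v2T : dot v2 T0 = 0. Proof. by case: fr0 => _ []. Qed.
Let v11 : enorm v1 = 1. Proof. by case: fr0 => -[_ h _] _; rewrite /enorm h sqrtr1. Qed.
Let v21 : enorm v2 = 1. Proof. by case: fr0 => -[_ _ h] _; rewrite /enorm h sqrtr1. Qed.

Let c2_decomp t : `|t| <= 2 * d ->
  c 2%N t = dot (fr v1 t) (c 2%N t) *: fr v1 t + dot (fr v2 t) (c 2%N t) *: fr v2 t.
Proof.
move=> td; rewrite [LHS](frame_decomp _ (arc_frame td)).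
rewrite (dotC _ (c 1%N t)) (dot_c1_c2 ra (in_r td)) scale0r add0r.
by rewrite (dotC (c 2%N t) (fr v1 t)) (dotC (c 2%N t) (fr v2 t)).
Qed.

(** The curvature vector is normal to the curve, so shifting the frame coordinates by l (k.p, k.q)
    amounts to adding l k. *)
Lemma arc_mapE t u : `|t| <= 2 * d ->
  arc_map t u = c 0%N t + u.1 *: fr v1 t + u.2 *: fr v2 t + lambda t u *: c 2%N t.
Proof.
move=> td; rewrite [in RHS](c2_decomp td) /arc_map /tube_map /bend -/(lambda t u).
by move: (lambda t u) => l; apply: space3P => /=; rewrite /GRing.scale/=; ring.
Qed.

Let sq_k t : `|t| <= 2 * d ->
  dot (fr v1 t) (c 2%N t) ^+ 2 + dot (fr v2 t) (c 2%N t) ^+ 2 <= K ^+ 2.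
Proof.
move=> td; have [[_ pp qq] [_ _ pq]] := arc_frame td.
have : dot (c 2%N t) (c 2%N t) <= K ^+ 2.
  by rewrite -enorm_le_sqr//; apply: (ra_bnd ra) => //; exact: in_r.
rewrite [X in dot X _](c2_decomp td) dotDl !dotZl.
by rewrite !expr2.
Qed.

Let sK : K * sigma <= 1 / 2.
Proof. by move: sigmad Kd K0; nra. Qed.

Let lambda_bound t u : `|t| <= 2 * d -> disc sigma u ->
  `|lambda t u| <= d ^+ 2 /\
  `|lambda t u - (u.1 ^+ 2 + u.2 ^+ 2 - sigma ^+ 2) / 2| <= K * d ^+ 3.
Proof.
move=> td us; have [h1 h2] := bend_shift_bounds K0 sigma0 sK (sq_k td) us.
have sd2 : sigma ^+ 2 <= (d / 4) ^+ 2.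
  by rewrite ler_pXn2r// nnegrE ltW// divr_gt0.
have sd3 : sigma ^+ 3 <= (d / 4) ^+ 3.
  by rewrite ler_pXn2r// nnegrE ltW// divr_gt0.
have d2 : 0 <= d ^+ 2 by rewrite sqr_ge0.
have d3 : 0 <= K * d ^+ 3 by rewrite mulr_ge0// exprn_ge0// ltW.
split.
  rewrite (le_trans h1)// (le_trans (ler_wpM2l _ sd2))//.
  by rewrite expr_div_n; move: d2; move: (d ^+ 2) => D2 hD; rewrite !exprS expr0; lra.
rewrite (le_trans h2)//.
have := ler_wpM2l K0 sd3.
rewrite (_ : (d / 4) ^+ 3 = d ^+ 3 / 64); last by field.
rewrite (mulrA K (d ^+ 3)) -(mulrA 5); move: d3; move: (K * d ^+ 3) (K * sigma ^+ 3) => D3 S3.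
lra.
Qed.

Let u_le (u : mR * mR) : disc sigma u -> `|u.1| <= d / 4 /\ `|u.2| <= d / 4.
Proof.
rewrite /disc/= => us; split; apply: le_trans sigmad;
  rewrite -(@ler_pXn2r _ 2)// ?nnegrE ?(ltW sigma0)// real_normK ?num_real//;
  apply: le_trans us; by rewrite ?lerDl ?lerDr sqr_ge0.
Qed.

Definition chord : space3 R := c 0%N d - c 0%N 0.

Let dd : `|d| <= 2 * d. Proof. by rewrite gtr0_norm// ler_peMl ?(ltW d0)// ler1n. Qed.

Let chord_T0 : enorm (chord - d *: T0) <= K * d ^+ 2.
Proof.
have := taylor2 ra (n := 0%N) isT zr (in_r dd).
by rewrite subr0 gtr0_norm.
Qed.

Let chord_norm : `|enorm chord - d| <= K * d ^+ 2.
Proof.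
have dT : enorm (d *: T0) = d by rewrite enormZ unitT// mulr1 gtr0_norm.
have h1 : enorm chord <= d + K * d ^+ 2.
  rewrite (_ : chord = d *: T0 + (chord - d *: T0)); last by apply: space3P => /=; ring.
  by rewrite (le_trans (ler_enormD _ _))// dT lerD2l.
have h2 : d <= enorm chord + K * d ^+ 2.
  rewrite -{1}dT (_ : d *: T0 = chord - (chord - d *: T0)); last first.
    by apply: space3P => /=; ring.
  by rewrite (le_trans (ler_enormB _ _))// lerD2l.
by rewrite ler_norml; apply/andP; split; lra.
Qed.

Lemma chord_norm_ge : 63 / 64 * d <= enorm chord.
Proof.
have := chord_norm; rewrite ler_norml => /andP[h _].
have : K * d ^+ 2 <= 1 / 64 * d by rewrite expr2 mulrA ler_wpM2r// ltW.
lra.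
Qed.

Lemma chord_norm_dist : `|enorm chord - d| <= K * d ^+ 2.
Proof. exact: chord_norm. Qed.

(** The times t and d - t are symmetric about d / 2, as are 0 and d. Even Taylor terms at the
    midpoint cancel, so both differences are multiples of the tangent there up to O(d^3), and the
    tangent can be eliminated. *)
Let chord_mid t : `|t| <= d / 4 ->
  enorm (c 0%N (d - t) - c 0%N t - ((d - 2 * t) / d) *: chord) <= 4 * K * d ^+ 3.
Proof.
move=> td; pose m := d / 2.
have td' : - (d / 4) <= t <= d / 4 by rewrite -ler_norml.
have mr : `|m| < r by apply: in_r; rewrite /m gtr0_norm ?divr_gt0//; lra.
have sym h : `|h| <= d -> enorm (c 0%N (m + h) - c 0%N (m - h) - (2 * h) *: c 1%N m)
    <= 2 * K * `|h| ^+ 3.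
  move=> hd; have hd' : - d <= h <= d by rewrite -ler_norml.
  have r1 : `|m + h| < r.
    by apply: in_r; rewrite ler_norml /m; case/andP: hd' => *; apply/andP; split; lra.
  have r2 : `|m - h| < r.
    by apply: in_r; rewrite ler_norml /m; case/andP: hd' => *; apply/andP; split; lra.
  have := taylor3 ra (n := 0%N) isT mr r1; have := taylor3 ra (n := 0%N) isT mr r2.
  rewrite (_ : m + h - m = h); last by ring.
  rewrite (_ : m - h - m = - h); last by ring.
  rewrite normrN sqrrN; set A := enorm _ <= _; set B := enorm _ <= _ => hA hB.
  rewrite (_ : 2 * K * _ = K * `|h| ^+ 3 + K * `|h| ^+ 3); last by ring.
  apply: le_trans (lerD hB hA); apply: le_trans (ler_enormB _ _).
  rewrite [X in enorm X <= _](_ : _ = c 0%N (m + h) - c 0%N m - h *: c 1%N m - (h ^+ 2 / 2) *: c 2%N m -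
    (c 0%N (m - h) - c 0%N m - (- h) *: c 1%N m - (h ^+ 2 / 2) *: c 2%N m))//.
  by apply: space3P => /=; rewrite /GRing.scale/=; ring.
have h1 : `|d / 2 - t| <= d by rewrite ler_norml; case/andP: td' => *; apply/andP; split; lra.
have h2 : `|d / 2| <= d by rewrite gtr0_norm ?divr_gt0//; lra.
have := sym _ h1; have := sym _ h2.
rewrite /m (_ : d / 2 + d / 2 = d); last by field.
rewrite (_ : d / 2 - d / 2 = 0); last by ring.
rewrite (_ : d / 2 + (d / 2 - t) = d - t); last by field.
rewrite (_ : d / 2 - (d / 2 - t) = t); last by ring.
rewrite (_ : 2 * (d / 2) = d); last by field.
rewrite (_ : 2 * (d / 2 - t) = d - 2 * t); last by field.
rewrite -/chord => B1 B2.
have d3 : 0 <= K * d ^+ 3 by rewrite mulr_ge0// exprn_ge0// ltW.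
have B1' : enorm (chord - d *: c 1%N (d / 2)) <= K * d ^+ 3.
  apply: (le_trans B1); rewrite gtr0_norm ?divr_gt0// expr_div_n.
  rewrite mulrA -[2 * K * _]mulrA; move: d3; move: (K * d ^+ 3) => D3 ?.
  by rewrite !exprS expr0; lra.
have B2' : enorm (c 0%N (d - t) - c 0%N t - (d - 2 * t) *: c 1%N (d / 2)) <= 2 * (K * d ^+ 3).
  apply: (le_trans B2); rewrite mulrA ler_wpM2l ?mulr_ge0//.
  by rewrite ler_pXn2r ?nnegrE// ltW.
have q : `|(d - 2 * t) / d| <= 2.
  rewrite normrM normfV (gtr0_norm d0) ler_pdivrMr// ler_norml.
  by case/andP: td' => *; apply/andP; split; lra.
rewrite (_ : c 0%N (d - t) - c 0%N t - ((d - 2 * t) / d) *: chord =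
  (c 0%N (d - t) - c 0%N t - (d - 2 * t) *: c 1%N (d / 2)) -
  ((d - 2 * t) / d) *: (chord - d *: c 1%N (d / 2))); last first.
  by apply: space3P => /=; rewrite /GRing.scale/=; field; rewrite gt_eqF.
rewrite (le_trans (ler_enormB _ _))// enormZ.
have := ler_pM (normr_ge0 _) (enorm_ge0 _) q B1'.
by move: B2'; rewrite -!mulrA; move: (K * d ^+ 3) => D3; lra.
Qed.

Definition displacement t u : space3 R := arc_map (d - t) u - arc_map t u.

Let range (t : R) : `|t| <= d / 4 -> `|t| <= 2 * d /\ `|d - t| <= 2 * d.
Proof.
rewrite !ler_norml => /andP[? ?]; split; apply/andP; split; lra.
Qed.

Let displacementE t u : `|t| <= d / 4 ->
  displacement t u = (c 0%N (d - t) - c 0%N t)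
    + u.1 *: (fr v1 (d - t) - fr v1 t) + u.2 *: (fr v2 (d - t) - fr v2 t)
    + (lambda (d - t) u *: c 2%N (d - t) - lambda t u *: c 2%N t).
Proof.
move=> /range[xd yd]; rewrite /displacement !arc_mapE//.
by move: (lambda _ _) (lambda _ _) => l l'; apply: space3P => /=; rewrite /GRing.scale/=; ring.
Qed.

(** The base points contribute through [chord_mid], the offsets through [fr_var], and the shift
    through the smoothness of the curvature vector; each leaves an error O(d^3). *)
Lemma displacement_along t u : `|t| <= d / 4 -> disc sigma u ->
  exists2 b, 1 / 4 <= b & enorm (displacement t u - b *: chord) <= 50 * K ^+ 2 * d ^+ 3.
Proof.
move=> td us; have [xd yd] := range td; rewrite displacementE//.
have td' : - (d / 4) <= t <= d / 4 by rewrite -ler_norml.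
have [a1 a1d H1] := fr_var v1T v11 xd yd.
have [a2 a2d H2] := fr_var v2T v21 xd yd.
have [u1 u2] := u_le us.
(* The first term is at least 1/2 because |t| <= d/4; the tangential frame variations contribute at
   least -1/16 each. *)
exists ((d - 2 * t) / d + u.1 * a1 / d + u.2 * a2 / d).
  have dn0 : 0 < d^-1 by rewrite invr_gt0.
  have bnd (w a : R) : `|w| <= d / 4 -> `|a| <= 8 * K * d -> - (1 / 16) <= w * a / d.
    move=> wd ad; have : `|w * a / d| <= 1 / 16.
      rewrite normrM normfV (gtr0_norm d0) ler_pdivrMr// normrM.
      apply: le_trans (ler_pM (normr_ge0 _) (normr_ge0 _) wd ad) _.
      by move: (mulr_ge0 K0 (ltW d0)) Kd; nra.
    by rewrite ler_norml => /andP[].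
  have := bnd _ _ u1 a1d; have := bnd _ _ u2 a2d.
  have : 1 / 2 <= (d - 2 * t) / d by rewrite ler_pdivlMr//; case/andP: td' => *; lra.
  by lra.
have E2 : enorm (T0 - d^-1 *: chord) <= K * d.
  rewrite (_ : T0 - _ = (- d^-1) *: (chord - d *: T0)); last first.
    by apply: space3P => /=; rewrite /GRing.scale/=; field; rewrite gt_eqF.
  rewrite enormZ normrN normfV (gtr0_norm d0) mulrC ler_pdivrMr//.
  by rewrite -mulrA -expr2.
have L1 := lambda_bound xd us; have L2 := lambda_bound yd us.
have [lx ly] : `|lambda t u| <= d ^+ 2 /\ `|lambda (d - t) u - lambda t u| <= 2 * (K * d ^+ 3).
  case: L1 => h1 h2; case: L2 => h3 h4; split=> //.
  move: h2 h4; set n := (_ - sigma ^+ 2) / 2 => h2 h4.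
  rewrite (le_trans (ler_distD n _ _))// mulr_natl mulr2n lerD//.
  by rewrite distrC.
have c2y : enorm (c 2%N (d - t)) <= K by apply: (ra_bnd ra) => //; exact: in_r.
have c2xy : enorm (c 2%N (d - t) - c 2%N t) <= K * (2 * d).
  rewrite (le_trans (taylor1 ra _ (in_r xd) (in_r yd)))// ler_wpM2l//.
  by rewrite ler_norml; case/andP: td' => *; apply/andP; split; lra.
set X := c 0%N (d - t) - c 0%N t.
set F1 := fr v1 (d - t) - fr v1 t in H1 *.
set F2 := fr v2 (d - t) - fr v2 t in H2 *.
set ly' := lambda (d - t) u in ly L2 *; set lx' := lambda t u in lx ly L1 *.
set cy := c 2%N (d - t) in c2y c2xy *; set cx := c 2%N t in c2xy *.
(* Four groups: base points against the chord, frame variation beyond its tangential part,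
   replacement of T0 by chord / d, and change of the shift between the two ends. *)
rewrite (_ : _ - _ *: chord = (X - ((d - 2 * t) / d) *: chord)
  + (u.1 *: (F1 - a1 *: T0) + u.2 *: (F2 - a2 *: T0))
  + ((u.1 * a1) *: (T0 - d^-1 *: chord) + (u.2 * a2) *: (T0 - d^-1 *: chord))
  + ((ly' - lx') *: cy + lx' *: (cy - cx))); last first.
  by apply: space3P => /=; rewrite /GRing.scale/=; field; rewrite gt_eqF.
have P0 := chord_mid td; rewrite -/X in P0.
have Q (w : R) (F : space3 R) : `|w| <= d / 4 -> enorm F <= 8 * K ^+ 2 * d ^+ 2 ->
    enorm (w *: F) <= 2 * (K ^+ 2 * d ^+ 3).
  move=> wd Fd; rewrite enormZ (le_trans (ler_pM _ _ wd Fd)) ?enorm_ge0//.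
  by rewrite (_ : d / 4 * _ = 2 * (K ^+ 2 * d ^+ 3))//; field.
have Q' (w a : R) : `|w| <= d / 4 -> `|a| <= 8 * K * d ->
    enorm ((w * a) *: (T0 - d^-1 *: chord)) <= 2 * (K ^+ 2 * d ^+ 3).
  move=> wd ad; rewrite enormZ normrM.
  have H := ler_pM (normr_ge0 _) (normr_ge0 _) wd ad.
  rewrite (le_trans (ler_pM _ _ H E2)) ?enorm_ge0 ?mulr_ge0//.
  by rewrite (_ : d / 4 * _ * _ = 2 * (K ^+ 2 * d ^+ 3))//; field.
have P1 := Q _ _ u1 H1; have P2 := Q _ _ u2 H2.
have P3 := Q' _ _ u1 a1d; have P4 := Q' _ _ u2 a2d.
have P5 : enorm ((ly' - lx') *: cy) <= 2 * (K ^+ 2 * d ^+ 3).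
  rewrite enormZ (le_trans (ler_pM _ _ ly c2y)) ?enorm_ge0//.
  by rewrite (_ : 2 * _ * _ = 2 * (K ^+ 2 * d ^+ 3))//; ring.
have P6 : enorm (lx' *: (cy - cx)) <= 2 * (K * d ^+ 3).
  rewrite enormZ (le_trans (ler_pM _ _ lx c2xy)) ?enorm_ge0//.
  by rewrite (_ : _ ^+ 2 * _ = 2 * (K * d ^+ 3))//; ring.
have KK : K * d ^+ 3 <= K ^+ 2 * d ^+ 3.
  by rewrite ler_wpM2r ?exprn_ge0 ?(ltW d0)// expr2 ler_peMl.
set A1 := X - _; set A2 := _ *: _ + _ *: _; set A3 := _ *: _ + _ *: _; set A4 := _ *: _ + _ *: _.
have := ler_enormD (A1 + A2 + A3) A4; have := ler_enormD (A1 + A2) A3.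
have := ler_enormD A1 A2; rewrite /A2 /A3 /A4.
have := ler_enormD (u.1 *: (F1 - a1 *: T0)) (u.2 *: (F2 - a2 *: T0)).
have := ler_enormD ((u.1 * a1) *: (T0 - d^-1 *: chord)) ((u.2 * a2) *: (T0 - d^-1 *: chord)).
have := ler_enormD ((ly' - lx') *: cy) (lx' *: (cy - cx)).
have KK0 : 0 <= K ^+ 2 * d ^+ 3 by rewrite mulr_ge0 ?sqr_ge0// exprn_ge0// ltW.
rewrite -mulrA in P0; rewrite -[50 * _ * _]mulrA.
move: P0 P1 P2 P3 P4 P5 P6 KK KK0; move: (K * d ^+ 3) (K ^+ 2 * d ^+ 3) => D3 D4.
lra.
Qed.

Definition chord_dir : space3 R := (enorm chord)^-1 *: chord.

Let L0 : 0 < enorm chord.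
Proof. by apply: lt_le_trans chord_norm_ge; rewrite mulr_gt0. Qed.

Lemma chord_dir_norm : enorm chord_dir = 1.
Proof. by rewrite enormZ ger0_norm ?invr_ge0 ?enorm_ge0// mulVf// gt_eqF. Qed.

Lemma dot_chord_dir : dot chord chord_dir = enorm chord.
Proof. by rewrite dotZr -sqr_enorm expr2 mulKf// gt_eqF. Qed.

(** Pythagoras: among all D - a e the shortest is the component of D orthogonal to e. *)
Let dot_le_along (D e : space3 R) (a : R) : enorm e = 1 ->
  dot D D <= dot D e ^+ 2 + enorm (D - a *: e) ^+ 2.
Proof.
move=> e1; have ee : dot e e = 1 by rewrite -sqr_enorm e1 expr1n.
rewrite sqr_enorm !(dotDl, dotDr, dotNl, dotNr, dotZl, dotZr) ee (dotC e D).
by have := sqr_ge0 (dot D e - a); nra.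
Qed.

(** The part across the chord is at most E d^3 with E = 50 K^2, and D.e >= d / 8. Hence |D| - D.e is
    at most E^2 d^6 / (2 D.e) <= 4 E^2 d^5, and d <= 1 gives the stated power. *)
Lemma displacement_dir t u : `|t| <= d / 4 -> disc sigma u ->
  0 <= dot (displacement t u) chord_dir /\
  enorm (displacement t u) <= dot (displacement t u) chord_dir + 4 * (50 * K ^+ 2) ^+ 2 * d ^+ 4.
Proof.
move=> td us; have [b b4 H] := displacement_along td us.
set D := displacement t u in H *; set w := D - b *: chord in H.
have Dw : D = b *: chord + w by rewrite /w; apply: space3P => /=; ring.
have De : dot D chord_dir = b * enorm chord + dot w chord_dir.
  by rewrite Dw dotDl dotZl dot_chord_dir.
have we : `|dot w chord_dir| <= enorm w.
  by rewrite (le_trans (dot_le_enorm _ _))// chord_dir_norm mulr1.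
have wd : enorm w <= 50 / 4096 * d.
  apply: le_trans H _; rewrite (_ : 50 * _ * _ = 50 * (K * d) * (K * d) * d); last by ring.
  rewrite ler_wpM2r ?(ltW d0)//.
  by have := mulr_ge0 K0 (ltW d0); move: Kd; move: (K * d) => a; nra.
have ge : d / 8 <= dot D chord_dir.
  have : 1 / 4 * (63 / 64 * d) <= b * enorm chord.
    by rewrite ler_pM ?chord_norm_ge// mulr_ge0// ltW.
  rewrite De.
  by move: we; rewrite ler_norml => /andP[? _]; move: wd d0; lra.
have DD : dot D D <= dot D chord_dir ^+ 2 + enorm w ^+ 2.
  have -> : w = D - (b * enorm chord) *: chord_dir.
    rewrite /w /chord_dir; move: (gt_eqF L0) => Ln; apply: space3P => /=;
      rewrite /GRing.scale/= mulrA mulfK ?Ln//.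
  exact: dot_le_along chord_dir_norm.
have pos : 0 < dot D chord_dir by apply: lt_le_trans ge; rewrite divr_gt0.
split; first exact: ltW.
have w2 : enorm w ^+ 2 <= (50 * K ^+ 2) ^+ 2 * d ^+ 6.
  rewrite -[6%N]/(3 * 2)%N exprM -[leRHS]exprMn.
  by rewrite ler_pXn2r// nnegrE ?enorm_ge0// !mulr_ge0 ?exprn_ge0// ltW.
move: H w2; set E := 50 * K ^+ 2 => _ w2.
have Z0 : 0 <= 4 * E ^+ 2 * d ^+ 5.
  by rewrite !mulr_ge0 ?sqr_ge0 ?exprn_ge0// ltW.
apply: (@le_trans _ _ (dot D chord_dir + 4 * E ^+ 2 * d ^+ 5)).
  apply: ler_enorm_sqr; first by rewrite addr_ge0// ltW.
  apply: (le_trans DD); rewrite (le_trans (lerD (lexx _) w2))//.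
  have zE : E ^+ 2 * d ^+ 6 = d / 4 * (4 * E ^+ 2 * d ^+ 5) by field.
  rewrite zE; move: (dot D chord_dir) (4 * _ * _) Z0 ge => a z Z0 ge.
  have : d / 4 * z <= 2 * a * z by rewrite ler_wpM2r//; move: ge; lra.
  by have := sqr_ge0 z; rewrite !expr2; lra.
rewrite lerD2l ler_wpM2l ?mulr_ge0 ?sqr_ge0//.
by rewrite exprS ler_piMl ?exprn_ge0// ltW.
Qed.

Let dir_T0 : enorm (chord_dir - T0) <= 4 * K * d.
Proof.
have dn : 0 < d^-1 by rewrite invr_gt0.
rewrite (_ : chord_dir - T0 =
  d^-1 *: ((chord - d *: T0) + (d - enorm chord) *: chord_dir)); last first.
  by rewrite /chord_dir; apply: space3P => /=; rewrite /GRing.scale/=; field;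
    rewrite !gt_eqF.
rewrite enormZ gtr0_norm// mulrC ler_pdivrMr//.
rewrite (le_trans (ler_enormD _ _))// enormZ chord_dir_norm mulr1 distrC.
have := chord_norm; have := chord_T0.
have : 0 <= K * d ^+ 2 by rewrite mulr_ge0 ?sqr_ge0.
by rewrite (_ : 4 * K * d * d = 4 * (K * d ^+ 2)); [lra | ring].
Qed.

Let dir_T t : `|t| <= 2 * d -> enorm (chord_dir - c 1%N t) <= 6 * K * d.
Proof.
move=> td; rewrite (le_trans (ler_enorm_distD T0 _ _))//.
have := T_near td; rewrite (enorm_distC T0); have := dir_T0.
by rewrite -!mulrA; move: (K * d) => a; lra.
Qed.

(** The second derivative is orthogonal to the tangent, and the chord direction is O(d) away from
    the tangent. *)
Let dot_dir_c2 t : `|t| <= 2 * d -> `|dot (c 2%N t) chord_dir| <= 6 * K ^+ 2 * d.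
Proof.
move=> td; have tr := in_r td.
have -> : dot (c 2%N t) chord_dir = dot (c 2%N t) (chord_dir - c 1%N t).
  by rewrite dotDr dotNr (dotC _ (c 1%N t)) (dot_c1_c2 ra tr) subr0.
rewrite (le_trans (dot_le_enorm _ _))//.
rewrite (_ : 6 * _ * _ = K * (6 * K * d)); last by ring.
by rewrite ler_pM ?enorm_ge0 ?dir_T//; exact: (ra_bnd ra).
Qed.

Let curv := dot (c 2%N 0) (c 2%N 0).

Let curv_var t : `|t| <= 2 * d ->
  `|dot (c 2%N t) (c 2%N t) - curv| <= 2 * K ^+ 2 * `|t|.
Proof.
move=> td; have tr := in_r td.
have -> : dot (c 2%N t) (c 2%N t) - curv = dot (c 2%N t + c 2%N 0) (c 2%N t - c 2%N 0).
  by rewrite /curv !(dotDl, dotDr, dotNr) (dotC (c 2%N 0) (c 2%N t)); ring.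
rewrite (le_trans (dot_le_enorm _ _))//.
rewrite (_ : 2 * _ * _ = (K + K) * (K * `|t|)); last by ring.
apply: ler_pM; rewrite ?enorm_ge0//.
  by rewrite (le_trans (ler_enormD _ _))// lerD//; exact: (ra_bnd ra).
by have := taylor1 ra (n := 2%N) isT zr tr; rewrite subr0.
Qed.

(** Along the chord direction c'' varies at the rate c'''.e, close to c'''.c' = -|c''|^2, itself
    close to -[curv]. *)
Let dot_dir_c2_var x y : `|x| <= 2 * d -> `|y| <= 2 * d ->
  `|dot (c 2%N y - c 2%N x) chord_dir + (y - x) * curv| <=
    `|y - x| * (6 * K ^+ 2 * d + 2 * K ^+ 2 * `|x|) + K * `|y - x| ^+ 2.
Proof.
move=> xd yd; have xr := in_r xd; have yr := in_r yd.
have H := taylor2 ra (n := 2%N) isT xr yr.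
have -> : dot (c 2%N y - c 2%N x) chord_dir + (y - x) * curv =
    (y - x) * (dot (c 3%N x) (chord_dir - c 1%N x) - (dot (c 2%N x) (c 2%N x) - curv))
    + dot (c 2%N y - c 2%N x - (y - x) *: c 3%N x) chord_dir.
  have : dot (c 3%N x) (c 1%N x) = - dot (c 2%N x) (c 2%N x).
    by rewrite dotC (dot_c1_c3 ra xr).
  by rewrite !(dotDl, dotDr, dotNr, dotNl, dotZl) => ->; ring.
rewrite (le_trans (ler_normD _ _))// lerD//.
  rewrite normrM ler_wpM2l// (le_trans (ler_normB _ _))// lerD ?curv_var//.
  rewrite (le_trans (dot_le_enorm _ _))// (_ : 6 * _ * _ = K * (6 * K * d)); last by ring.
  by rewrite ler_pM ?enorm_ge0 ?dir_T//; exact: (ra_bnd ra).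
by rewrite (le_trans (dot_le_enorm _ _))// chord_dir_norm mulr1.
Qed.

Let dot_dir_c2_diff t : `|t| <= d / 4 ->
  `|dot (c 2%N (d - t) - c 2%N t) chord_dir + (d - 2 * t) * curv| <= 16 * K ^+ 2 * d ^+ 2.
Proof.
move=> td; have [xd yd] := range td.
have := dot_dir_c2_var xd yd; rewrite (_ : d - t - t = d - 2 * t); last by ring.
move=> /le_trans; apply.
have h : `|d - 2 * t| <= 3 / 2 * d.
  by move: td; rewrite !ler_norml => /andP[? ?]; apply/andP; split; lra.
have K2 : K <= K ^+ 2 by rewrite expr2 ler_peMl.
have h2 : K * `|d - 2 * t| ^+ 2 <= K ^+ 2 * (3 / 2 * d) ^+ 2.
  by rewrite ler_pM ?sqr_ge0// ler_pXn2r// nnegrE// mulr_ge0// ltW.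
have h3 : 6 * K ^+ 2 * d + 2 * K ^+ 2 * `|t| <= 13 / 2 * (K ^+ 2 * d).
  have := ler_wpM2l (sqr_ge0 K) td.
  by rewrite -!mulrA; move: (K ^+ 2 * d) (K ^+ 2 * `|t|) => a b; rewrite ?mulrA; lra.
have h4 := ler_pM (normr_ge0 _) _ h h3.
rewrite (le_trans (lerD (h4 _) h2))//.
  by rewrite addr_ge0// !mulr_ge0 ?sqr_ge0// ltW.
rewrite (_ : _ + _ = 12 * (K ^+ 2 * d ^+ 2)); last by field.
have : 0 <= K ^+ 2 * d ^+ 2 by rewrite mulr_ge0 ?sqr_ge0.
by rewrite -[16 * _ * _]mulrA; move: (K ^+ 2 * d ^+ 2) => a; lra.
Qed.

(** Both shifts equal n = (|u|^2 - sigma^2) / 2 up to O(d^3). Those errors meet c''.e = O(d), which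
    leaves n times the variation of c'' along e. *)
Let bend_term t u : disc sigma u -> `|t| <= d / 4 ->
  `|dot (lambda (d - t) u *: c 2%N (d - t) - lambda t u *: c 2%N t) chord_dir
    + (u.1 ^+ 2 + u.2 ^+ 2 - sigma ^+ 2) / 2 * ((d - 2 * t) * curv)|
    <= 13 * K ^+ 3 * d ^+ 4.
Proof.
move=> us td; have [xd yd] := range td.
have [_ lx] := lambda_bound xd us; have [_ ly] := lambda_bound yd us.
have n2 : `|(u.1 ^+ 2 + u.2 ^+ 2 - sigma ^+ 2) / 2| <= d ^+ 2 / 32.
  have s0 : 0 <= u.1 ^+ 2 + u.2 ^+ 2 by rewrite addr_ge0 ?sqr_ge0.
  have s1 : u.1 ^+ 2 + u.2 ^+ 2 <= sigma ^+ 2 by [].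
  have : sigma ^+ 2 <= (d / 4) ^+ 2 by rewrite ler_pXn2r// nnegrE ltW// divr_gt0.
  rewrite (_ : (d / 4) ^+ 2 = d ^+ 2 / 16); last by field.
  move: s0 s1; move: (u.1 ^+ 2 + u.2 ^+ 2) (sigma ^+ 2) (d ^+ 2) => a b e a0 ab be.
  by rewrite ler_norml; apply/andP; split; lra.
move: lx ly n2; set n := (_ - sigma ^+ 2) / 2 => lx ly n2.
have -> : dot (lambda (d - t) u *: c 2%N (d - t) - lambda t u *: c 2%N t) chord_dir
    + n * ((d - 2 * t) * curv) =
    n * (dot (c 2%N (d - t) - c 2%N t) chord_dir + (d - 2 * t) * curv)
    + (lambda (d - t) u - n) * dot (c 2%N (d - t)) chord_dir
    - (lambda t u - n) * dot (c 2%N t) chord_dir.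
  by rewrite !(dotDl, dotNl, dotZl); ring.
have A1 := ler_pM (normr_ge0 _) (normr_ge0 _) n2 (dot_dir_c2_diff td).
have A2 := ler_pM (normr_ge0 _) (normr_ge0 _) ly (dot_dir_c2 yd).
have A3 := ler_pM (normr_ge0 _) (normr_ge0 _) lx (dot_dir_c2 xd).
rewrite -!normrM in A1 A2 A3.
rewrite (le_trans (ler_normB _ _))//.
rewrite (le_trans (lerD (le_trans (ler_normD _ _) (lerD A1 A2)) A3))//.
have KK : K ^+ 2 * d ^+ 4 <= K ^+ 3 * d ^+ 4.
  by rewrite ler_wpM2r ?exprn_ge0 ?(ltW d0)// [K ^+ 3]exprS ler_peMl ?sqr_ge0.
rewrite (_ : _ + _ + _ = K ^+ 2 * d ^+ 4 / 2 + 12 * (K ^+ 3 * d ^+ 4)); last by field.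
have : 0 <= K ^+ 2 * d ^+ 4 by rewrite mulr_ge0 ?sqr_ge0// exprn_ge0// ltW.
by rewrite -(mulrA 13); move: KK; move: (K ^+ 2 * d ^+ 4) (K ^+ 3 * d ^+ 4) => a b; lra.
Qed.

(** Expand to fourth order around the two ends, at 0 and at d. In the sum over t and -t odd powers
    cancel, and what remains beyond the chord is t^2 times the variation of c''.e from 0 to d. *)
Let curve_term t : `|t| <= d / 4 ->
  `|dot (c 0%N (d - t) - c 0%N t + (c 0%N (d + t) - c 0%N (- t))) chord_dir
    - 2 * enorm chord + t ^+ 2 * (d * curv)| <= 2 * (K ^+ 2 * d ^+ 4).
Proof.
move=> td; have td' : `|- t| <= d / 4 by rewrite normrN.
have [tr1 tr2] := range td; have [] := range td'; rewrite opprK => tr3 tr4.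
have H0 := dot_dir_c2_diff (t := 0); move: H0.
rewrite normr0 mulr0 !subr0 divr_ge0 ?(ltW d0)// => /(_ isT) H0.
have B1 := taylor4 ra (in_r dd) (in_r tr2); have B2 := taylor4 ra (in_r dd) (in_r tr4).
have B3 := taylor4 ra zr (in_r tr1); have B4 := taylor4 ra zr (in_r tr3).
rewrite (_ : d - t - d = - t) in B1; last by ring.
rewrite (_ : d + t - d = t) in B2; last by ring.
rewrite !subr0 in B3 B4; rewrite normrN in B1 B4.
set E1 := (X in enorm X <= _) in B1; set E2 := (X in enorm X <= _) in B2.
set E3 := (X in enorm X <= _) in B3; set E4 := (X in enorm X <= _) in B4.
have -> : dot (c 0%N (d - t) - c 0%N t + (c 0%N (d + t) - c 0%N (- t))) chord_dir
    - 2 * enorm chord + t ^+ 2 * (d * curv) =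
    dot (E1 + E2 - (E3 + E4)) chord_dir
    + t ^+ 2 * (dot (c 2%N d - c 2%N 0) chord_dir + d * curv).
  rewrite -dot_chord_dir /E1 /E2 /E3 /E4 /chord.
  by rewrite !(dotDl, dotNl, dotZl); field.
have t4 : K * `|t| ^+ 4 <= K ^+ 2 * d ^+ 4 / 256.
  rewrite (_ : _ / 256 = K ^+ 2 * (d / 4) ^+ 4); last by field.
  by rewrite ler_pM ?exprn_ge0// ?ler_pXn2r ?nnegrE ?divr_ge0 ?(ltW d0)// expr2 ler_peMl.
have t2 : `|t ^+ 2| <= d ^+ 2 / 16.
  rewrite (_ : d ^+ 2 / 16 = (d / 4) ^+ 2); last by field.
  by rewrite normrX ler_pXn2r ?nnegrE ?divr_ge0 ?(ltW d0).
have A1 := ler_pM (normr_ge0 _) (normr_ge0 _) t2 H0.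
rewrite -normrM in A1.
rewrite (le_trans (ler_normD _ _))// mulr_natl mulr2n lerD//; last first.
  apply: (le_trans A1).
  by rewrite (_ : _ / 16 * _ = K ^+ 2 * d ^+ 4)//; field.
rewrite (le_trans (dot_le_enorm _ _))// chord_dir_norm mulr1.
have := ler_enormB (E1 + E2) (E3 + E4); have := ler_enormD E1 E2; have := ler_enormD E3 E4.
have : 0 <= K ^+ 2 * d ^+ 4 by rewrite mulr_ge0 ?sqr_ge0// exprn_ge0// ltW.
by move: B1 B2 B3 B4 t4; move: (K * `|t| ^+ 4) (K ^+ 2 * d ^+ 4) => a b; lra.
Qed.

Definition height t u := dot (displacement t u) chord_dir.

(** The four signs remove the frame terms, linear in u, and the terms odd in t; [curve_term] and
    [bend_term] evaluate the rest. *)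
Lemma height_sym t u : `|t| <= d / 4 -> disc sigma u ->
  `|height t u + height t (- u) + height (- t) u + height (- t) (- u)
    - 4 * (enorm chord
           - d * curv * (t ^+ 2 + (u.1 ^+ 2 + u.2 ^+ 2) - sigma ^+ 2) / 2)|
    <= 100 * K ^+ 3 * d ^+ 4.
Proof.
move=> td us; have td' : `|- t| <= d / 4 by rewrite normrN.
have us' : disc sigma (- u) by move: us; rewrite /disc/= !sqrrN.
have C := curve_term td.
have D1 := bend_term us td; have D2 := bend_term us' td.
have D3 := bend_term us td'; have D4 := bend_term us' td'.
rewrite /= !sqrrN in D2 D4.
rewrite /height !displacementE// !(dotDl, dotZl) /=.
rewrite !opprK in D3 D4 *.
have KK : K ^+ 2 * d ^+ 4 <= K ^+ 3 * d ^+ 4.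
  by rewrite ler_wpM2r ?exprn_ge0 ?(ltW d0)// [K ^+ 3]exprS ler_peMl ?sqr_ge0.
have K3 : 0 <= K ^+ 2 * d ^+ 4 by rewrite mulr_ge0 ?sqr_ge0// exprn_ge0// ltW.
rewrite -mulrA in D1 D2 D3 D4; rewrite -[100 * _ * _]mulrA.
rewrite !(dotDl, dotNl, dotZl) in C D1 D2 D3 D4 *.
rewrite !ler_norml in C D1 D2 D3 D4 *.
move: C D1 D2 D3 D4 => /andP[? ?] /andP[? ?] /andP[? ?] /andP[? ?] /andP[? ?].
apply/andP; split; lra.
Qed.

Lemma arc_map_bound t u : `|t| <= 2 * d -> disc sigma u -> enorm (arc_map t u) <= 4 * K.
Proof.
move=> td us; rewrite arc_mapE//; have [l1 _] := lambda_bound td us.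
have [u1 u2] := u_le us; have tr := in_r td.
have [[_ p1 q1] _] := arc_frame td.
have c0K := ra_bnd ra (n := 0%N) isT tr; have c2K := ra_bnd ra (n := 2%N) isT tr.
have f1 : enorm (fr v1 t) = 1 by rewrite /enorm p1 sqrtr1.
have f2 : enorm (fr v2 t) = 1 by rewrite /enorm q1 sqrtr1.
have h1 : enorm (u.1 *: fr v1 t) <= d / 4 by rewrite enormZ f1 mulr1.
have h2 : enorm (u.2 *: fr v2 t) <= d / 4 by rewrite enormZ f2 mulr1.
have h3 : enorm (lambda t u *: c 2%N t) <= 1 * K.
  rewrite enormZ ler_pM ?enorm_ge0// (le_trans l1)// expr2.
  by rewrite mulr_ile1// ltW.
have := ler_enormD (c 0%N t + u.1 *: fr v1 t + u.2 *: fr v2 t) (lambda t u *: c 2%N t).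
have := ler_enormD (c 0%N t + u.1 *: fr v1 t) (u.2 *: fr v2 t).
have := ler_enormD (c 0%N t) (u.1 *: fr v1 t).
by move: K1 d1; lra.
Qed.
End displacement.

(** * Uniform laws and couplings *)

Section uniform_probability.
Context d (T : measurableType d) (R : realType).
Variables (mu : {measure set T -> \bar R}) (D : set T) (mD : measurable D).
Variable P : probability T R.
Local Open Scope ereal_scope.

(** P is the default value of [mnormalize] when the mass of D is zero or infinite, which [D0] and
    [Doo] exclude. *)
Definition uniform_on : probability T R := mnormalize (mrestr mu mD) P.

Hypotheses (D0 : mu D != 0) (Doo : mu D != +oo).

Lemma uniform_onE A : uniform_on A = mu (A `&` D) / mu D.
Proof.
have mDT : mrestr mu mD setT = mu D by rewrite /mrestr setTI.
rewrite /uniform_on/= /mnormalize/= !mDT (negbTE D0) (negbTE Doo)/= /mrestr.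
have fD : mu D \is a fin_num by rewrite ge0_fin_numE// ltey.
by rewrite -[in RHS](fineK fD) inver fine_eq0// (negbTE D0).
Qed.

Lemma integral_uniform_on (f : T -> \bar R) : measurable_fun setT f ->
  (forall x, 0 <= f x) ->
  \int[uniform_on]_x f x = (fine (mu D))^-1%:E * \int[mu]_(x in D) f x.
Proof.
move=> mf f0; have mDT : mrestr mu mD setT = mu D by rewrite /mrestr setTI.
have c0 : (0 <= (fine (mu D))^-1)%R by rewrite invr_ge0 fine_ge0.
transitivity (\int[mscale (NngNum c0) (mrestr mu mD)]_x f x).
  apply: eq_measure_integral => A mA _.
  by rewrite /uniform_on/= /mnormalize/= !mDT (negbTE D0) (negbTE Doo)/= /mscale/= muleC.
rewrite ge0_integral_mscale//; congr (_ * _).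
rewrite -(setUv D) ge0_integral_setU//; last 3 first.
- exact: measurableC.
- by rewrite setUv.
- by rewrite disj_set2E setICr.
rewrite [X in _ + X](_ : _ = 0) ?adde0; last first.
  rewrite (eq_measure_integral mzero) ?integral_measure_zero// => A mA AD.
  transitivity (mu (A `&` D)); first by [].
  by move/disjoints_subset : AD => ->; rewrite measure0.
apply: eq_measure_integral => A mA AD.
by transitivity (mu (A `&` D)); [|rewrite setIidl].
Qed.

Lemma le_integral_uniform_on (f g : T -> \bar R) : measurable_fun setT f ->
  measurable_fun setT g -> (forall x, 0 <= f x) -> (forall x, 0 <= g x) ->
  (forall x, D x -> f x <= g x) -> \int[uniform_on]_x f x <= \int[uniform_on]_x g x.
Proof.
move=> mf mg f0 g0 fg; rewrite !integral_uniform_on//.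
rewrite lee_wpmul2l ?lee_fin ?invr_ge0 ?fine_ge0//.
by apply: ge0_le_integral => //; exact: measurable_funTS.
Qed.
End uniform_probability.

(** * Second moments of the interval and of the disc *)

Section moments.
Context {R : realType}.
Notation mR := (measurableTypeR R).
Notation lam := (@lebesgue_measure R).
Notation lam2 := (lam \x lam)%E.

(** The factor 3 makes the primitive x^3 + b x, so the mean c^2 + b involves no division. The
    constant b will be the squared height of a chord of the disc. *)
Lemma integral_sqr_itv (c b : R) : 0 <= c -> 0 <= b ->
  (\int[lam]_(x in `[(- c)%R, c]) (3 * x ^+ 2 + b)%:E = (c ^+ 2 + b)%:E * lam `[(- c)%R, c])%E.
Proof.
move=> c0 b0; rewrite lebesgue_measure_itv/= lte_fin.
transitivity ((c ^+ 3 + b * c) - ((- c) ^+ 3 + b * - c))%:E.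
  apply: (@FTC_is_derive R (fun x => x ^+ 3 + b * x) (fun x => 3 * x ^+ 2 + b)).
  - by move: c0; lra.
  - by move=> t _; apply: is_derive_eq; rewrite /GRing.scale/=; ring.
  - move=> t _; apply: continuousD; last exact: cst_continuous.
    by apply: continuousM; [exact: cst_continuous|exact: exprn_continuous].
case: ltP => cc; last first.
  by have -> : c = 0 by [lra]; rewrite mule0 oppr0 subrr.
by rewrite -EFinD -EFinM; congr (_%:E); ring.
Qed.

Lemma integral_sqr_oitv (c b : R) : 0 <= c -> 0 <= b ->
  (\int[lam]_(x in `](- c)%R, c[) (3 * x ^+ 2 + b)%:E = (c ^+ 2 + b)%:E * lam `](- c)%R, c[)%E.
Proof.
move=> c0 b0; rewrite -(integral_itv_bndoo true false) ?integral_sqr_itv//.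
  by rewrite !lebesgue_measure_itv.
by apply/measurable_EFinP; apply: measurable_funTS; measurability.
Qed.

Lemma ge0_integral12 (F : mR * (mR * mR) -> \bar R) : measurable_fun setT F ->
  (forall x, 0 <= F x)%E ->
  (\int[lebesgue12]_x F x = \int[lam]_t \int[lam2]_u F (t, u))%E.
Proof. by move=> mF F0; exact: (fubini_tonelli1 (m1 := lam) (m2 := @lebesgue2 R)). Qed.

Lemma ge0_integral21 (F : mR * (mR * mR) -> \bar R) : measurable_fun setT F ->
  (forall x, 0 <= F x)%E ->
  (\int[lebesgue12]_x F x = \int[lam2]_u \int[lam]_t F (t, u))%E.
Proof. by move=> mF F0; exact: (fubini_tonelli2 (m1 := lam) (m2 := @lebesgue2 R)). Qed.

Lemma measurable_snd_section (F : mR * (mR * mR) -> \bar R) t :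
  measurable_fun setT F -> measurable_fun setT (fun u => F (t, u)).
Proof. by move=> mF; apply: (measurableT_comp mF); measurability. Qed.

Lemma ge0_integral12_affine (a b : R) (F : mR * (mR * mR) -> \bar R) : `|a| = 1 ->
  measurable_fun setT F -> (forall x, 0 <= F x)%E ->
  (\int[lebesgue12]_x F (a * x.1 + b, x.2)%R = \int[lebesgue12]_x F x)%E.
Proof.
move=> a1 mF F0.
have mF' : measurable_fun setT (fun x : mR * (mR * mR) => F (a * x.1 + b, x.2)%R).
  by apply: (measurableT_comp mF); measurability.
rewrite (ge0_integral12 mF F0) (ge0_integral12 mF' (fun x => F0 _)) /=.
rewrite (@ge0_integral_affine _ a b (fun t => \int[lam2]_u F (t, u))%E).
- by rewrite a1 invr1 mul1e.
- by rewrite -normr_gt0 a1.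
- exact: (measurable_fun_fubini_tonelli_F (m2 := @lebesgue2 R) F).
- by move=> t; apply: integral_ge0.
Qed.

Lemma ge0_integral12_opp (F : mR * (mR * mR) -> \bar R) :
  measurable_fun setT F -> (forall x, 0 <= F x)%E ->
  (\int[lebesgue12]_x F (x.1, (- x.2.1, - x.2.2)%R) = \int[lebesgue12]_x F x)%E.
Proof.
move=> mF F0.
have mF' : measurable_fun setT (fun x : mR * (mR * mR) => F (x.1, (- x.2.1, - x.2.2)%R)).
  by apply: (measurableT_comp mF); measurability.
rewrite (ge0_integral12 mF F0) (ge0_integral12 mF' (fun x => F0 _)) /=.
apply: eq_integral => t _ /=.
have := @ge0_integral_linear _ (-1) 0 0 (-1) 0 0 (fun u => F (t, u)) _ (measurable_snd_section t mF).
rewrite mulr0 subr0 mulrNN mulr1 normr1 invr1 mul1e oner_eq0 => <-//.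
apply: eq_integral => -[u1 u2] _; congr (F (t, _)).
by congr (_, _) => /=; ring.
Qed.

Lemma ge0_integral12_swap (F : mR * (mR * mR) -> \bar R) :
  measurable_fun setT F -> (forall x, 0 <= F x)%E ->
  (\int[lebesgue12]_x F (x.1, (x.2.2, x.2.1)) = \int[lebesgue12]_x F x)%E.
Proof.
move=> mF F0.
have mF' : measurable_fun setT (fun x : mR * (mR * mR) => F (x.1, (x.2.2, x.2.1))).
  by apply: (measurableT_comp mF); measurability.
rewrite (ge0_integral12 mF F0) (ge0_integral12 mF' (fun x => F0 _)) /=.
apply: eq_integral => t _ /=.
by rewrite -[RHS]ge0_integral_swap//; exact: measurable_snd_section.
Qed.

Section params.
Variables (sigma eps : R).
Hypotheses (sigma0 : 0 < sigma) (eps0 : 0 < eps).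

Let Om := tube_params sigma 0 eps.

Let mOm : measurable Om. Proof. exact: measurable_tube_params. Qed.

Let tE (t : R) : `|t - 0| < eps <-> t \in `]- eps, eps[%R.
Proof. by rewrite subr0 ltr_norml in_itv. Qed.

Lemma ge0_integral_params (F : mR * (mR * mR) -> \bar R) : measurable_fun setT F ->
  (forall x, 0 <= F x)%E ->
  (\int[lebesgue12]_(x in Om) F x = \int[lam]_(t in `](- eps)%R, eps[)
     \int[lam2]_(u in disc sigma) F (t, u))%E.
Proof.
move=> mF F0; rewrite integral_mkcond ge0_integral12; last 2 first.
- by apply/(measurable_restrictT _ mOm); exact: measurable_funTS.
- by move=> x; exact: erestrict_ge0.
rewrite [RHS]integral_mkcond; apply: eq_integral => t _; rewrite /patch.
case: ifPn => [|/negP] ; rewrite inE/= => tt.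
  rewrite [RHS]integral_mkcond; apply: eq_integral => u _; rewrite /patch.
  by congr (if _ then _ else _); apply/idP/idP; rewrite !inE; [case|split=> //; apply/tE].
apply: integral0_eq => u _; rewrite memNset//; move=> -[/= /tE tt' _]; exact: tt.
Qed.

Lemma ge0_integral_params_swap (F : mR * (mR * mR) -> \bar R) : measurable_fun setT F ->
  (forall x, 0 <= F x)%E ->
  (\int[lebesgue12]_(x in Om) F x = \int[lam2]_(u in disc sigma)
     \int[lam]_(t in `](- eps)%R, eps[) F (t, u))%E.
Proof.
move=> mF F0; rewrite integral_mkcond ge0_integral21; last 2 first.
- by apply/(measurable_restrictT _ mOm); exact: measurable_funTS.
- by move=> x; exact: erestrict_ge0.
rewrite [RHS]integral_mkcond; apply: eq_integral => u _; rewrite /patch.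
case: ifPn => [|/negP] ; rewrite inE/= => uu.
  rewrite [RHS]integral_mkcond; apply: eq_integral => t _; rewrite /patch.
  by congr (if _ then _ else _); apply/idP/idP; rewrite !inE; [by case=> /tE|by move=> /tE].
by apply: integral0_eq => t _; rewrite memNset// => -[].
Qed.

Lemma params_volume : lebesgue12 Om = (lam2 (disc sigma) * lam `](- eps)%R, eps[)%E.
Proof.
have := @ge0_integral_params (cst 1%E) (@measurable_cst _ _ _ _ _ _) (fun=> lee01).
rewrite integral_cst// mul1e => ->.
rewrite (eq_integral (cst (lam2 (disc sigma)))) ?integral_cst// => t _.
by rewrite -[RHS]mul1e -integral_cst//; exact: measurable_disc.
Qed.

(** An inscribed square bounds the disc from below, and a circumscribed one does from above in the
    next lemma; the area itself is never computed. *)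
Lemma params_volume_gt0 : (0 < lebesgue12 Om)%E.
Proof.
rewrite params_volume mule_gt0//; last first.
  rewrite lebesgue_measure_itv/= lte_fin ifT ?lte_fin; [|by move: eps0; lra].
  by move: eps0; lra.
pose I : set mR := `[- (sigma / 2), sigma / 2].
have mI : measurable I by exact: measurable_itv.
apply: (@lt_le_trans _ _ (lam2 (I `*` I))).
  have -> : lam2 (I `*` I) = (lam I * lam I)%E by exact: product_measure1E.
  rewrite mule_gt0// /I lebesgue_measure_itv/= lte_fin;
    rewrite ifT -?EFinD ?lte_fin; move: sigma0; lra.
apply: le_measure; rewrite ?inE; [exact: (measurableX mI mI)|exact: measurable_disc|].
move=> -[u1 u2] [/=]; rewrite /I/= !in_itv/= /disc/= => /andP[? ?] /andP[? ?].
move: sigma0; nra.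
Qed.

Lemma params_volume_lty : (lebesgue12 Om < +oo)%E.
Proof.
rewrite params_volume lte_mul_pinfty//; last first.
  by rewrite lebesgue_measure_itv/=; case: ifP => _; rewrite -?EFinD ?ltry.
pose I : set mR := `[- sigma, sigma].
have mI : measurable I by exact: measurable_itv.
have h : (lam2 (disc sigma) <= lam2 (I `*` I))%E.
  apply: le_measure; rewrite ?inE; [exact: measurable_disc|exact: (measurableX mI mI)|].
  move=> -[u1 u2]; rewrite /disc/= => us.
  have := sqr_ge0 u1; have := sqr_ge0 u2; move: us; rewrite !expr2 => us h1 h2.
  split; rewrite /I/= in_itv/=; apply/andP; split; rewrite leNgt; apply/negP; move: sigma0; nra.
have h2 : (lam2 (I `*` I) < +oo)%E.
  have -> : lam2 (I `*` I) = (lam I * lam I)%E by exact: product_measure1E.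
  rewrite /I lebesgue_measure_itv/=.
  by case: ifP => _; rewrite -?EFinD -?EFinM ?mule0 ?ltry.
by rewrite ge0_fin_numE ?measure_ge0//; exact: le_lt_trans h h2.
Qed.

Lemma integral_params_sqr_t :
  (\int[lebesgue12]_(x in Om) (3 * x.1 ^+ 2)%:E = (eps ^+ 2)%:E * lebesgue12 Om)%E.
Proof.
rewrite ge0_integral_params_swap; last 2 first.
- by apply/measurable_EFinP; measurability.
- by move=> x; rewrite lee_fin mulr_ge0// sqr_ge0.
rewrite params_volume [X in (_ * X)%E]muleC muleA.
rewrite -[eps ^+ 2]addr0 -integral_sqr_oitv ?(ltW eps0)//= -(integral_cst lam2); last exact: measurable_disc.
by apply: eq_integral => u _; apply: eq_integral => t _; rewrite addr0.
Qed.

(** On the chord at height y, of half-length c, the mean of 3 x^2 + y^2 is c^2 + y^2 = sigma^2,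
    whatever y: no polar coordinates are required. *)
Let integral_disc_sqr :
  (\int[lam2]_(u in disc sigma) (3 * u.1 ^+ 2 + u.2 ^+ 2)%:E
    = (sigma ^+ 2)%:E * lam2 (disc sigma))%E.
Proof.
have mdisc := @measurable_disc R sigma.
have mF : measurable_fun setT (fun u : mR * mR => (3 * u.1 ^+ 2 + u.2 ^+ 2)%:E).
  by apply/measurable_EFinP; measurability.
rewrite -integral_cst// [LHS]integral_mkcond [RHS]integral_mkcond.
rewrite fubini_tonelli2; last 2 first.
- by apply/(measurable_restrictT _ mdisc); exact: measurable_funTS.
- by move=> x; apply: erestrict_ge0 => u _; rewrite lee_fin addr_ge0 ?sqr_ge0// mulr_ge0// sqr_ge0.
rewrite fubini_tonelli2; last 2 first.
- by apply/(measurable_restrictT _ mdisc).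
- by move=> x; apply: erestrict_ge0 => u _; rewrite lee_fin ?sqr_ge0.
apply: eq_integral => y _; rewrite /fubini_G.
have [ys|ys] := leP (y ^+ 2) (sigma ^+ 2); last first.
  rewrite !integral0_eq// => x _; rewrite /patch memNset// /disc/= => h;
    have := sqr_ge0 x; move: ys h; lra.
pose c := Num.sqrt (sigma ^+ 2 - y ^+ 2).
have cc : c ^+ 2 = sigma ^+ 2 - y ^+ 2 by rewrite sqr_sqrtr// subr_ge0.
have c0 : 0 <= c by exact: sqrtr_ge0.
have mem x : ((x, y) \in disc sigma) = (x \in `[(- c)%R, c]%classic).
  have xc : (x ^+ 2 <= c ^+ 2) = (- c <= x <= c).
    by rewrite -ler_norml -[RHS](@ler_pXn2r _ 2%N)// ?nnegrE// real_normK ?num_real.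
  by apply/idP/idP; rewrite !inE /disc/= in_itv/= -xc cc; lra.
transitivity (\int[lam]_(x in `[(- c)%R, c]) (3 * x ^+ 2 + y ^+ 2)%:E)%E.
  by rewrite [RHS]integral_mkcond; apply: eq_integral => x _; rewrite /patch mem.
rewrite integral_sqr_itv ?sqr_ge0// cc subrK -integral_cst// [LHS]integral_mkcond.
by apply: eq_integral => x _; rewrite /patch mem.
Qed.

(** Add to 3 u1^2 + u2^2 its mirror image under the exchange of the two coordinates, which preserves
    the disc. *)
Lemma integral_params_sqr_u :
  (\int[lebesgue12]_(x in Om) (4 * (x.2.1 ^+ 2 + x.2.2 ^+ 2))%:E
    = (2 * sigma ^+ 2)%:E * lebesgue12 Om)%E.
Proof.
pose F (x : mR * (mR * mR)) := (3 * x.2.1 ^+ 2 + x.2.2 ^+ 2)%:E.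
have mF : measurable_fun setT F by apply/measurable_EFinP; measurability.
have F0 x : (0 <= F x)%E by rewrite /F lee_fin addr_ge0 ?sqr_ge0// mulr_ge0// sqr_ge0.
have H : (\int[lebesgue12]_(x in Om) F x = (sigma ^+ 2)%:E * lebesgue12 Om)%E.
  rewrite ge0_integral_params// params_volume muleA -integral_disc_sqr.
  by rewrite -(integral_cst lam).
pose G (x : mR * (mR * mR)) := F (x.1, (x.2.2, x.2.1)).
have mG : measurable_fun setT G by apply/measurable_EFinP; measurability.
have S : (\int[lebesgue12]_(x in Om) G x = \int[lebesgue12]_(x in Om) F x)%E.
  rewrite integral_mkcond [RHS]integral_mkcond -[RHS]ge0_integral12_swap; last 2 first.
  - by apply/(measurable_restrictT _ mOm); exact: measurable_funTS.
  - by move=> x; exact: erestrict_ge0.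
  apply: eq_integral => -[t [u1 u2]] _; rewrite /patch/=.
  by congr (if _ then _ else _); apply/idP/idP; rewrite !inE => -[h1 h2]; split=> //;
    move: h2; rewrite /disc/= addrC.
transitivity (\int[lebesgue12]_(x in Om) (F x + G x))%E.
  by apply: eq_integral => x _; rewrite /F /G -EFinD/=; congr (_%:E); ring.
rewrite ge0_integralD//; last 3 first.
- exact: measurable_funTS.
- by move=> x _; exact: F0.
- exact: measurable_funTS.
by rewrite S H -ge0_muleDl ?lee_fin ?sqr_ge0// -EFinD mulr_natl mulr2n.
Qed.
End params.
End moments.

(** * Couplings and test functions *)

Section coupling.
Context {R : realType}.
Notation S3 := (mspace3 R).
Implicit Types mu nu : set S3 -> \bar R.

Lemma W1_le mu nu (P : probability (S3 * S3)%type R) : is_coupling mu nu P ->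
  (W1 mu nu <= \int[P]_z (enorm ((z.1 : space3 R) - z.2))%:E)%E.
Proof. by move=> PC; apply: ereal_inf_lbound; exists P. Qed.

Lemma coupling_integral mu nu (P Q : probability (S3 * S3)%type R) (h : S3 -> \bar R) :
  is_coupling mu nu P -> is_coupling mu nu Q ->
  measurable_fun setT h -> (forall x, 0 <= h x)%E ->
  (\int[P]_z h z.1 = \int[Q]_z h z.1)%E /\ (\int[P]_z h z.2 = \int[Q]_z h z.2)%E.
Proof.
move=> PC QC mh h0; split.
- transitivity (\int[image_measure P measurable_fst]_x h x)%E.
    by rewrite ge0_integral_pushforward.
  transitivity (\int[image_measure Q measurable_fst]_x h x)%E.
    by apply: eq_measure_integral => A mA _; rewrite /= (PC A mA).1 (QC A mA).1.
  by rewrite ge0_integral_pushforward.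
- transitivity (\int[image_measure P measurable_snd]_x h x)%E.
    by rewrite ge0_integral_pushforward.
  transitivity (\int[image_measure Q measurable_snd]_x h x)%E.
    by apply: eq_measure_integral => A mA _; rewrite /= (PC A mA).2 (QC A mA).2.
  by rewrite ge0_integral_pushforward.
Qed.

Lemma measurable_dot d (T : measurableType d) (f g : T -> S3) :
  measurable_fun setT f -> measurable_fun setT g ->
  measurable_fun setT (fun x => dot (f x) (g x) : measurableTypeR R).
Proof.
move=> mf mg; have h (k : T -> S3) : measurable_fun setT k ->
    [/\ measurable_fun setT (fun x => (k x).1.1 : measurableTypeR R),
        measurable_fun setT (fun x => (k x).1.2 : measurableTypeR R) &
        measurable_fun setT (fun x => (k x).2 : measurableTypeR R)].
  by move=> mk; split; measurability.
have [f1 f2 f3] := h _ mf; have [g1 g2 g3] := h _ mg.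
by rewrite /dot; measurability.
Qed.

Lemma measurable_enorm_dist d (T : measurableType d) (f g : T -> S3) :
  measurable_fun setT f -> measurable_fun setT g ->
  measurable_fun setT (fun x => enorm ((f x : space3 R) - g x) : measurableTypeR R).
Proof.
move=> mf mg; apply: measurable_fun_sqrt.
have mfg : measurable_fun setT (fun x => ((f x : space3 R) - g x) : S3).
  have -> : (fun x => (f x : space3 R) - g x) = (fun x =>
      (((f x).1.1 - (g x).1.1, (f x).1.2 - (g x).1.2), (f x).2 - (g x).2)) by [].
  measurability.
exact: measurable_dot.
Qed.

(* The function [z |-> |e.z + a|] is 1-Lipschitz, hence a test function for
   the easy half of Kantorovich duality. *)
Lemma W1_ge mu nu (Q : probability (S3 * S3)%type R) (e : space3 R) (a : R) m :
  is_coupling mu nu Q -> enorm e = 1 ->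
  (\int[Q]_z (`|dot z.1 e + a|)%:E < +oo)%E ->
  (\int[Q]_z (`|dot z.1 e + a|)%:E + m <= \int[Q]_z (`|dot z.2 e + a|)%:E)%E ->
  (m <= W1 mu nu)%E.
Proof.
move=> QC e1 fin le; apply: le_ereal_inf_tmp => _ [P PC <-].
pose h (z : S3) := (`|dot z e + a|)%:E.
have mh : measurable_fun setT h.
  apply/measurable_EFinP; apply: (measurableT_comp (@normr_measurable R setT)).
  by apply: measurable_funD => //; apply: measurable_dot => //; exact: measurable_id.
have h0 x : (0 <= h x)%E by rewrite lee_fin.
have [H1 H2] := coupling_integral PC QC mh h0.
rewrite -H1 -H2 in le; rewrite -H1 in fin.
have mE : measurable_fun setT (fun z : S3 * S3 => (enorm ((z.1 : space3 R) - z.2))%:E).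
  by apply/measurable_EFinP; exact: measurable_enorm_dist.
have : (\int[P]_z h z.2 <= \int[P]_z h z.1 + \int[P]_z (enorm ((z.1 : space3 R) - z.2))%:E)%E.
  rewrite -ge0_integralD//; last 2 first.
  - exact: measurableT_comp mh measurable_fst.
  - by move=> z _; rewrite lee_fin enorm_ge0.
  apply: ge0_le_integral => //.
  - exact: measurableT_comp mh measurable_snd.
  - by apply: emeasurable_funD => //; exact: measurableT_comp mh measurable_fst.
  - move=> z _; rewrite /h -EFinD lee_fin.
    have -> : dot z.2 e + a = dot z.1 e + a + dot ((z.2 : space3 R) - z.1) e.
      by rewrite dotDl dotNl; ring.
    rewrite (le_trans (ler_normD _ _))// lerD2l.
    by rewrite (le_trans (dot_le_enorm _ _))// e1 mulr1 enorm_distC.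
move=> /(le_trans le); rewrite leeD2lE//.
by rewrite ge0_fin_numE//; apply: integral_ge0 => z _.
Qed.

Section joint_law.
Context d (T : measurableType d) (rho : probability T R).
Variables X Y : T -> S3.
Hypotheses (mX : measurable_fun setT X) (mY : measurable_fun setT Y).

Definition joint_map x : S3 * S3 := (X x, Y x).

Let mjoint : measurable_fun setT joint_map.
Proof. exact: measurable_fun_pair. Qed.

HB.instance Definition _ := isMeasurableFun.Build _ _ _ _ joint_map mjoint.

Definition joint_law : probability (S3 * S3)%type R := distribution rho joint_map.

Lemma joint_law_coupling mu nu :
  (forall A, measurable A -> mu A = rho (X @^-1` A)) ->
  (forall A, measurable A -> nu A = rho (Y @^-1` A)) -> is_coupling mu nu joint_law.
Proof. by move=> muX nuY A mA; rewrite muX// nuY. Qed.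

Lemma integral_joint_law (h : S3 * S3 -> \bar R) : measurable_fun setT h ->
  (forall z, 0 <= h z)%E -> (\int[joint_law]_z h z = \int[rho]_x h (X x, Y x))%E.
Proof. by move=> mh h0; rewrite ge0_integral_distribution. Qed.
End joint_law.
End coupling.

Section params_mean.
Context {R : realType}.
Notation mR := (measurableTypeR R).
Variables (sigma eps : R).
Notation Om := (tube_params sigma 0 eps).
Hypotheses (sigma0 : 0 < sigma) (eps0 : 0 < eps).
Implicit Types f g : mR * (mR * mR) -> mR.

Definition params_law : probability (mR * (mR * mR))%type R :=
  uniform_on lebesgue12 (measurable_tube_params sigma 0 eps) (dirac point).

Let V0 : lebesgue12 Om != 0%E.
Proof. by rewrite gt_eqF// params_volume_gt0. Qed.

Let Voo : lebesgue12 Om != +oo%E.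
Proof. by rewrite lt_eqF// params_volume_lty. Qed.

Let mOm := measurable_tube_params sigma 0 eps.

Definition mean f : \bar R := (\int[params_law]_x (f x)%:E)%E.

Lemma params_lawE A :
  params_law A = (lebesgue12 (A `&` Om) / lebesgue12 Om)%E.
Proof. by rewrite /params_law uniform_onE. Qed.

Lemma mean_ge0 f : (forall x, 0 <= f x) -> (0 <= mean f)%E.
Proof. by move=> f0; apply: integral_ge0 => x _; rewrite lee_fin. Qed.

Lemma meanD f g : measurable_fun setT f -> measurable_fun setT g ->
  (forall x, 0 <= f x) -> (forall x, 0 <= g x) ->
  mean (fun x => f x + g x) = (mean f + mean g)%E.
Proof.
move=> mf mg f0 g0; rewrite /mean -ge0_integralD//.
- by move=> x _; rewrite lee_fin.
- exact/measurable_EFinP.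
- by move=> x _; rewrite lee_fin.
- exact/measurable_EFinP.
Qed.

Lemma meanZ a f : 0 <= a -> measurable_fun setT f -> (forall x, 0 <= f x) ->
  mean (fun x => a * f x) = (a%:E * mean f)%E.
Proof.
move=> a0 mf f0; rewrite /mean -ge0_integralZl_EFin//.
- by move=> x _; rewrite lee_fin.
- exact/measurable_EFinP.
Qed.

Lemma mean_cst (a : R) : mean (cst a) = a%:E.
Proof.
transitivity (\int[params_law]_x (cst a%:E) x)%E; first by [].
have P1 : params_law setT = 1%E by exact: probability_setT.
transitivity (a%:E * params_law setT)%E; first exact: integral_cst.
by rewrite P1 mule1.
Qed.

Lemma le_mean f g : measurable_fun setT f -> measurable_fun setT g ->
  (forall x, 0 <= f x) -> (forall x, 0 <= g x) ->
  (forall x, Om x -> f x <= g x) -> (mean f <= mean g)%E.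
Proof.
move=> mf mg f0 g0 fg; apply: le_integral_uniform_on => //.
- exact/measurable_EFinP.
- exact/measurable_EFinP.
Qed.

Let meanE f : measurable_fun setT f -> (forall x, 0 <= f x) ->
  mean f = ((fine (lebesgue12 Om))^-1%:E *
    \int[lebesgue12]_x (((fun x => (f x)%:E) \_ Om) x))%E.
Proof.
move=> mf f0; rewrite /mean integral_uniform_on//; last exact/measurable_EFinP.
by rewrite integral_mkcond.
Qed.

Let mpatch f : measurable_fun setT f ->
  measurable_fun setT ((fun x => (f x)%:E) \_ Om).
Proof.
move=> mf; apply/(measurable_restrictT _ mOm); apply: measurable_funTS.
exact/measurable_EFinP.
Qed.

Let ge0patch f x : (forall x, 0 <= f x) ->
  (0 <= ((fun x => (f x)%:E) \_ Om) x)%E.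
Proof. by move=> f0; apply: erestrict_ge0 => y _; rewrite lee_fin. Qed.

Lemma mean_opp_t f : measurable_fun setT f -> (forall x, 0 <= f x) ->
  mean (fun x => f (- x.1, x.2)) = mean f.
Proof.
move=> mf f0; rewrite !meanE//; last first.
  by apply: (measurableT_comp mf); measurability.
congr (_ * _)%E; rewrite -[RHS](@ge0_integral12_affine _ (-1) 0)//.
- apply: eq_integral => -[t u] _; rewrite /patch/=.
  rewrite (_ : -1 * t + 0 = - t); last by ring.
  by congr (if _ then _ else _); apply/idP/idP; rewrite !inE => -[h1 h2]; split=> //;
    move: h1; rewrite /= !subr0 normrN.
- by rewrite normrN normr1.
- exact: mpatch.
- by move=> x; exact: ge0patch.
Qed.

Lemma mean_opp_u f : measurable_fun setT f -> (forall x, 0 <= f x) ->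
  mean (fun x => f (x.1, (- x.2.1, - x.2.2))) = mean f.
Proof.
move=> mf f0; rewrite !meanE//; last first.
  by apply: (measurableT_comp mf); measurability.
congr (_ * _)%E; rewrite -[RHS]ge0_integral12_opp//.
- apply: eq_integral => -[t u] _; rewrite /patch/=.
  by congr (if _ then _ else _); apply/idP/idP; rewrite !inE => -[h1 h2]; split=> //;
    move: h2; rewrite /disc/= !sqrrN.
- exact: mpatch.
- by move=> x; exact: ge0patch.
Qed.

Let mean_volume (a : R) f : measurable_fun setT f -> (forall x, 0 <= f x) ->
  (\int[lebesgue12]_(x in Om) (f x)%:E
    = a%:E * lebesgue12 Om)%E -> mean f = a%:E.
Proof.
move=> mf f0 fa; rewrite /mean integral_uniform_on//; last exact/measurable_EFinP.
have Vfin : lebesgue12 Om \is a fin_num.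
  by rewrite ge0_fin_numE// params_volume_lty.
have Vn : fine (lebesgue12 Om) != 0 by rewrite fine_eq0.
rewrite fa muleCA -[X in (_ * (_ * X))%E](fineK Vfin).
by rewrite -[X in (_ * X)%E]EFinM mulVf// mule1.
Qed.

Lemma mean_sqr_t : mean (fun x => 3 * x.1 ^+ 2) = (eps ^+ 2)%:E.
Proof.
apply: mean_volume; [by measurability | | exact: integral_params_sqr_t].
by move=> x; rewrite mulr_ge0// sqr_ge0.
Qed.

Lemma mean_sqr_u : mean (fun x => 4 * (x.2.1 ^+ 2 + x.2.2 ^+ 2)) = (2 * sigma ^+ 2)%:E.
Proof.
apply: mean_volume; [by measurability | | exact: integral_params_sqr_u].
by move=> x; rewrite mulr_ge0// addr_ge0 ?sqr_ge0.
Qed.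
End params_mean.

(** * Cost estimate in parameter space *)

Section arcs.
Context {R : realType}.
Notation mR := (measurableTypeR R).
Notation S3 := (mspace3 R).
Variables (c : nat -> R -> space3 R) (r K : R).
Hypothesis ra : regular_arc c r K.
Variables (v1 v2 : space3 R).
Hypothesis fr0 : frame (c 1%N 0) v1 v2.
Variables (d sigma eps : R).
Hypotheses (K1 : 1 <= K) (d0 : 0 < d) (d1 : d <= 1) (dr : 2 * d < r)
  (Kd : K * d <= 1 / 64) (sigma0 : 0 < sigma) (sigmad : sigma <= d / 4)
  (eps0 : 0 < eps) (epsd : eps <= d / 4).

Let K0 : 0 <= K. Proof. exact: ra_K ra. Qed.

Lemma measurable_transport (T0 : space3 R) (T : R -> space3 R) v :
  measurable_curve T -> measurable_curve (fun t => transport T0 (T t) v).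
Proof.
move=> [T1 T2 T3].
have md w : measurable_fun setT (fun t => dot w (T t) : mR).
  by apply: measurable_funD; [apply: measurable_funD|]; apply: measurable_funM.
have mt : measurable_fun setT (fun t => tilt T0 (T t) v : mR).
  have m1 : measurable_fun setT (fun t => 1 + dot T0 (T t) : mR) by exact: (measurable_funD (measurable_cst _) (md T0)).
  exact: (measurable_funM (md v) (measurable_funV m1)).
by split; rewrite /transport /=; apply: measurable_funB => //;
  apply: measurable_funM => //; apply: measurable_funD.
Qed.

Let X (x : mR * (mR * mR)) : S3 := arc_map c v1 v2 sigma x.1 x.2.
Let Y (x : mR * (mR * mR)) : S3 := arc_map c v1 v2 sigma (d - x.1) x.2.

Lemma measurable_arc_map : measurable_fun setT X.
Proof.
apply: measurable_tube_map; try exact: (ra_meas ra);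
  by apply: measurable_transport; exact: (ra_meas ra).
Qed.

Let mX := measurable_arc_map.

Lemma measurable_arc_map_refl : measurable_fun setT Y.
Proof.
pose refl (x : mR * (mR * mR)) : mR * (mR * mR) := (d - x.1, x.2).
have mrefl : measurable_fun setT refl by rewrite /refl; measurability.
exact: measurableT_comp mX mrefl.
Qed.

Let mY := measurable_arc_map_refl.

Let e := chord_dir c d.
Let curv := dot (c 2%N 0) (c 2%N 0).

(** The absolute value makes this nonnegative off the parameter domain as well; on the domain it
    equals [height]. *)
Let Hr (x : mR * (mR * mR)) : mR := `|dot (Y x) e - dot (X x) e|.

Let HrE x : Hr x = `|height c v1 v2 d sigma x.1 x.2|.
Proof. by rewrite /Hr /height /displacement dotDl dotNl. Qed.

Let mdot (f : mR * (mR * mR) -> S3) : measurable_fun setT f ->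
  measurable_fun setT (fun x => dot (f x) e : mR).
Proof. by move=> mf; apply: measurable_dot => //; exact: measurable_cst. Qed.

Let mabs (f : mR * (mR * mR) -> mR) : measurable_fun setT f ->
  measurable_fun setT (fun x => `|f x| : mR).
Proof. by move=> mf; exact: (measurableT_comp (@normr_measurable R setT)). Qed.

Let mHr : measurable_fun setT Hr.
Proof. by apply: mabs; apply: measurable_funB; apply: mdot. Qed.

Let Hr0 x : 0 <= Hr x. Proof. exact: normr_ge0. Qed.

Let in_params x : tube_params sigma 0 eps x -> `|x.1| <= d / 4 /\ disc sigma x.2.
Proof. by case: x => t u [/=]; rewrite subr0 => /ltW te us; split=> //; exact: le_trans te _. Qed.

Let in_range (t : R) : `|t| <= d / 4 -> `|t| <= 2 * d /\ `|d - t| <= 2 * d.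
Proof. by move: d0; rewrite !ler_norml => ? /andP[? ?]; split; apply/andP; split; lra. Qed.

Let XY_bound x : tube_params sigma 0 eps x ->
  `|dot (X x) e| <= 4 * K /\ `|dot (Y x) e| <= 4 * K.
Proof.
move=> /in_params[/in_range[t1 t2] us].
have b := arc_map_bound ra fr0 K1 d0 d1 dr Kd sigma0 sigmad _ us.
have e1 : enorm e = 1 := chord_dir_norm ra d0 dr Kd.
by split; rewrite (le_trans (dot_le_enorm _ _))// e1 mulr1; exact: b.
Qed.

(** The parameter law is invariant under t -> -t and u -> -u, so m is a quarter of the mean of the
    four-term sum of [height_sym], and its error 100 becomes 25. *)
Lemma mean_height : exists2 m : R, mean sigma eps Hr = m%:E &
  `|m - (enorm (chord c d) + d * curv * (sigma ^+ 2 / 4 - eps ^+ 2 / 6))|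
    <= 25 * K ^+ 3 * d ^+ 4.
Proof.
have mfin : (mean sigma eps Hr < +oo)%E.
  apply: (@le_lt_trans _ _ (mean sigma eps (cst (8 * K)))); last by rewrite mean_cst ltry.
  apply: le_mean => //; first by move=> x; rewrite /= mulr_ge0.
  move=> x /XY_bound[b1 b2]; rewrite /Hr/= (le_trans (ler_normB _ _))//.
  by move: b1 b2; lra.
have mE : mean sigma eps Hr = (fine (mean sigma eps Hr))%:E.
  by rewrite fineK// ge0_fin_numE// mean_ge0.
exists (fine (mean sigma eps Hr)) => //.
move: mE; set m := fine _ => mE.
have curv0 : 0 <= curv by rewrite /curv -sqr_enorm sqr_ge0.
have dc : 0 <= d * curv by rewrite mulr_ge0// ltW.
pose H1 (x : mR * (mR * mR)) : mR := Hr (- x.1, x.2).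
pose H2 (x : mR * (mR * mR)) : mR := Hr (x.1, (- x.2.1, - x.2.2)).
pose H3 (x : mR * (mR * mR)) : mR := H2 (- x.1, x.2).
have mH1 : measurable_fun setT H1 by apply: (measurableT_comp mHr); measurability.
have mH2 : measurable_fun setT H2 by apply: (measurableT_comp mHr); measurability.
have mH3 : measurable_fun setT H3 by apply: (measurableT_comp mH2); measurability.
pose Q1 (x : mR * (mR * mR)) : mR := 3 * x.1 ^+ 2.
pose Q2 (x : mR * (mR * mR)) : mR := 4 * (x.2.1 ^+ 2 + x.2.2 ^+ 2).
have mQ1 : measurable_fun setT Q1 by rewrite /Q1; measurability.
have mQ2 : measurable_fun setT Q2 by rewrite /Q2; measurability.
have Q10 x : 0 <= Q1 x by rewrite /Q1 mulr_ge0// sqr_ge0.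
have Q20 x : 0 <= Q2 x by rewrite /Q2 mulr_ge0// addr_ge0// sqr_ge0.
(* Chosen so that q1 and q2 are 2 d curv t^2 and 2 d curv |u|^2, expressed through the multiples 3
   t^2 and 4 |u|^2 whose means are available. *)
pose a1 := 2 / 3 * (d * curv); pose a2 := 1 / 2 * (d * curv).
have a10 : 0 <= a1 by rewrite mulr_ge0// divr_ge0.
have a20 : 0 <= a2 by rewrite mulr_ge0// divr_ge0.
pose q1 x : mR := a1 * Q1 x; pose q2 x : mR := a2 * Q2 x.
have mq1 : measurable_fun setT q1 by apply: measurable_funM.
have mq2 : measurable_fun setT q2 by apply: measurable_funM.
have q10 x : 0 <= q1 x by rewrite mulr_ge0.
have q20 x : 0 <= q2 x by rewrite mulr_ge0.
(* [mean] is handled on nonnegative functions, so the quadratic terms that lower the height are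
   added here instead of being subtracted from the constant b. *)
pose G x : mR := (Hr x + H1 x) + (H2 x + H3 x) + (q1 x + q2 x).
have mG1 : measurable_fun setT (fun x => Hr x + H1 x : mR) by apply: measurable_funD.
have mG2 : measurable_fun setT (fun x => H2 x + H3 x : mR) by apply: measurable_funD.
have mG3 : measurable_fun setT (fun x => q1 x + q2 x : mR) by apply: measurable_funD.
have mG4 : measurable_fun setT (fun x => Hr x + H1 x + (H2 x + H3 x) : mR).
  by apply: measurable_funD.
have mG : measurable_fun setT G by apply: measurable_funD.
have H10 x : 0 <= H1 x by exact: Hr0.
have H20 x : 0 <= H2 x by exact: Hr0.
have H30 x : 0 <= H3 x by exact: Hr0.
have G10 x : 0 <= Hr x + H1 x by rewrite addr_ge0.
have G20 x : 0 <= H2 x + H3 x by rewrite addr_ge0.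
have G30 x : 0 <= q1 x + q2 x by rewrite addr_ge0.
have G40 x : 0 <= Hr x + H1 x + (H2 x + H3 x) by rewrite addr_ge0.
have G0 x : 0 <= G x by rewrite /G addr_ge0.
have GE : mean sigma eps G = (4 * m + a1 * eps ^+ 2 + a2 * (2 * sigma ^+ 2))%:E.
  have E1 : mean sigma eps H1 = m%:E by rewrite -mE -(mean_opp_t sigma0 eps0 mHr).
  have E2 : mean sigma eps H2 = m%:E by rewrite -mE -(mean_opp_u sigma0 eps0 mHr).
  have E3 : mean sigma eps H3 = m%:E by rewrite -E2 -(mean_opp_t sigma0 eps0 mH2).
  have E4 : mean sigma eps q1 = (a1 * eps ^+ 2)%:E.
    by rewrite /q1 meanZ// mean_sqr_t.
  have E5 : mean sigma eps q2 = (a2 * (2 * sigma ^+ 2))%:E.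
    by rewrite /q2 meanZ// mean_sqr_u.
  rewrite /G !(meanD _ _ mG4 mG3, meanD _ _ mG1 mG2, meanD _ _ mHr mH1,
    meanD _ _ mH2 mH3, meanD _ _ mq1 mq2)// mE E1 E2 E3 E4 E5 -!EFinD.
  by congr (_%:E); ring.
pose z := 100 * K ^+ 3 * d ^+ 4.
have z0 : 0 <= z by rewrite !mulr_ge0 ?exprn_ge0// ltW.
pose b := 4 * enorm (chord c d) + 2 * (d * curv) * sigma ^+ 2.
have b0 : 0 <= b.
  rewrite addr_ge0//; first by rewrite mulr_ge0// enorm_ge0.
  by rewrite mulr_ge0 ?sqr_ge0// mulr_ge0.
have GO x : tube_params sigma 0 eps x -> `|G x - b| <= z.
  move=> xO; have [t4 us] := in_params xO.
  have t4' : `|- x.1| <= d / 4 by rewrite normrN.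
  have us' : disc sigma (- x.2) by move: us; rewrite /disc/= !sqrrN.
  have S := height_sym ra fr0 K1 d0 dr Kd sigma0 sigmad t4 us.
  have D := displacement_dir ra fr0 K1 d0 d1 dr Kd sigma0 sigmad.
  have h1 : Hr x = height c v1 v2 d sigma x.1 x.2.
    by rewrite HrE ger0_norm//; case: (D _ _ t4 us).
  have h2 : H1 x = height c v1 v2 d sigma (- x.1) x.2.
    by rewrite /H1 HrE ger0_norm//; case: (D _ _ t4' us).
  have h3 : H2 x = height c v1 v2 d sigma x.1 (- x.2).
    by rewrite /H2 HrE ger0_norm//; case: (D _ _ t4 us').
  have h4 : H3 x = height c v1 v2 d sigma (- x.1) (- x.2).
    by rewrite /H3 /H2 HrE ger0_norm//; case: (D _ _ t4' us').
  rewrite /G h1 h2 h3 h4; apply: le_trans S; rewrite le_eqVlt; apply/orP; left; apply/eqP.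
  by congr `|_|; rewrite /b /q1 /q2 /Q1 /Q2 /a1 /a2 /curv; field.
have le1 : (mean sigma eps G <= mean sigma eps (cst (b + z)%R))%E.
  apply: le_mean => //; first by move=> x; rewrite /= addr_ge0.
  by move=> x /GO; rewrite /= ler_norml => /andP[_]; rewrite lerBlDl.
have le2 : (mean sigma eps (cst b) <= mean sigma eps (fun x => (G x + z)%R))%E.
  apply: le_mean => //; first exact: measurable_funD.
    by move=> x; rewrite addr_ge0.
  by move=> x /GO; rewrite /= ler_norml => /andP[+ _]; lra.
rewrite mean_cst GE lee_fin in le1.
rewrite (meanD _ _ mG (measurable_cst (z : mR)))// (mean_cst _ _ z) mean_cst GE -EFinD lee_fin in le2.
move: le1 le2; rewrite /a1 /a2 /b /z -(mulrA 100) -(mulrA 25) ler_norml.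
move: (K ^+ 3 * d ^+ 4) (enorm _) (d * curv) => k L q le1 le2.
apply/andP; split; lra.
Qed.

(** The reflection coupling bounds the cost by m plus the excess in [displacement_dir]; a test
    function bounds it below by m. Replacing d by the chord length in the correction term costs
    another K^3 d^4, whence 26 = 25 + 1. *)
Lemma W1_arcs (mu nu : set S3 -> \bar R) :
  (forall A, measurable A -> mu A = params_law sigma eps (X @^-1` A)) ->
  (forall A, measurable A -> nu A = params_law sigma eps (Y @^-1` A)) ->
  (`| W1 mu nu - (enorm (chord c d) * (1 + curv * (sigma ^+ 2 / 4 - eps ^+ 2 / 6)))%:E |
    <= ((26 * K ^+ 3 + 4 * (50 * K ^+ 2) ^+ 2) * d ^+ 4)%:E)%E.
Proof.
move=> muX nuY; have [m mE mL] := mean_height.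
have QC := joint_law_coupling mX mY muX nuY.
have e1 : enorm e = 1 := chord_dir_norm ra d0 dr Kd.
pose z := 4 * (50 * K ^+ 2) ^+ 2 * d ^+ 4.
have z0 : 0 <= z by rewrite !mulr_ge0 ?sqr_ge0 ?exprn_ge0// ltW.
have up : (W1 mu nu <= (m + z)%:E)%E.
  apply: le_trans (W1_le QC) _; rewrite integral_joint_law; last 2 first.
  - by apply/measurable_EFinP; exact: measurable_enorm_dist.
  - by move=> x; rewrite lee_fin enorm_ge0.
  rewrite EFinD -mE -(mean_cst sigma eps z) -meanD//.
  apply: (@le_mean _ _ _ sigma0 eps0 (fun x => enorm ((X x : space3 R) - Y x))
    (fun x => Hr x + z)).
  - exact: measurable_enorm_dist.
  - exact: measurable_funD.
  - by move=> x; exact: enorm_ge0.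
  - by move=> x; rewrite addr_ge0.
  move=> x /in_params[t4 us].
  have [h0 h1] := displacement_dir ra fr0 K1 d0 d1 dr Kd sigma0 sigmad t4 us.
  rewrite enorm_distC (le_trans h1)// lerD2r HrE; exact: ler_norm.
have lo : (m%:E <= W1 mu nu)%E.
  have mXe : measurable_fun setT (fun x => `|dot (X x) e + 4 * K| : mR).
    by apply: mabs; apply: measurable_funD => //; exact: mdot.
  have mYe : measurable_fun setT (fun x => `|dot (Y x) e + 4 * K| : mR).
    by apply: mabs; apply: measurable_funD => //; exact: mdot.
  have mS : measurable_fun setT (fun z : S3 * S3 => (`|dot z.1 e + 4 * K|)%:E).
    apply/measurable_EFinP; apply: (measurableT_comp (@normr_measurable R setT)).
    by apply: measurable_funD => //; apply: measurable_dot => //; exact: measurable_cst.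
  have mS' : measurable_fun setT (fun z : S3 * S3 => (`|dot z.2 e + 4 * K|)%:E).
    apply/measurable_EFinP; apply: (measurableT_comp (@normr_measurable R setT)).
    by apply: measurable_funD => //; apply: measurable_dot => //; exact: measurable_cst.
  (* By [arc_map_bound] the points have norm at most 4 K, so this offset makes the test function
     affine on the supports. *)
  apply: (@W1_ge _ _ _ _ e (4 * K) _ QC e1); rewrite !integral_joint_law//.
  - apply: (@le_lt_trans _ _ (mean sigma eps (cst (8 * K)))); last by rewrite mean_cst ltry.
    apply: le_mean => //; first by move=> x; rewrite /= mulr_ge0.
    move=> x /XY_bound[]; rewrite /= !ler_norml => /andP[? ?] _; move: K0 => ?.
    by apply/andP; split; lra.
  - rewrite -mE -[X in (X + _ <= _)%E]/(mean sigma eps (fun x => `|dot (X x) e + 4 * K|)).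
    rewrite -meanD//.
    apply: (@le_mean _ _ _ sigma0 eps0 (fun x => `|dot (X x) e + 4 * K| + Hr x)
       (fun x => `|dot (Y x) e + 4 * K|)) => //.
    + exact: measurable_funD.
    + by move=> x; rewrite addr_ge0.
    move=> x xO; have [t4 us] := in_params xO.
    have [h0 _] := displacement_dir ra fr0 K1 d0 d1 dr Kd sigma0 sigmad t4 us.
    have [] := XY_bound xO; rewrite !ler_norml => /andP[? _] /andP[? _].
    have -> : Hr x = dot (Y x) e - dot (X x) e.
      by rewrite HrE ger0_norm// /height /displacement dotDl dotNl.
    rewrite !ger0_norm; lra.
have Wfin : W1 mu nu \is a fin_num.
  by rewrite fin_numE -ltNye -ltey (lt_le_trans _ lo) ?ltNyr ?(le_lt_trans up) ?ltry.
have [W WE] : exists W, W1 mu nu = W%:E by exists (fine (W1 mu nu)); rewrite fineK.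
rewrite {}WE in up lo *; rewrite -EFinB abse_EFin !lee_fin in up lo *.
have curvK : 0 <= curv <= K ^+ 2.
  by rewrite /curv -sqr_enorm sqr_ge0 ler_pXn2r ?nnegrE ?enorm_ge0//;
    apply: (ra_bnd ra) => //; rewrite normr0 (ra_r ra).
have Ld := chord_norm_dist ra d0 dr.
have ss : `|sigma ^+ 2 / 4 - eps ^+ 2 / 6| <= d ^+ 2.
  have s1 : sigma ^+ 2 <= (d / 4) ^+ 2 by rewrite ler_pXn2r// nnegrE ltW// divr_gt0.
  have s2 : eps ^+ 2 <= (d / 4) ^+ 2 by rewrite ler_pXn2r// nnegrE ltW// divr_gt0.
  rewrite (_ : (d / 4) ^+ 2 = d ^+ 2 / 16) in s1 s2; [|by field..].
  have := sqr_ge0 sigma; have := sqr_ge0 eps.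
  move: s1 s2; move: (sigma ^+ 2) (eps ^+ 2) (d ^+ 2) => a b q ? ? ? ?.
  by rewrite ler_norml; apply/andP; split; lra.
have err : `|(enorm (chord c d) - d) * (curv * (sigma ^+ 2 / 4 - eps ^+ 2 / 6))|
    <= K ^+ 3 * d ^+ 4.
  rewrite !normrM (_ : K ^+ 3 * d ^+ 4 = K * d ^+ 2 * (K ^+ 2 * d ^+ 2)); last by ring.
  by apply: ler_pM => //; apply: ler_pM => //; rewrite ger0_norm; case/andP: curvK.
move: mL err up lo; rewrite -/z -(mulrA 25).
rewrite (_ : (26 * _ + _) * _ = 26 * (K ^+ 3 * d ^+ 4) + z); last by rewrite /z; ring.
move: (K ^+ 3 * d ^+ 4) (sigma ^+ 2 / 4 - _) => k s.
set L := enorm _ => mL err up lo.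
have -> : W - L * (1 + curv * s) = (W - m) + (m - (L + d * curv * s)) - (L - d) * (curv * s).
  by ring.
move: mL err; move: (_ - (L + _)) (_ * (curv * s)) => p q.
rewrite !ler_norml => /andP[? ?] /andP[? ?]; apply/andP; split; lra.
Qed.
End arcs.

(** * The tube measures as images of the parameter law *)

Section tube_law.
Context {R : realType}.
Notation mR := (measurableTypeR R).

(** The absolute coordinates of a unit vector sum to at least 1, so one of them is at least 1/3, and
    1/3 - 1/32 >= 1/4. *)
Lemma exists_coord (T0 : space3 R) : dot T0 T0 = 1 -> exists P sg,
  [/\ coord_swap P, sg = 1 \/ sg = -1 &
      forall T, enorm (T - T0) <= 1 / 32 -> 1 / 4 <= sg * (P T).1.1].
Proof.
move=> T1; have := ler_enorm_coord T0; rewrite /enorm T1 sqrtr1 => T0le.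
have sgn (x : R) : 1 / 3 <= `|x| -> exists2 sg : R, sg = 1 \/ sg = -1 &
    forall y, `|y - x| <= 1 / 32 -> 1 / 4 <= sg * y.
  have [x0|x0] := leP 0 x => xle.
    exists 1; first by left.
    by move=> y; rewrite ler_norml mul1r => /andP[? _]; move: xle; rewrite ger0_norm//; lra.
  exists (-1); first by right.
  by move=> y; rewrite ler_norml mulN1r => /andP[_ ?]; move: xle; rewrite ltr0_norm//; lra.
have [/sgn[sg s1 h]|x1] := leP (1 / 3) `|T0.1.1|.
  exists id, sg; split=> // [|T TT]; first by left.
  by apply: h; exact: le_trans (ler_coord1 _) TT.
have [/sgn[sg s1 h]|x2] := leP (1 / 3) `|T0.1.2|.
  exists (@swap12 R), sg; split=> // [|T TT]; first by right; left.
  by apply: h; exact: le_trans (ler_coord2 _) TT.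
have [/sgn[sg s1 h]|x3] := leP (1 / 3) `|T0.2|.
  exists (@swap13 R), sg; split=> // [|T TT]; first by right; right.
  by apply: h; exact: le_trans (ler_coord3 _) TT.
by move: T0le x1 x2 x3; lra.
Qed.

Lemma regular_arcW (c : nat -> R -> space3 R) (r K K' : R) : K <= K' ->
  regular_arc c r K -> regular_arc c r K'.
Proof.
move=> KK [ra1 ra2 ra3 ra4 ra5 ra6]; split=> //; first exact: le_trans KK.
by move=> n t n4 tr; exact: le_trans (ra5 n t n4 tr) KK.
Qed.

Variables (c : nat -> R -> space3 R) (r K : R).
Hypothesis ra : regular_arc c r K.
Variables (v1 v2 : space3 R).
Hypothesis fr0 : frame (c 1%N 0) v1 v2.
Variables (d sigma eps : R).
Hypotheses (K1 : 1 <= K) (d0 : 0 < d) (dr : 2 * d < r)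
  (Kd : K ^+ 2 * d <= 1 / 64) (sigma0 : 0 < sigma) (sigmad : sigma <= d / 4)
  (eps0 : 0 < eps) (epsd : eps <= d / 4).

Let K0 : 0 <= K. Proof. exact: ra_K ra. Qed.

Let Kd1 : K * d <= 1 / 64.
Proof. by apply: le_trans Kd; rewrite ler_wpM2r ?(ltW d0)// expr2 ler_peMl. Qed.

Let slab s : set (mspace3 R) := slab_tube (c 0%N) (c 1%N) s eps sigma.

Let near_s s t : s = 0 \/ s = d -> `|t - s| <= eps -> `|t| <= 2 * d.
Proof.
move=> sE; rewrite !ler_norml => /andP[h1 h2]; have := epsd; have := d0.
by case: sE h1 h2 => -> h1 h2 h3 h4; apply/andP; split; lra.
Qed.

Let measurable_slab s : s = 0 \/ s = d -> measurable (slab s).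
Proof.
move=> sE; apply: (measurable_slab_tube ra) => //.
  by case: sE => ->; rewrite ?normr0 ?gtr0_norm//; have := epsd; have := d0; have := dr; lra.
have h1 : K * sigma <= K * d / 4 by rewrite -mulrA ler_wpM2l.
have h2 : K ^+ 2 * eps <= K ^+ 2 * d / 4 by rewrite -mulrA ler_wpM2l ?sqr_ge0.
rewrite (_ : K * _ = 2 * (K * sigma) + 2 * (K ^+ 2 * eps)); last by ring.
by move: Kd Kd1 h1 h2; lra.
Qed.

Let slab_volume s (A : set (mspace3 R)) : s = 0 \/ s = d -> measurable A ->
  lebesgue3 (A `&` slab s) = lebesgue12 (tube_params sigma s eps `&`
    (fun tu => arc_map c v1 v2 sigma tu.1 tu.2) @^-1` A).
Proof.
move=> sE mA; have zr : `|0 : R| < r by rewrite normr0 (ra_r ra).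
have in_r t : `|t - s| <= eps -> `|t| < r.
  by move=> /(near_s sE) td; exact: le_lt_trans dr.
have [P [sg [swP sgE Ple]]] := exists_coord (ra_unit ra zr).
have Ks : K * sigma <= K * d / 4 by rewrite -mulrA ler_wpM2l.
have Ke : K * eps <= K * d / 4 by rewrite -mulrA ler_wpM2l.
(* The slope c = 1/4 comes from [exists_coord]; the product is at most 30 K d / 4, below 1 since K d
   <= 1/64. *)
have small : K * (sigma + 2 * eps) * (2 / (1 / 4) + 2) < 1.
  have -> : 2 / (1 / 4) + 2 = 10 :> R by field.
  rewrite (_ : K * _ * _ = 10 * (K * sigma) + 20 * (K * eps)); last by ring.
  by move: Kd1 Ks Ke; lra.
have Tle t : `|t - s| <= eps -> 1 / 4 <= sg * (P (c 1%N t)).1.1.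
  move=> ts; apply: Ple; have td := near_s sE ts.
  rewrite (le_trans (taylor1 ra (n := 1%N) isT zr (in_r _ ts)))// subr0.
  by rewrite (le_trans (ler_wpM2l K0 td))//; move: Kd1; lra.
have mfr v : measurable_curve (fun t => transport (c 1%N 0) (c 1%N t) v).
  by apply: measurable_transport; exact: (ra_meas ra).
have dc n t : `|t - s| <= eps -> is_derive3 (c n) (c n.+1) t.
  by move=> /in_r tr; exact: (ra_d ra n tr).
have ck t : `|t - s| <= eps -> [/\ {for t, continuous (fun t => (c 2%N t).1.1)},
    {for t, continuous (fun t => (c 2%N t).1.2)} & {for t, continuous (fun t => (c 2%N t).2)}].
  by move=> /(dc 2%N); exact: is_derive3_continuous.
have frs t : `|t - s| <= eps -> frame (c 1%N t) (transport (c 1%N 0) (c 1%N t) v1)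
    (transport (c 1%N 0) (c 1%N t) v2).
  by move=> /(near_s sE); exact: (arc_frame ra fr0 dr Kd1).
have kK t : `|t - s| <= eps -> enorm (c 2%N t) <= K.
  by move=> /in_r tr; exact: (ra_bnd ra).
have td := TubeData (ra_meas ra 0%N) (ra_meas ra 1%N) (ra_meas ra 2%N) (mfr v1) (mfr v2)
  eps0 sigma0 K0 (dc 0%N) (dc 1%N) ck frs kK.
have c0 : 0 < 1 / 4 :> R by rewrite divr_gt0.
exact: (tube_volume td swP sgE c0 Tle small mA (measurable_slab sE)).
Qed.

Let slab_volumeT s : s = 0 \/ s = d ->
  lebesgue3 (slab s) = lebesgue12 (tube_params sigma s eps).
Proof.
move=> sE; rewrite -(setTI (slab s)) (slab_volume sE measurableT).
by rewrite preimage_setT (setIT (tube_params sigma s eps)).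
Qed.

Let refl_volume (B : set (mR * (mR * mR))) : measurable B ->
  lebesgue12 ((fun x : mR * (mR * mR) => (d - x.1, x.2)) @^-1` B) = lebesgue12 B.
Proof.
move=> mB; have mrefl : measurable_fun setT (fun x : mR * (mR * mR) =>
    (d - x.1, x.2) : mR * (mR * mR)) by measurability.
rewrite (measure_integral_indic lebesgue12 mB) -(@ge0_integral12_affine _ (-1) d); last 3 first.
- by rewrite normrN normr1.
- exact/measurable_EFinP/measurable_indic.
- by move=> x; rewrite lee_fin.
rewrite measure_integral_indic; last by rewrite -[X in measurable X]setTI; exact: mrefl.
apply: eq_integral => -[t u] _; rewrite !indicE; congr (_%:R%:E).
by rewrite /= mulN1r addrC.
Qed.

Lemma slab_law_start (A : set (mspace3 R)) : measurable A ->
  (lebesgue3 (A `&` slab 0) / lebesgue3 (slab 0))%E =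
  params_law sigma eps ((fun x => arc_map c v1 v2 sigma x.1 x.2) @^-1` A).
Proof.
move=> mA; have s0 : (0 : R) = 0 \/ (0 : R) = d by left.
rewrite (slab_volume s0 mA) (slab_volumeT s0) (params_lawE sigma0 eps0).
by rewrite (setIC (tube_params sigma 0 eps)).
Qed.

(** The parameters of this slab are centred at d. The volume preserving reflection t -> d - t brings
    them to those of the slab at 0, so one law serves both ends. *)
Lemma slab_law_end (A : set (mspace3 R)) : measurable A ->
  (lebesgue3 (A `&` slab d) / lebesgue3 (slab d))%E =
  params_law sigma eps ((fun x => arc_map c v1 v2 sigma (d - x.1) x.2) @^-1` A).
Proof.
move=> mA; have sd : d = 0 \/ d = d by right.
rewrite (slab_volume sd mA) (slab_volumeT sd) (params_lawE sigma0 eps0).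
have mO := measurable_tube_params sigma d eps.
have mXA : measurable ((fun x : mR * (mR * mR) => arc_map c v1 v2 sigma x.1 x.2 : mspace3 R) @^-1` A).
  by rewrite -[X in measurable X]setTI; exact: (measurable_arc_map ra v1 v2 sigma).
have reflE : (fun x : mR * (mR * mR) => (d - x.1, x.2)) @^-1` tube_params sigma d eps =
    tube_params sigma 0 eps.
  apply/seteqP; split=> -[t u] [/= h1 h2]; split=> //=; move: h1;
    by rewrite /= subr0 addrC addKr normrN.
rewrite -(refl_volume (measurableI _ _ mO mXA)) -(refl_volume mO) preimage_setI reflE.
by rewrite (setIC (tube_params sigma 0 eps)).
Qed.
End tube_law.

Theorem theorem3p10 (R : realType) (delta0 : R) (gamma : R -> space3 R) :
  let I : set R := [set t | - delta0 < t < delta0] in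
  let x0 := gamma 0 in
  let rho := (enorm (gamma^`(2) 0))^-1 in
  0 < delta0 ->
  smooth_on I gamma ->
  unit_speed_on I gamma ->
  embedding_on I gamma ->
  (forall t, I t -> gamma^`(2) t <> 0) ->
  exists C delta1 : R, [/\ 0 < C, 0 < delta1 <= delta0 &
    forall delta sigma eps : R,
      0 < delta < delta1 -> 0 < sigma -> 0 < eps ->
      Num.max sigma eps <= delta / 4 ->
      let y := gamma delta in
      (`| W1 (tube_measure I gamma sigma eps x0)
             (tube_measure I gamma sigma eps y)
          - (enorm (x0 - y) *
             (1 + sigma ^+ 2 / (4 * rho ^+ 2) - eps ^+ 2 / (6 * rho ^+ 2)))%:E |
        <= (C * delta ^+ 4)%:E)%E].
Proof.
move=> I x0 rho delta00 smooth unit emb _.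
have [c [r [K' [ra' rd cE]]]] := exists_regular_arc delta00 smooth unit.
(* With K >= 1, lower powers of K are absorbed by higher ones in the error terms. *)
pose K := K' + 1.
have K1 : 1 <= K by rewrite lerDr (ra_K ra').
have {ra'}ra : regular_arc c r K by apply: regular_arcW ra'; rewrite lerDl.
have [r1 r10 ballE] := tube_ballE delta00 smooth unit emb ra rd cE.
have r0 := ra_r ra.
have K0 : 0 < K by exact: lt_le_trans K1.
have zr : `|0 : R| < r by rewrite normr0.
have [v1 [v2 fr0]] := exists_frame (ra_unit ra zr).
(* The bound 1 compares powers of delta; r / 2 keeps both neighbourhoods in the regular range; r1 /
   2 gives delta + eps + sigma < r1 for [tube_ballE]; the last makes the tubes thin with respect to
   the curvature. *)
pose delta1 := Num.min (Num.min 1 (r / 2)) (Num.min (r1 / 2) (64 * K ^+ 2)^-1).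
have delta10 : 0 < delta1.
  by rewrite !lt_min ltr01 !divr_gt0// invr_gt0 mulr_gt0// exprn_gt0.
exists (26 * K ^+ 3 + 4 * (50 * K ^+ 2) ^+ 2), delta1; split.
- by rewrite addr_gt0// mulr_gt0// exprn_gt0// mulr_gt0// exprn_gt0.
- rewrite delta10/=; apply: le_trans rd; rewrite !ge_min; apply/orP; left; apply/orP; right.
  by rewrite ler_pdivrMr// ler_peMr ?(ltW r0)// ler1n.
move=> d sigma eps /andP[d0]; rewrite !lt_min => /andP[/andP[d1 dr] /andP[dr1 dK]].
move=> sigma0 eps0; rewrite ge_max => /andP[sd ed]; cbv zeta.
set y := gamma d.
have {}dr : 2 * d < r by rewrite mulrC -ltr_pdivlMr.
have Kd : K ^+ 2 * d <= 1 / 64.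
  have K20 : 0 < 64 * K ^+ 2 by rewrite mulr_gt0// exprn_gt0.
  have : d * (64 * K ^+ 2) <= 1 by rewrite -ler_pdivlMr// div1r ltW.
  by rewrite (_ : d * _ = 64 * (K ^+ 2 * d)); [lra | ring].
have ball0 : tube_ball I gamma sigma eps x0 = slab_tube (c 0%N) (c 1%N) 0 eps sigma.
  by apply: ballE => //; rewrite normr0; move: dr1 sd ed d0; lra.
have balld : tube_ball I gamma sigma eps y = slab_tube (c 0%N) (c 1%N) d eps sigma.
  by apply: ballE => //; rewrite gtr0_norm//; move: dr1 sd ed d0; lra.
have c0E t : `|t| <= r -> c 0%N t = gamma t by move=> /cE ->.
have chordE : enorm (x0 - y) = enorm (chord c d).
  rewrite enorm_distC /chord !c0E ?normr0 ?(ltW r0)// gtr0_norm//.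
  by move: dr d0; lra.
have -> : enorm (x0 - y) * (1 + sigma ^+ 2 / (4 * rho ^+ 2) - eps ^+ 2 / (6 * rho ^+ 2)) =
    enorm (chord c d) * (1 + dot (c 2%N 0) (c 2%N 0) * (sigma ^+ 2 / 4 - eps ^+ 2 / 6)).
  rewrite chordE; congr (_ * _).
  rewrite /rho -(cE 2%N) ?normr0 ?(ltW r0)// -sqr_enorm exprVn !invfM invrK.
  by field.
have Kd1 : K * d <= 1 / 64.
  by apply: le_trans Kd; rewrite ler_wpM2r ?(ltW d0)// expr2 ler_peMl// ltW.
apply: (W1_arcs ra fr0 K1 d0 (ltW d1) dr Kd1 sigma0 sd eps0 ed) => A mA.
  rewrite /tube_measure ball0; exact: (slab_law_start ra fr0 K1 d0 dr Kd).
rewrite /tube_measure balld; exact: (slab_law_end ra fr0 K1 d0 dr Kd).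
Qed.
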